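(* Let $k$ be a field, $R=k[x_1,\dots,x_n]$ with $\deg x_i=1$, and let $I\subset R$ be a determinantal ideal of codimension $c\ge1$, i.e. a homogeneous ideal of codimension $c$ generated by the maximal minors of a $t\times(t+c-1)$ homogeneous matrix for some $t\ge1$. For $1\le i\le c$ let $m_i$ and $M_i$ be the minimal and maximal degree shifts at the $i$-th step of the minimal graded free $R$-resolution of $R/I$, and let $e(R/I)$ be the multiplicity of $R/I$. Then $$\frac{\prod_{i=1}^c m_i}{c!}\le e(R/I)\le \frac{\prod_{i=1}^c M_i}{c!}.$$
   Context: A homogeneous matrix is a matrix representing a degree-$0$ morphism of free graded $R$-modules; equivalently, there are integers $a_j,b_i$ such that the $(i,j)$ entry is either $0$ or homogeneous of degree $a_j-b_i$. For a graded ideal $I\subset R$ with minimal graded free resolution $0\to\bigoplus_j R(-j)^{\beta_{p,j}}\to\cdots\to\bigoplus_j R(-j)^{\beta_{1,j}}\to R\to R/I\to0$, where $\beta_{i,j}=\operatorname{Tor}_i^R(R/I,k)_j$, one sets $m_i=\min\{j:\beta_{i,j}\ne0\}$ and $M_i=\max\{j:\beta_{i,j}\ne0\}$. *)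

(* Defs.v *)
From HB Require Import structures.
From mathcomp Require Import all_boot all_order all_algebra.
From mathcomp Require Import mpoly.
Set Implicit Arguments. Unset Strict Implicit. Unset Printing Implicit Defensive.
Import Order.TTheory GRing.Theory Num.Theory.
Local Open Scope ring_scope.

Section Defs.
Variables (k : fieldType) (n : nat).
Local Notation R := {mpoly k[n]}.

Definition is_homog (d : nat) (p : R) : bool := p \is @ishomog1 n k d mdeg.

Definition is_homogeneous_matrix (t s : nat) (A : 'M[R]_(t, s)) : Prop :=
  exists (a : 'I_s -> int) (b : 'I_t -> int),
    forall i j, A i j != 0 ->
      exists e : nat, (e%:Z = a j - b i)%R /\ is_homog e (A i j).

(* The ideal generated by the maximal (t x t) minors of A : t x s.
   (Minors \det (colsub f A) over all maps f : 'I_t -> 'I_s; non-injective f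
   give 0, injective ones give +/- the maximal minors, so this is exactly the
   ideal generated by the maximal minors.) *)
Definition maxminor_ideal (t s : nat) (A : 'M[R]_(t, s)) (p : R) : Prop :=
  exists coef : {ffun 'I_t -> 'I_s} -> R,
    p = \sum_(f : {ffun 'I_t -> 'I_s}) coef f * \det (colsub f A).

Definition indep_mod (I : R -> Prop) (d s : nat) (p : 'I_s -> R) : Prop :=
  (forall a, is_homog d (p a)) /\
  forall cf : 'I_s -> k, I (\sum_(a < s) cf a *: p a) -> forall a, cf a = 0.

Definition hilbert_function (I : R -> Prop) (H : nat -> nat) : Prop :=
  forall d, (exists p : 'I_(H d) -> R, indep_mod I d p) /\
            (forall s (p : 'I_s -> R), indep_mod I d p -> (s <= H d)%N).

Definition hilbert_samuel_poly (H : nat -> nat) (Q : {poly rat}) : Prop :=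
  exists d0 : nat, forall d : nat, (d0 <= d)%N ->
    ((\sum_(j < d.+1) H j)%N)%:R = Q.[d%:R].

(* Multiplicity e(R/I) = (deg Q)! * lead_coef Q, where deg Q = dim R/I. *)
Definition multiplicity (Q : {poly rat}) : rat :=
  ((size Q).-1)`!%:R * lead_coef Q.

(* A minimal graded free resolution of R/I:
     ... -> F_2 --phi 1--> F_1 --phi 0--> F_0 = R -> R/I -> 0
   F_i = (+)_{a < r i} R(-d i a); phi i : F_{i+1} -> F_i is the matrix
   'M_(r i, r i.+1) acting on column vectors. *)
Definition min_graded_free_res (I : R -> Prop) (r : nat -> nat)
    (d : forall i, 'I_(r i) -> nat) (phi : forall i, 'M[R]_(r i, r i.+1)) : Prop :=
  r 0 = 1%N /\ (forall a, d 0 a = 0%N) /\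
  [/\
      (* degree-0 morphisms: entry (a,b) of phi i homogeneous of degree
         d (i+1) b - d i a (and 0 if that degree would be negative) *)
      (forall i a b, is_homog (d i.+1 b - d i a) (phi i a b) /\
                     (phi i a b != 0 -> (d i a <= d i.+1 b)%N)),
      (* minimality: all entries lie in the homogeneous maximal ideal *)
      (forall i a b, mcoeff 0%MM (phi i a b) = 0),
      (forall p : R, I p <-> exists v : 'cV[R]_(r 1), forall a, (phi 0 *m v) a ord0 = p) &
      (forall i (v : 'cV[R]_(r i.+1)),
          phi i *m v = 0 <-> exists w : 'cV[R]_(r i.+2), v = phi i.+1 *m w)].

Definition maxshift (r : nat -> nat) (d : forall i, 'I_(r i) -> nat) (i : nat) : nat :=
  \max_(a < r i) d i a.
Definition minshift (r : nat -> nat) (d : forall i, 'I_(r i) -> nat) (i : nat) : nat :=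
  \big[minn/maxshift d i]_(a < r i) d i a.

End Defs.

(* Main.v *)
Require Import Defs.
From HB Require Import structures.
From mathcomp Require Import all_boot all_order all_algebra all_fingroup.
From mathcomp Require Import mpoly.
From mathcomp Require Import zify ring lra.
From Stdlib Require Import Classical.
Import Order.TTheory GRing.Theory Num.Theory.
Set Implicit Arguments. Unset Strict Implicit. Unset Printing Implicit Defensive.
Local Open Scope ring_scope.

(* After cancelling unit entries by row operations, the Eagon-Northcott complex
   of the matrix is the minimal free resolution of R/I.  Its differential is built
   from the contractions by the rows of the matrix on an exterior algebra; wedging
   with the columns of the adjugate of a maximal submatrix shows that a power of
   each maximal minor kills the homology modulo every ideal.  Noether normalization
   provides c elements with that property which form a regular sequence, and a
   complex of length c killed in this way is exact.  The same argument applied to a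
   smaller block shows that, with columns and rows sorted by degrees a_0 <= a_1 <= ...
   and b_0 <= b_1 <= ..., the diagonal degrees a_i - b_i are positive.

   The Hilbert series of the resolution gives e(R/I) = E(t,c), where
     E(t+1,c+1) = E(t,c+1) + (a_(t+c) - b_t) E(t+1,c),  E(t,0) = 1,  E(0,c+1) = 0,
   in whatever order rows and columns are listed, as long as the factors are
   nonnegative.  With m_c = a_0 + ... + a_(t+c-2) - b_0 - ... - b_(t-1) - (c-1) b_(t-1),
   a double induction gives c E(t,c) >= m_c E(t,c-1) for increasing degrees and
   c E(t,c) <= m_c E(t,c-1) for decreasing ones; these m_c are degree shifts of the
   resolution, namely its extremal ones. *)

(** * Degrees of determinantal ideals *)

(** The codimension is given only through the degree of the Hilbert-Samuel polynomial. It enters in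
    one way: counting monomials in elements algebraically independent modulo the ideal shows that
    there are at most n - c of them, so that normalization must produce at least c regular elements.
    Homology is killed modulo every ideal, and not only for the complex itself, because exactness is
    proved along a regular sequence by cancelling one element at a time; the elements that kill
    homology in this strong sense form an ideal, to which normalization applies directly. The
    recursion for E(t,c) is not visibly symmetric in the degrees, yet its value is the multiplicity
    for every admissible listing, so each bound can use the order in which its induction closes; in
    the opposite order the comparisons of consecutive degrees have the wrong sign. Positive diagonal
    degrees make the factors of the recursion nonnegative in both orders. *)

Section DegreeNumber.
Variables (a b : nat -> int).

(** The recursion lowers [t] for fixed [c], or [c] for fixed [t]; the nested [fix] makes this
    lexicographic descent structural. *)
Fixpoint detdeg (t c : nat) {struct t} : int :=
  if t is t'.+1 then
    (fix aux c := if c is c'.+1 then detdeg t' c'.+1 + (a (t' + c')%N - b t') * aux c'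
                  else 1) c
  else (c == 0%N)%:R.

Lemma detdegn0 t : detdeg t 0 = 1.
Proof. by case: t. Qed.

Lemma detdeg0S c : detdeg 0 c.+1 = 0.
Proof. by []. Qed.

Lemma detdegSS t c :
  detdeg t.+1 c.+1 = detdeg t c.+1 + (a (t + c)%N - b t) * detdeg t.+1 c.
Proof. by []. Qed.

Lemma detdeg_ge0 t c : (forall i l, (i < t)%N -> (l < c)%N -> b i <= a (i + l)%N) ->
  0 <= detdeg t c.
Proof.
elim: t c => [|t IHt] c hab; first by case: c hab.
elim: c hab => [|c IHc] hab; first by [].
rewrite detdegSS addr_ge0 ?mulr_ge0 ?subr_ge0 ?hab //.
  by apply: IHt => i l hi hl; apply: hab => //; lia.
by apply: IHc => i l hi hl; apply: hab => //; lia.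
Qed.

(* The degree of the generator of the [c]-th Eagon-Northcott module of the
   leading [t x (t+c-1)] block in which the row [t-1] is repeated. *)
Definition extshift (t c : nat) : int :=
  \sum_(j < (t + c).-1) a j - \sum_(i < t) b i - (c.-1)%:R * b t.-1.

Lemma extshiftSS t c :
  extshift t.+1 c.+2 = extshift t.+1 c.+1 + (a (t + c.+1)%N - b t).
Proof.
rewrite /extshift !addSn /= addnS big_ord_recr /= -[c.+1]addn1 natrD; ring.
Qed.

(** Both blocks have t + c + 2 columns, so only the row terms differ, by (c+1)(b_(t+1) - b_t), whose
    sign is given by the sorting order. *)
Lemma extshift_row t c :
  extshift t.+1 c.+2 = extshift t.+2 c.+1 + b t.+1 + c.+1%:R * (b t.+1 - b t) - b t.+1.
Proof.
rewrite /extshift !addSn !addnS /= !big_ord_recr /=.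
rewrite -[c.+1]addn1 natrD; ring.
Qed.

Lemma detdegn1 t : detdeg t.+1 1 = extshift t.+1 1.
Proof.
elim: t => [|t IH].
  by rewrite detdegSS detdeg0S detdegn0 /extshift !big_ord_recr !big_ord0 /=; ring.
rewrite detdegSS IH detdegn0 /extshift !addn1 !addn0 /= !big_ord_recr /=; ring.
Qed.

Lemma detdeg_lower t c :
  {homo a : i j / (i <= j)%N >-> i <= j} -> {homo b : i j / (i <= j)%N >-> i <= j} ->
  (forall i, (i < t)%N -> b i <= a i) ->
  extshift t c.+1 * detdeg t c <= c.+1%:R * detdeg t c.+1.
Proof.
move=> ma mb; elim: t c => [|t IHt] c hab.
  by case: c => [|c]; rewrite ?detdeg0S ?mulr0 // /extshift !big_ord0 /=; lia.
have hab' i l : (i < t.+1)%N -> b i <= a (i + l)%N.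
  by move=> hi; apply: le_trans (hab _ hi) (ma _ _ (leq_addr _ _)).
have E0 t' c' : (t' <= t.+1)%N -> 0 <= detdeg t' c'.
  by move=> ht'; apply: detdeg_ge0 => i l hi _; apply: hab'; lia.
elim: c => [|c IHc].
  rewrite detdegn0 mulr1 mul1r.
  by rewrite detdegn1.
rewrite [detdeg t.+1 c.+2]detdegSS.
set u := detdeg t.+1 c.+1 in IHc *; set V := detdeg t.+1 c in IHc.
set mu := extshift t.+1 c.+1 in IHc.
have u0 : 0 <= u by apply: E0.
have V0 : 0 <= V by apply: E0.
have hf : b t <= a (t + c)%N by apply: hab'.
have hf' : a (t + c)%N <= a (t + c.+1)%N by apply: ma; lia.
rewrite extshiftSS -/mu.
(* Once E(t+1,c+2) and its shift are expanded, the new factor a_(t+c+1) - b_t may be lowered to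
   a_(t+c) - b_t, and this inequality remains. For one row it holds because the mean of a_0, ...,
   a_c is at most a_c. Otherwise, with u = W + (a - b)V, the inner hypothesis cancels the V-part; mu
   W is left, and the hypothesis for one row fewer bounds it because [b] increases. *)
have key : (mu - c.+1%:R * (a (t + c)%N - b t)) * u <= c.+2%:R * detdeg t c.+2.
  case: t => [|t] in IHt hab hab' E0 @u @V @mu u0 V0 IHc hf hf' *.
    rewrite detdeg0S mulr0.
    have : u = (a c - b 0%N) * V by rewrite /u detdegSS detdeg0S; ring.
    have: mu <= c.+1%:R * (a c - b 0%N).
      have: \sum_(j < c.+1) a j <= \sum_(j < c.+1) a c by apply: ler_sum => j _; apply: ma; rewrite -ltnS.
      rewrite /mu /extshift /= big_ord1 sumr_const card_ord -mulr_natr.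
      rewrite -[c.+1]addn1 natrD => hs; nra.
    rewrite !add0n; nra.
  set W := detdeg t.+1 c.+1.
  have W0 : 0 <= W by apply: E0.
  have uE : u = W + (a (t.+1 + c)%N - b t.+1) * V by rewrite /u detdegSS.
  have := IHt c.+1 (fun i hi => hab i (leqW hi)).
  rewrite -/W extshift_row -/mu.
  have : b t <= b t.+1 by apply: mb.
  have : (0 : int) <= c.+1%:R by lia.
  move: (c.+1%:R : int) (c.+2%:R : int) (detdeg t.+1 c.+2) uE W0 V0 u0 IHc hf hf' => C C2 D -> {u}.
  move: (b t.+1) (b t) (a (t.+1 + c)%N) => b1 b0 a0 W0 V0 u0 IHc hf hf' C0 hb H1.
  have h1 : 0 <= C * (b1 - b0) * W by rewrite !mulr_ge0 //; lra.
  have h2 : 0 <= (a0 - b1) * (C * (W + (a0 - b1) * V) - mu * V) by rewrite mulr_ge0 //; lra.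
  nra.
have C2E : c.+2%:R = c.+1%:R + 1 :> int by rewrite -[c.+2]addn1 natrD.
rewrite C2E in key *.
move: (detdeg t c.+2) key => D key.
clearbody u mu V.
have : 0 <= (c.+1%:R * (a (t + c.+1)%N - a (t + c)%N)) * u :> int by rewrite !mulr_ge0 //; lia.
nra.
Qed.

(** Mirror image of [detdeg_lower]: every comparison reverses with the order. As the columns now
    decrease, nonnegativity of the factors is asked at the last column involved, [i + c]. *)
Lemma detdeg_upper t c :
  {homo a : i j / (i <= j)%N >-> j <= i} -> {homo b : i j / (i <= j)%N >-> j <= i} ->
  (forall i, (i < t)%N -> b i <= a (i + c)%N) ->
  c.+1%:R * detdeg t c.+1 <= extshift t c.+1 * detdeg t c.
Proof.
move=> ma mb; elim: t c => [|t IHt] c hab.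
  by case: c hab => [|c] hab; rewrite ?detdeg0S ?mulr0 // /extshift !big_ord0 /=; lia.
have hab' i l : (i < t.+1)%N -> (l <= c)%N -> b i <= a (i + l)%N.
  by move=> hi hl; apply: le_trans (hab _ hi) (ma _ _ _); rewrite leq_add2l.
have E0 t' c' : (t' <= t.+1)%N -> (c' <= c.+1)%N -> 0 <= detdeg t' c'.
  by move=> ht' hc'; apply: detdeg_ge0 => i l hi hl; apply: hab'; lia.
elim: c hab hab' E0 => [|c IHc] hab hab' E0.
  by rewrite detdegn0 mulr1 mul1r detdegn1.
rewrite [detdeg t.+1 c.+2]detdegSS.
have {}IHc : c.+1%:R * detdeg t.+1 c.+1 <= extshift t.+1 c.+1 * detdeg t.+1 c.
  apply: IHc => [i hi|i l hi hl|t' c' ht' hc']; [apply: hab' => //; lia|apply: hab' => //; lia|].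
  by apply: E0 => //; lia.
set u := detdeg t.+1 c.+1 in IHc *; set V := detdeg t.+1 c in IHc.
set mu := extshift t.+1 c.+1 in IHc.
have u0 : 0 <= u by apply: E0.
have V0 : 0 <= V by apply: E0 => //; lia.
have hf : b t <= a (t + c)%N by apply: hab'.
have hf' : a (t + c.+1)%N <= a (t + c)%N by apply: ma; lia.
rewrite extshiftSS -/mu.
have key : c.+2%:R * detdeg t c.+2 <= (mu - c.+1%:R * (a (t + c)%N - b t)) * u.
  case: t => [|t] in IHt hab hab' E0 @u @V @mu u0 V0 IHc hf hf' *.
    rewrite detdeg0S mulr0.
    have : c.+1%:R * (a c - b 0%N) <= mu.
      have: \sum_(j < c.+1) a c <= \sum_(j < c.+1) a j.
        by apply: ler_sum => j _; apply: ma; rewrite -ltnS.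
      rewrite /mu /extshift /= big_ord1 sumr_const card_ord -mulr_natr.
      rewrite -[c.+1]addn1 natrD => hs; nra.
    move: u0; rewrite !add0n; nra.
  set W := detdeg t.+1 c.+1.
  have W0 : 0 <= W by apply: E0 => //; lia.
  have uE : u = W + (a (t.+1 + c)%N - b t.+1) * V by rewrite /u detdegSS.
  have := IHt c.+1 (fun i hi => hab i (leqW hi)).
  rewrite -/W extshift_row -/mu.
  have : b t.+1 <= b t by apply: mb.
  have : (0 : int) <= c.+1%:R by lia.
  move: (c.+1%:R : int) (c.+2%:R : int) (detdeg t.+1 c.+2) uE W0 V0 u0 IHc hf hf' => C C2 D -> {u}.
  move: (b t.+1) (b t) (a (t.+1 + c)%N) => b1 b0 a0 W0 V0 u0 IHc hf hf' C0 hb H1.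
  have h1 : 0 <= C * (b0 - b1) * W by rewrite !mulr_ge0 //; lra.
  have h2 : 0 <= (a0 - b1) * (mu * V - C * (W + (a0 - b1) * V)) by rewrite mulr_ge0 //; lra.
  nra.
have C2E : c.+2%:R = c.+1%:R + 1 :> int by rewrite -[c.+2]addn1 natrD.
rewrite C2E in key *.
move: (detdeg t c.+2) key => D key.
clearbody u mu V.
have : 0 <= (c.+1%:R * (a (t + c)%N - a (t + c.+1)%N)) * u :> int by rewrite !mulr_ge0 //; lia.
nra.
Qed.

Lemma fact_detdeg_lower t c :
  {homo a : i j / (i <= j)%N >-> i <= j} -> {homo b : i j / (i <= j)%N >-> i <= j} ->
  (forall i, (i < t)%N -> b i <= a i) ->
  (forall l, (l < c)%N -> 0 <= extshift t l.+1) ->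
  \prod_(l < c) extshift t l.+1 <= c`!%:R * detdeg t c.
Proof.
move=> ma mb hab; elim: c => [|c IHc] hM; first by rewrite big_ord0 detdegn0.
rewrite big_ord_recr /= factS natrM.
have {}IHc := IHc (fun l hl => hM l (leqW hl)).
have h1 := ler_wpM2r (hM c (ltnSn c)) IHc.
have f0 : (0 : int) <= c`!%:R by [].
have := ler_wpM2l f0 (detdeg_lower c ma mb hab).
lra.
Qed.

Lemma fact_detdeg_upper t c :
  {homo a : i j / (i <= j)%N >-> j <= i} -> {homo b : i j / (i <= j)%N >-> j <= i} ->
  (forall i, (i < t)%N -> b i <= a (i + c.-1)%N) ->
  (forall l, (l < c)%N -> 0 <= extshift t l.+1) ->
  c`!%:R * detdeg t c <= \prod_(l < c) extshift t l.+1.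
Proof.
move=> ma mb; elim: c => [|c IHc] hab hM; first by rewrite big_ord0 detdegn0.
rewrite big_ord_recr /= factS natrM.
have {}IHc : c`!%:R * detdeg t c <= \prod_(l < c) extshift t l.+1.
  apply: IHc => [i hi|l hl]; last by apply: hM; apply: leqW.
  by apply: le_trans (hab i hi) (ma _ _ _); case: (c) => //= c'; lia.
have h1 := ler_wpM2r (hM c (ltnSn c)) IHc.
have f0 : (0 : int) <= c`!%:R by [].
have := ler_wpM2l f0 (detdeg_upper ma mb hab).
lra.
Qed.

End DegreeNumber.

(** * Ideals and regular sequences *)

Section Ideals.
Variable R : comNzRingType.
Implicit Types (I : R -> Prop) (s : seq R).

Definition is_ideal I :=
  [/\ I 0, forall x y, I x -> I y -> I (x + y) & forall r x, I x -> I (r * x)].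

Lemma ideal0 I : is_ideal I -> I 0. Proof. by case. Qed.
Lemma idealD I x y : is_ideal I -> I x -> I y -> I (x + y). Proof. by case=> _ h _; apply: h. Qed.
Lemma idealM I r x : is_ideal I -> I x -> I (r * x). Proof. by case=> _ _; apply. Qed.
Lemma idealN I x : is_ideal I -> I x -> I (- x).
Proof. by move=> hI hx; rewrite -mulN1r; apply: idealM. Qed.
Lemma idealB I x y : is_ideal I -> I x -> I y -> I (x - y).
Proof. by move=> hI hx hy; apply: idealD => //; apply: idealN. Qed.
Lemma ideal_sum I (T : Type) (r : seq T) (P : pred T) (F : T -> R) :
  is_ideal I -> (forall i, P i -> I (F i)) -> I (\sum_(i <- r | P i) F i).
Proof. by move=> hI hF; apply: (big_ind I) => //; [apply: ideal0|move=> x y; apply: idealD]. Qed.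

(** The ideal generated by [s], unfolded one generator at a time so that proofs go by induction on
    the list. *)
Fixpoint idl s (p : R) : Prop :=
  if s is f :: s' then exists r, idl s' (p - r * f) else p = 0.

(* The sequence is read from right to left: the head is regular modulo the tail. *)
Fixpoint regseq s : Prop :=
  if s is f :: s' then regseq s' /\ (forall g, idl s' (f * g) -> idl s' g) else True.

Lemma idl_ideal s : is_ideal (idl s).
Proof.
elim: s => [|f s IH] /=; first by split=> [//|x y -> ->|r x ->]; rewrite ?addr0 ?mulr0.
split=> [|x y [r hr] [r' hr']|r x [r' hr']].
- by exists 0; rewrite mul0r subr0; apply: ideal0.
- by exists (r + r'); rewrite mulrDl opprD addrACA; apply: idealD.
- by exists (r * r'); rewrite -mulrA -mulrBr; apply: idealM.
Qed.

Lemma radical_ideal I : is_ideal I -> is_ideal (fun x => exists N, I (x ^+ N)).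
Proof.
move=> hI; split=> [|x y [N hN] [M hM]|r x [N hN]].
- by exists 1%N; rewrite expr1; apply: ideal0.
- exists (N + M)%N; rewrite exprDn; apply: ideal_sum => // i _.
  rewrite -mulr_natl; apply: idealM => //.
  case: (leqP N (N + M - i)) => h.
    by rewrite -(subnK h) exprD mulrAC; apply: idealM.
  have h' : (M <= i)%N by lia.
  by rewrite -(subnK h') exprD mulrA; apply: idealM.
- by exists N; rewrite exprMn; apply: idealM.
Qed.

End Ideals.

Lemma idl_map (R S : comNzRingType) (th : {rmorphism R -> S}) (ta : {rmorphism S -> R}) s p :
  cancel th ta -> cancel ta th -> idl (map th s) p <-> idl s (ta p).
Proof.
move=> thK taK; elim: s p => [|f s IH] p /=.
  by split=> [->|h]; rewrite ?rmorph0 // -[p]taK h rmorph0.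
split=> [[r /IH]|[r h]].
  by rewrite rmorphB rmorphM thK; exists (ta r).
by exists (th r); apply/IH; rewrite rmorphB rmorphM !thK.
Qed.

Lemma regseq_map (R S : comNzRingType) (th : {rmorphism R -> S}) (ta : {rmorphism S -> R}) s :
  cancel th ta -> cancel ta th -> regseq s -> regseq (map th s).
Proof.
move=> thK taK; elim: s => [//|f s IH] /= [/IH hs hf]; split=> // g.
by move=> /(idl_map _ _ thK taK); rewrite rmorphM thK => /hf /(idl_map _ _ thK taK).
Qed.

Section PolyRegular.
Variable S : idomainType.

Lemma idl_polyC (s : seq S) (q : {poly S}) :
  idl (map polyC s) q <-> forall i, idl s q`_i.
Proof.
elim: s q => [|f s IH] q /=.
  by split=> [-> i|h]; [rewrite coef0|apply/polyP => i; rewrite h coef0].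
split=> [[r /IH h] i|h].
  by exists r`_i; have := h i; rewrite coefB coefMC.
have [r hr] := @fin_all_exists _ _ (fun (i : 'I_(size q)) x => idl s (q`_i - x * f)) (fun i => h i).
exists (\poly_(i < size q) (if insub i is Some j then r j else 0)); apply/IH => i.
rewrite coefB coefMC coef_poly; case: ltnP => hi; first by rewrite insubT; apply: (hr (Ordinal hi)).
by rewrite nth_default // mul0r subr0; exact: ideal0 (idl_ideal s).
Qed.

(** The leading coefficient of f q is a unit times that of q, so the latter lies in [J]; removing
    the leading term of q lowers its size and keeps the hypothesis. *)
Lemma unit_lead_regular (J : S -> Prop) (f q : {poly S}) (u : S) :
  is_ideal J -> u * lead_coef f = 1 -> (forall i, J (f * q)`_i) -> forall i, J q`_i.
Proof.
move=> hJ hu.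
have [m] := ubnP (size q); elim: m q => // m IH q; rewrite ltnS => hm hq.
have [->|q0] := eqVneq q 0; first by move=> i; rewrite coef0; apply: ideal0.
have f0 : f != 0.
  by apply: contra_eq_neq hu => ->; rewrite lead_coef0 mulr0 eq_sym oner_eq0.
have hl : J (lead_coef q).
  rewrite -[lead_coef q]mul1r -hu -mulrA; apply: idealM => //.
  by rewrite -lead_coefM lead_coefE.
pose q' := q - (lead_coef q)%:P * 'X^((size q).-1).
have hq' : forall i, J q'`_i.
  apply: IH => [|i].
    apply: leq_trans hm; rewrite -[ltnRHS]prednK ?size_poly_gt0 // ltnS.
    apply/leq_sizeP => j; rewrite leq_eqVlt => /predU1P[<-|hj].
      by rewrite coefB coefCM coefXn eqxx mulr1 subrr.
    rewrite coefB coefCM coefXn gtn_eqF // mulr0 subr0 nth_default //.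
    by move: hj; rewrite prednK ?size_poly_gt0.
  rewrite mulrBr coefB; apply: idealB => //.
  by rewrite mulrCA coefCM mulrC; apply: idealM.
move=> i; have := hq' i; rewrite coefB coefCM => h.
rewrite -[q`_i](subrK (lead_coef q * ('X^((size q).-1))`_i)); apply: idealD => //.
by rewrite mulrC; apply: idealM.
Qed.

Lemma regseq_polyC_cons (s : seq S) (f : {poly S}) u :
  u * lead_coef f = 1 -> regseq s -> regseq (f :: map polyC s).
Proof.
move=> hu hs; split=> [|q /idl_polyC h]; last first.
  by apply/idl_polyC; apply: unit_lead_regular hu h; apply: idl_ideal.
elim: s hs => [//|g s IH] [/IH hs hg] /=; split=> // q /idl_polyC h.
by apply/idl_polyC => i; apply: hg; rewrite -coefCM.
Qed.
End PolyRegular.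

(** * Nagata's change of variables and Noether normalization *)

Section Nagata.
Variables (k : fieldType) (n : nat).
Local Notation R := {mpoly k[n.+1]}.
Local Notation S := {mpoly k[n]}.

Lemma mpoly_rmorph_eq (m : nat) (T : comNzRingType) (f g : {rmorphism {mpoly k[m]} -> T}) :
  (forall c, f c%:MP = g c%:MP) -> (forall i, f 'X_i = g 'X_i) -> f =1 g.
Proof.
move=> hC hX p; rewrite [p]mpolyE !rmorph_sum; apply: eq_bigr => mm _.
rewrite -mul_mpolyC !rmorphM hC; congr (_ * _).
rewrite mpolyXE_id !rmorph_prod; apply: eq_bigr => i _.
by rewrite !rmorphXn hX.
Qed.

Variable N : nat.
Hypothesis N_gt0 : (0 < N)%N.

(** Nagata's substitution: x_0 becomes the new variable X and x_i becomes x_i + X^(N^i). It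
    separates monomials with exponents below N by their degree in X. *)
Definition nagata_var (i : 'I_n.+1) : {poly S} :=
  if unlift ord0 i is Some j then ('X_j)%:P + 'X^(N ^ i) else 'X.

Definition nagata : R -> {poly S} := mmap (polyC \o mpolyC n (R := k)) nagata_var.
HB.instance Definition _ := GRing.RMorphism.on nagata.

Definition nagata_inv0 : S -> R :=
  mmap (mpolyC n.+1 (R := k)) (fun j => 'X_(lift ord0 j) - 'X_ord0 ^+ (N ^ j.+1)).
HB.instance Definition _ := GRing.RMorphism.on nagata_inv0.

Definition nagata_inv (q : {poly S}) : R := (map_poly nagata_inv0 q).['X_ord0].
Lemma nagata_inv_is_additive : additive nagata_inv.
Proof. by move=> p q; rewrite /nagata_inv rmorphB hornerD hornerN. Qed.
Lemma nagata_inv_is_multiplicative : multiplicative nagata_inv.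
Proof. by split=> [p q|]; rewrite /nagata_inv ?rmorphM ?hornerM ?rmorph1 ?hornerC. Qed.
HB.instance Definition _ := GRing.isAdditive.Build _ _ nagata_inv nagata_inv_is_additive.
HB.instance Definition _ := GRing.isMultiplicative.Build _ _ nagata_inv nagata_inv_is_multiplicative.

Lemma nagata_invC g : nagata_inv g%:P = nagata_inv0 g.
Proof. by rewrite /nagata_inv map_polyC hornerC. Qed.
Lemma nagata_invX : nagata_inv 'X = 'X_ord0.
Proof. by rewrite /nagata_inv map_polyX hornerX. Qed.
Lemma nagataC c : nagata c%:MP = c%:MP%:P.
Proof. by rewrite /nagata mmapC. Qed.
Lemma nagataX i : nagata 'X_i = nagata_var i.
Proof. by rewrite /nagata mmapX mmap1U. Qed.
Lemma nagata_var0 : nagata_var ord0 = 'X.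
Proof. by rewrite /nagata_var unlift_none. Qed.
Lemma nagata_varS j : nagata_var (lift ord0 j) = ('X_j)%:P + 'X^(N ^ j.+1).
Proof. by rewrite /nagata_var liftK. Qed.

Lemma nagataK : cancel nagata nagata_inv.
Proof.
apply: (@mpoly_rmorph_eq _ _ (nagata_inv \o nagata) idfun) => [c|i] /=.
  by rewrite nagataC nagata_invC /nagata_inv0 mmapC.
rewrite nagataX; case: (unliftP ord0 i) => [j|] ->; rewrite ?nagata_var0 ?nagata_invX //.
by rewrite nagata_varS rmorphD rmorphXn /= nagata_invC nagata_invX /nagata_inv0 mmapX mmap1U subrK.
Qed.

Lemma nagata_inv0K g : nagata (nagata_inv0 g) = g%:P.
Proof.
move: g; apply: (@mpoly_rmorph_eq _ _ (nagata \o nagata_inv0) polyC) => [c|j] /=.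
  by rewrite /nagata_inv0 mmapC nagataC.
by rewrite /nagata_inv0 mmapX mmap1U rmorphB rmorphXn /= !nagataX nagata_var0 nagata_varS addrK.
Qed.

Lemma nagata_invK : cancel nagata_inv nagata.
Proof.
elim/poly_ind=> [|q c IH]; first by rewrite !rmorph0.
rewrite [nagata_inv _]rmorphD /= [nagata_inv (_ * _)]rmorphM /= nagata_invX nagata_invC.
by rewrite rmorphD rmorphM /= IH nagataX nagata_var0 nagata_inv0K.
Qed.

(** The X-degree of the image of a monomial; when all exponents are below [N], they are its base-[N]
    digits. *)
Definition nagata_wgt (m : 'X_{1..n.+1}) : nat := (\sum_(i < n.+1) m i * N ^ i)%N.

Lemma nagata_wgt_inj (m1 m2 : 'X_{1..n.+1}) : (forall i, m1 i < N)%N -> (forall i, m2 i < N)%N ->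
  nagata_wgt m1 = nagata_wgt m2 -> m1 = m2.
Proof.
rewrite /nagata_wgt => h1 h2 h; apply/mnmP.
move: (n.+1) (fun_of_multinom m1) (fun_of_multinom m2) h1 h2 h.
elim=> [|r IH] f g hf hg h i; first by case: i.
move: h; rewrite !big_ord_recl /= !expn0 !muln1.
have e (ff : 'I_r.+1 -> nat) : (\sum_(i0 < r) ff (lift ord0 i0) * N ^ bump 0 i0
   = (\sum_(i0 < r) ff (lift ord0 i0) * N ^ i0) * N)%N.
  by rewrite big_distrl /=; apply: eq_bigr => j _; rewrite /bump add1n expnS mulnA mulnAC.
rewrite !e => h.
have e0 : f ord0 = g ord0.
  by move/(congr1 (modn^~ N)): (h); rewrite !(addnC _ (_ * N))%N !modnMDl !modn_small.
move: h; rewrite e0 => /addnI /eqP; rewrite eqn_pmul2r // => /eqP h.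
by case: (unliftP ord0 i) => [j|] -> //; apply: (IH (f \o lift ord0) (g \o lift ord0)) => //= x.
Qed.

Lemma nagata_var_monic i : nagata_var i \is monic /\ size (nagata_var i) = (N ^ i).+1.
Proof.
case: (unliftP ord0 i) => [j|] ->; last by rewrite nagata_var0 monicX size_polyX expn0.
rewrite nagata_varS lift0.
have hs : (size ('X_j : S)%:P < size ('X^(N ^ j.+1) : {poly S}))%N.
  by rewrite size_polyXn (leq_ltn_trans (size_polyC_leq1 _)) // ltnS expn_gt0 N_gt0.
rewrite monicE addrC lead_coefDl // lead_coefXn eqxx.
by rewrite size_polyDl // size_polyXn.
Qed.

Lemma nagata_mon m : nagata 'X_[m] \is monic /\ size (nagata 'X_[m]) = (nagata_wgt m).+1.
Proof.
rewrite /nagata mmapX /mmap1 /nagata_wgt.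
elim: (index_enum _) => [|i r [IH1 IH2]]; first by rewrite !big_nil monic1 size_poly1.
rewrite !big_cons; have [m1 s1] := nagata_var_monic i.
have m2 : nagata_var i ^+ m i \is monic by apply: monic_exp.
split; first by rewrite monicMl.
rewrite size_Mmonic ?monic_neq0 // IH2 addnS /= -[size _]prednK ?size_poly_gt0 ?monic_neq0 //.
by rewrite size_exp s1 /= mulnC addSn.
Qed.

(** All exponents of [p] are below [N], so its monomials have distinct weights and the heaviest one
    alone contributes the leading term; the coefficient is a nonzero scalar, hence a unit. *)
Lemma nagata_lead (p : R) : p != 0 -> (msize p <= N)%N ->
  exists2 c : k, c != 0 & lead_coef (nagata p) = c%:MP.
Proof.
move=> p0 hN.
have hin m i : m \in msupp p -> (m i < N)%N.
  move=> /msize_mdeg_lt h; apply: leq_ltn_trans (leq_trans h hN).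
  by rewrite mdegE (bigD1 i) //= leq_addr.
have [ms hms hmax] : exists2 ms, ms \in msupp p & forall m, m \in msupp p ->
    (nagata_wgt m <= nagata_wgt ms)%N.
  have := mlead_supp p0; move: (msupp p) (mlead p) => s m0 hm0 {hin}.
  elim: s m0 hm0 => // x s IH m0 _.
  case: s IH => [_|y s IH].
    by exists x => [|m]; rewrite inE // => /eqP ->.
  have [ms h1 h2] := IH y (mem_head _ _).
  case: (leqP (nagata_wgt x) (nagata_wgt ms)) => hx.
    by exists ms => [|m]; rewrite inE ?h1 ?orbT // => /predU1P[->|/h2].
  exists x => [|m]; rewrite inE ?eqxx // => /predU1P[->//|/h2 h].
  exact: leq_trans h (ltnW hx).
exists p@_ms; first by rewrite -mcoeff_msupp.
have cE i : (nagata p)`_i = \sum_(m <- msupp p) (p@_m)%:MP * (nagata 'X_[m])`_i.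
  rewrite {1}[p]mpolyE rmorph_sum coef_sum; apply: eq_bigr => m _.
  by rewrite -mul_mpolyC rmorphM /= nagataC coefCM.
have c1 : (nagata p)`_(nagata_wgt ms) = (p@_ms)%:MP.
  rewrite cE (bigD1_seq ms) ?msupp_uniq //= big1_seq ?addr0.
    have [+ s1] := nagata_mon ms; rewrite monicE lead_coefE s1 /= => /eqP ->.
    by rewrite mulr1.
  move=> m /andP[hm hin']; rewrite nth_default ?mulr0 //.
  have [_ ->] := nagata_mon m.
  rewrite ltn_neqAle hmax // andbT; apply: contra hm => /eqP h.
  by apply/eqP; apply: nagata_wgt_inj h => i; apply: hin.
rewrite lead_coefE -c1; congr _`_ _.
apply/eqP; rewrite eqn_leq; apply/andP; split.
  rewrite -subn1 leq_subLR add1n; apply/leq_sizeP => j hj.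
  rewrite cE big1_seq // => m /andP[_ hm]; rewrite nth_default ?mulr0 //.
  by have [_ ->] := nagata_mon m; apply: leq_ltn_trans hj; apply: hmax.
have : (nagata_wgt ms < size (nagata p))%N.
  rewrite ltnNge; apply/negP => h; move: c1; rewrite nth_default //.
  by move/eqP; rewrite eq_sym mpolyC_eq0 => /negP; apply; rewrite mcoeff_eq0 hms.
by move=> h; rewrite -ltnS prednK // (leq_ltn_trans _ h).
Qed.

End Nagata.

Lemma mmap_rmorph (k : fieldType) (m : nat) (S T : comNzRingType) (f : {rmorphism k -> S})
  (y : 'I_m -> S) (g : {rmorphism S -> T}) P :
  g (mmap f y P) = mmap (g \o f) (g \o y) P.
Proof.
apply: (@mpoly_rmorph_eq k m T (g \o mmap f y) (mmap (g \o f) (g \o y))) => [c|i] /=.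
  by rewrite !mmapC.
by rewrite !mmapX !mmap1U.
Qed.

(** A nonzero element of [I], made monic up to a scalar in one variable, is regular modulo anything
    extended from the other variables. The contraction of [I] to those variables supplies the rest
    of the sequence and the elements [y], which stay independent modulo [I]. The equation
    [m + size s = n] turns a bound on independent elements into a length. *)
Lemma noether_regseq (k : fieldType) n (I : {mpoly k[n]} -> Prop) :
  is_ideal I -> ~ I 1 ->
  exists (m : nat) (y : 'I_m -> {mpoly k[n]}) (s : seq {mpoly k[n]}),
    [/\ (m + size s = n)%N, regseq s, forall f, f \in s -> I f &
        forall P : {mpoly k[m]}, I (mmap (mpolyC n (R := k)) y P) -> P = 0].
Proof.
elim: n I => [|n IH] I hI h1.
  exists 0%N, (fun i => 'X_i), [::]; split=> // P.
  rewrite (nvar0_mpolyC P) mmapC => hP; apply/eqP; rewrite mpolyC_eq0; apply/negPn/negP => c0.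
  apply: h1; have -> : 1 = (P@_0%MM)^-1%:MP * (P@_0%MM)%:MP :> {mpoly k[0]}.
    by rewrite -mpolyCM mulVf.
  exact: idealM hP.
have [[p [p0 hp]]|hz] := classic (exists p, p != 0 /\ I p); last first.
  exists n.+1, (fun i => 'X_i), [::]; rewrite addn0; split=> // P.
  have -> : mmap (mpolyC n.+1 (R := k)) (fun i => 'X_i) P = P.
    move: P; apply: (@mpoly_rmorph_eq k n.+1 _ _ idfun) => [c|i] /=; rewrite ?mmapC ?mmapX ?mmap1U //.
  by move=> hP; apply/eqP/negPn/negP => P0; apply: hz; exists P.
have [N N_gt0 hN] : exists2 N, (0 < N)%N & (msize p <= N)%N.
  by exists (msize p) => //; rewrite lt0n msize_poly_eq0.
have [c c0 hc] := nagata_lead N_gt0 p0 hN.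
pose I' (g : {mpoly k[n]}) := I (nagata_inv N g%:P).
have hI' : is_ideal I'.
  split=> [|x y|r x]; rewrite /I' ?rmorph0 ?rmorphD ?rmorphM; [exact: ideal0|exact: idealD|exact: idealM].
have [|m [y [s [e1 e2 e3 e4]]]] := IH I' hI'; first by rewrite /I' !rmorph1.
pose ta := (nagata N : {rmorphism {mpoly k[n.+1]} -> {poly {mpoly k[n]}}}).
pose th := (nagata_inv N : {rmorphism {poly {mpoly k[n]}} -> {mpoly k[n.+1]}}).
exists m, (fun i => th (y i)%:P), (map th (nagata N p :: map polyC s)); split.
- by rewrite /= !size_map addnS e1.
- apply: (@regseq_map _ _ th ta); [exact: nagata_invK|exact: nagataK|].
  by apply: (@regseq_polyC_cons _ _ _ (c^-1)%:MP) => //; rewrite hc -mpolyCM mulVf.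
- move=> f; rewrite inE => /predU1P[->|]; first by rewrite /th /= nagataK.
  by case/mapP => g /mapP[g' hg' ->] ->; apply: e3.
move=> P hP; apply: e4; rewrite /I'.
have := mmap_rmorph (mpolyC n (R := k)) y (th \o polyC) P; rewrite /= => ->.
congr I: hP; apply: eq_bigr => mm _; congr (_ * _).
by rewrite /= /th /= nagata_invC /nagata_inv0 mmapC.
Qed.

(** * The exterior algebra and minors *)

(** The vanishing diagonal is a separate hypothesis because antisymmetry does not imply it in
    characteristic 2. *)
Lemma antisym_sum (V : zmodType) n (F : 'I_n -> 'I_n -> V) :
  (forall p q, F p q = - F q p) -> (forall p, F p p = 0) -> \sum_p \sum_q F p q = 0.
Proof.
move=> hF h0; elim: n F hF h0 => [|n IH] F hF h0; first by rewrite big_ord0.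
rewrite big_ord_recl big_ord_recl h0 add0r.
under [X in _ + X]eq_bigr do rewrite big_ord_recl.
rewrite big_split /= IH // addr0 -big_split /= big1 // => i _.
by rewrite hF addNr.
Qed.

Section Exterior.
Variables (R : comNzRingType) (s : nat).
Local Notation V := {ffun {set 'I_s} -> R^o}.
Implicit Types (x y : V) (J : {set 'I_s}) (a v : 'I_s -> R).

(** An element of [V] lists the coordinates of an exterior form in the basis e_J, J a set of
    columns. This is the sign of moving e_j past the elements of J below j. *)
Definition esgn (j : 'I_s) J : R := (-1) ^+ #|[set i in J | (i < j)%N]|.

Lemma esgnU (i j : 'I_s) J : i \notin J -> esgn j (i |: J) = (-1) ^+ (i < j)%N * esgn j J.
Proof.
move=> hi; rewrite /esgn -exprD; congr (_ ^+ _).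
case: (ltnP i j) => h.
  rewrite (_ : [set _ in _ | _] = i |: [set i0 in J | (i0 < j)%N]) ?cardsU1 ?inE ?(negPf hi) //.
  by apply/setP => l; rewrite !inE; case: eqVneq => // ->; rewrite h.
rewrite add0n; apply: eq_card => l; rewrite !inE; case: eqVneq => // ->.
by rewrite (negPf hi) ltnNge h.
Qed.

Lemma esgn_sqr j J : esgn j J * esgn j J = 1.
Proof. by rewrite /esgn -expr2 sqrr_sign. Qed.

Lemma esgnD1 (i j : 'I_s) J : i \in J -> esgn j J = (-1) ^+ (i < j)%N * esgn j (J :\ i).
Proof. by move=> hi; rewrite -{1}(setD1K hi) esgnU // !inE eqxx. Qed.

Definition econ (j : 'I_s) (x : V) : V :=
  [ffun J : {set 'I_s} => if j \in J then 0 else esgn j J * x (j |: J)].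
Definition ewdg (j : 'I_s) (x : V) : V :=
  [ffun J : {set 'I_s} => if j \in J then esgn j J * x (J :\ j) else 0].

Lemma econ_is_linear j : linear (econ j).
Proof.
move=> r x y; apply/ffunP => J; rewrite !ffunE; case: ifP => _; first by rewrite scaler0 addr0.
by rewrite mulrDr scalerAr.
Qed.
HB.instance Definition _ j := GRing.isLinear.Build R V V _ (econ j) (econ_is_linear j).

Lemma ewdg_is_linear j : linear (ewdg j).
Proof.
move=> r x y; apply/ffunP => J; rewrite !ffunE; case: ifP => _; last by rewrite scaler0 addr0.
by rewrite mulrDr scalerAr.
Qed.
HB.instance Definition _ j := GRing.isLinear.Build R V V _ (ewdg j) (ewdg_is_linear j).

Lemma econ_con0 j x : econ j (econ j x) = 0.
Proof. by apply/ffunP => J; rewrite !ffunE !inE eqxx mulr0 if_same. Qed.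

Lemma econ_conN i j x : econ i (econ j x) = - econ j (econ i x).
Proof.
have [->|ij] := eqVneq i j; first by rewrite econ_con0 oppr0.
apply/ffunP => J; rewrite !ffunE !inE (negPf ij) [j == i]eq_sym (negPf ij) /=.
case: (boolP (i \in J)) => hi; case: (boolP (j \in J)) => hj; rewrite ?mulr0 ?oppr0 //.
rewrite !esgnU // setUCA !mulrA -mulNr; congr (_ * _).
have: (i < j)%N || (j < i)%N by rewrite -neq_ltn.
by case: ltngtP => // _ _; rewrite ?expr0 ?expr1; ring.
Qed.

(** The Clifford relation between contraction and exterior multiplication, the source of the
    homotopy in [edif_htp]. *)
Lemma econ_wdg i j x : econ i (ewdg j x) = (i == j)%:R *: x - ewdg j (econ i x).
Proof.
apply/ffunP => J; rewrite !ffunE !inE.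
have [<-|ij] := eqVneq i j.
  rewrite /= scale1r; case: (boolP (i \in J)) => hi.
    by rewrite setD1K // (esgnD1 i hi) ltnn mul1r mulrA esgn_sqr mul1r subrr.
  by rewrite subr0 esgnU // ltnn mul1r mulrA esgn_sqr mul1r setU1K.
rewrite scale0r add0r /=.
case: (boolP (i \in J)) => hi; case: (boolP (j \in J)) => hj; rewrite ?mulr0 ?oppr0 //=.
have -> : (i |: J) :\ j = i |: (J :\ j).
  by apply/setP => l; rewrite !inE; case: eqVneq => // ->; rewrite eq_sym (negPf ij).
rewrite esgnU // [esgn i J](esgnD1 i hj) !mulrA -mulNr; congr (_ * _).
have: (i < j)%N || (j < i)%N by rewrite -neq_ltn.
by case: ltngtP => // _ _; rewrite ?expr0 ?expr1; ring.
Qed.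

Definition kap a (x : V) : V := \sum_j a j *: econ j x.
Definition lam v (x : V) : V := \sum_j v j *: ewdg j x.

Lemma kap_is_linear a : linear (kap a).
Proof.
move=> r x y; rewrite /kap scaler_sumr -big_split; apply: eq_bigr => j _ /=.
by rewrite linearP scalerDr !scalerA mulrC.
Qed.
HB.instance Definition _ a := GRing.isLinear.Build R V V _ (kap a) (kap_is_linear a).

Lemma lam_is_linear v : linear (lam v).
Proof.
move=> r x y; rewrite /lam scaler_sumr -big_split; apply: eq_bigr => j _ /=.
by rewrite linearP scalerDr !scalerA mulrC.
Qed.
HB.instance Definition _ v := GRing.isLinear.Build R V V _ (lam v) (lam_is_linear v).

Lemma kap_kapE a a' x : kap a (kap a' x) = \sum_i \sum_j (a i * a' j) *: econ i (econ j x).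
Proof.
rewrite /kap; apply: eq_bigr => i _; rewrite linear_sum scaler_sumr.
by apply: eq_bigr => j _; rewrite linearZ scalerA.
Qed.

Lemma kap_kap0 a x : kap a (kap a x) = 0.
Proof.
rewrite kap_kapE antisym_sum // => [i j|i]; last by rewrite econ_con0 scaler0.
by rewrite econ_conN scalerN mulrC.
Qed.

Lemma kap_kapN a a' x : kap a (kap a' x) = - kap a' (kap a x).
Proof.
rewrite !kap_kapE exchange_big -sumrN; apply: eq_bigr => i _.
rewrite -sumrN; apply: eq_bigr => j _.
by rewrite econ_conN scalerN mulrC.
Qed.

Lemma kap_lam a v x : kap a (lam v x) = (\sum_j a j * v j) *: x - lam v (kap a x).
Proof.
rewrite /kap /lam.
under eq_bigr => i _.
  rewrite linear_sum scaler_sumr.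
  under eq_bigr do rewrite linearZ /= econ_wdg !scalerBr scalerA -scalerA !scalerA.
  rewrite sumrB.
  over.
rewrite sumrB; congr (_ - _).
  rewrite scaler_suml; apply: eq_bigr => i _.
  rewrite (bigD1 i) //= eqxx mulr1 big1 ?addr0 // => j.
  by rewrite eq_sym => /negPf ->; rewrite mulr0 scale0r.
rewrite exchange_big; apply: eq_bigr => j _; rewrite linear_sum scaler_sumr.
by apply: eq_bigr => i _; rewrite linearZ /= scalerA mulrC.
Qed.

Lemma kap_wdg a j x : kap a (ewdg j x) = a j *: x - ewdg j (kap a x).
Proof.
have h y : ewdg j y = lam (fun l => (l == j)%:R) y.
  rewrite /lam (bigD1 j) //= eqxx scale1r big1 ?addr0 // => l /negPf ->.
  by rewrite scale0r.
rewrite !h kap_lam (bigD1 j) //= eqxx mulr1 big1 ?addr0 // => l /negPf ->.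
by rewrite mulr0.
Qed.

Definition kaps (rs : seq ('I_s -> R)) (x : V) : V := foldl (fun y a => kap a y) x rs.

Lemma kaps_is_linear rs : linear (kaps rs).
Proof. by elim: rs => [|a rs IH] r x y //=; rewrite linearP IH. Qed.
HB.instance Definition _ rs := GRing.isLinear.Build R V V _ (kaps rs) (kaps_is_linear rs).

Lemma kaps_cons a rs x : kaps (a :: rs) x = kaps rs (kap a x). Proof. by []. Qed.

Lemma kaps_kap (T : eqType) (F : T -> 'I_s -> R) (rs : seq T) p x :
  p \in rs -> kaps (map F rs) (kap (F p) x) = 0.
Proof.
elim: rs x => // q rs IH x; rewrite inE map_cons kaps_cons => /predU1P[->|h].
  by rewrite kap_kap0 linear0.
by rewrite kap_kapN linearN /= IH ?oppr0.
Qed.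

Definition edelta J : V := [ffun J' => (J == J')%:R].

(** The exterior product of the e_(f i) in order: zero when [f] repeats a value, a signed basis
    vector otherwise. *)
Fixpoint ewdgs r : ('I_r -> 'I_s) -> V :=
  if r is r'.+1 then fun f => ewdg (f ord0) (ewdgs (f \o lift ord0)) else fun _ => edelta set0.

Lemma eq_ewdgs r (f g : 'I_r -> 'I_s) : f =1 g -> ewdgs f = ewdgs g.
Proof.
elim: r f g => [//|r IH] f g h /=.
by rewrite h (IH _ (g \o lift ord0)) // => i; apply: h.
Qed.

Lemma econ_delta0 j : econ j (edelta set0) = 0.
Proof.
apply/ffunP => J; rewrite !ffunE; case: ifP => // _.
rewrite (_ : (set0 == _) = false) ?mulr0 //.
by apply/negP => /eqP/setP/(_ j); rewrite !inE eqxx.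
Qed.

Lemma kap_wdgs a r (f : 'I_r.+1 -> 'I_s) :
  kap a (ewdgs f) = \sum_(i < r.+1) ((-1) ^+ i * a (f i)) *: ewdgs (f \o lift i).
Proof.
elim: r f => [|r IH] f.
  rewrite big_ord_recl big_ord0 addr0 /= expr0 mul1r kap_wdg [kap a _]big1 => [|j _].
    by rewrite linear0 subr0.
  by rewrite econ_delta0 scaler0.
rewrite [ewdgs f]/= kap_wdg IH linear_sum [RHS]big_ord_recl expr0 mul1r; congr (_ + _).
rewrite -sumrN; apply: eq_bigr => i _; rewrite linearZ /= -scaleNr.
rewrite /bump /= add1n exprS mulN1r mulNr; congr (- _ *: _).
rewrite (_ : lift (lift ord0 i) ord0 = ord0); last exact: val_inj.
congr (ewdg _ _); apply: eq_ewdgs => j /=; congr f; apply: val_inj => /=.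
by rewrite /bump /=; lia.
Qed.

Lemma ewdgs_supp r (f : 'I_r -> 'I_s) J : #|J| != r -> ewdgs f J = 0.
Proof.
elim: r f J => [|r IH] f J /=; first by rewrite ffunE cards_eq0 eq_sym => /negPf ->.
rewrite ffunE => h; case: ifP => // hj; rewrite IH ?mulr0 //.
by apply: contra h => /eqP <-; rewrite (cardsD1 (f ord0) J) hj.
Qed.

Lemma edelta_wdgs r J : #|J| = r -> exists (f : 'I_r -> 'I_s) (e : bool), edelta J = (-1) ^+ e *: ewdgs f.
Proof.
elim: r J => [|r IH] J.
  move/eqP; rewrite cards_eq0 => /eqP ->.
  have f : 'I_0 -> 'I_s by case.
  by exists f, false; rewrite scale1r.
move=> hJ; have /card_gt0P[j hj] : (0 < #|J|)%N by rewrite hJ.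
have [|f [e he]] := IH (J :\ j).
  by apply/eqP; rewrite -eqSS -hJ (cardsD1 j J) hj.
(* Putting e_j in front of the other factors costs the sign [esgn j J], whose parity is added to the
   sign found for [J :\ j]. *)
exists (fun i => if unlift ord0 i is Some l then f l else j), (odd (#|[set i in J | (i < j)%N]|) (+) e).
rewrite signr_addb -scalerA [ewdgs _]/= unlift_none.
rewrite (eq_ewdgs (g := f)); last by move=> i /=; rewrite liftK.
rewrite -[_ *: ewdg _ _]linearZ /= -he; apply/ffunP => K; rewrite !ffunE /= signr_odd.
have [<-|JK] := eqVneq J K.
  by rewrite hj eqxx mulr1 -/(esgn j J) [_ *: _]esgn_sqr.
case: ifP => hK; last by rewrite scaler0.
rewrite (_ : (_ == _) = false) ?mulr0 ?scaler0 //.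
by apply: contraNF JK => /eqP h; rewrite -(setD1K hj) h setD1K.
Qed.

End Exterior.

Section RowContraction.
Variables (R : comNzRingType) (s : nat).

(** On forms of degree [t] this is the [t]-th exterior power of [A]. Contracting by the first row
    first matches Laplace expansion along that row, so no sign appears in [rkaps_wdgs]. *)
Definition rkaps t (A : 'M[R]_(t, s)) : {ffun {set 'I_s} -> R^o} -> {ffun {set 'I_s} -> R^o} :=
  kaps [seq A p | p <- enum 'I_t].
HB.instance Definition _ t (A : 'M[R]_(t, s)) := GRing.Linear.on (rkaps A).

Lemma rkapsS t (A : 'M[R]_(t.+1, s)) x : rkaps A x = rkaps (row' ord0 A) (kap (A ord0) x).
Proof.
rewrite /rkaps enum_ordSl map_cons kaps_cons -map_comp.
elim: (enum _) (kap _ x) => [//|p l IH] y.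
rewrite !map_cons !kaps_cons IH; congr (kaps _ _); rewrite /kap.
by apply: eq_bigr => j _; rewrite /= mxE.
Qed.

Lemma rkaps_wdgs t (A : 'M[R]_(t, s)) (f : 'I_t -> 'I_s) :
  rkaps A (ewdgs R f) set0 = \det (colsub f A).
Proof.
elim: t A f => [|t IH] A f.
  by rewrite /rkaps enum_ord0 /kaps /= ffunE eqxx det_mx00.
rewrite rkapsS kap_wdgs linear_sum sum_ffunE (expand_det_row _ ord0).
apply: eq_bigr => i _; rewrite linearZ /= ffunE IH mxE /cofactor add0n.
rewrite [(-1) ^+ i * _]mulrC [LHS]/GRing.scale /= -mulrA; congr (_ * (_ * \det _)).
by apply/matrixP => p q; rewrite !mxE.
Qed.

Lemma rkaps_kap t (A : 'M[R]_(t, s)) p x : rkaps A (kap (A p) x) = 0.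
Proof. by apply: kaps_kap; rewrite mem_enum. Qed.

(** The body of [maxminor_ideal] over any commutative ring; over polynomials the two are
    convertible, which the final theorem uses. *)
Definition minors_ideal t (A : 'M[R]_(t, s)) (p : R) : Prop :=
  exists coef : {ffun 'I_t -> 'I_s} -> R,
    p = \sum_(f : {ffun 'I_t -> 'I_s}) coef f * \det (colsub f A).

Lemma minors_is_ideal t (A : 'M[R]_(t, s)) : is_ideal (minors_ideal A).
Proof.
split=> [|x y [u ->] [v ->]|r x [u ->]].
- by exists (fun=> 0); rewrite big1 // => f _; rewrite mul0r.
- by exists (fun f => u f + v f); rewrite -big_split; apply: eq_bigr => f _; rewrite mulrDl.
- by exists (fun f => r * u f); rewrite mulr_sumr; apply: eq_bigr => f _; rewrite mulrA.
Qed.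

Lemma minor_mem t (A : 'M[R]_(t, s)) (f : 'I_t -> 'I_s) : minors_ideal A (\det (colsub f A)).
Proof.
exists (fun g => (g == [ffun i => f i])%:R); rewrite (bigD1 [ffun i => f i]) //= eqxx mul1r.
rewrite big1 ?addr0 => [|g /negPf ->]; last by rewrite mul0r.
by congr (\det _); apply/matrixP => i j; rewrite !mxE ffunE.
Qed.

Lemma minors_sub t (A : 'M[R]_(t, s)) (I : R -> Prop) : is_ideal I ->
  (forall f : 'I_t -> 'I_s, I (\det (colsub f A))) -> forall p, minors_ideal A p -> I p.
Proof. by move=> hI h p [u ->]; apply: ideal_sum => // f _; apply: idealM. Qed.

Lemma rkaps_delta t (A : 'M[R]_(t, s)) (J : {set 'I_s}) : #|J| = t ->
  minors_ideal A (rkaps A (edelta R J) set0).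
Proof.
move=> /(edelta_wdgs R) [f [e ->]]; rewrite linearZ /= ffunE rkaps_wdgs.
by apply: idealM; [apply: minors_is_ideal|apply: minor_mem].
Qed.

End RowContraction.

(** * The Eagon-Northcott complex *)

Section EagonNorthcott.
Variables (R : comNzRingType) (t s : nat) (A : 'M[R]_(t, s)).
Local Notation V := {ffun {set 'I_s} -> R^o}.
Local Notation X := ('X_{1..t} -> V).
Implicit Types (x y z w : X) (mu : 'X_{1..t}) (J : R -> Prop).

(** An element of [X] gives an exterior form for each divided-power monomial in the rows, all
    degrees at once. On divided powers, lowering the exponent of row p has coefficient 1, so the
    formula is right in every characteristic. *)
Definition edif x : X := fun mu => \sum_p kap (A p) (x (mu + U_(p))%MM).

Lemma edif_dif x mu : edif (edif x) mu = 0.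
Proof.
rewrite /edif; under eq_bigr do rewrite linear_sum.
apply: antisym_sum => [p q|p]; last exact: kap_kap0.
by rewrite /= kap_kapN -!addmA [(U_(p) + U_(q))%MM]addmC.
Qed.

Lemma rkaps_dif x mu : rkaps A (edif x mu) = 0.
Proof. by rewrite linear_sum big1 // => p _; apply: rkaps_kap. Qed.

Lemma eq_edif x y : x =1 y -> edif x =1 edif y.
Proof. by move=> h mu; apply: eq_bigr => p _; rewrite h. Qed.

Lemma edifD x y mu : edif (fun m => x m + y m) mu = edif x mu + edif y mu.
Proof. by rewrite /edif -big_split; apply: eq_bigr => p _; rewrite linearD. Qed.

Lemma edifZ r x mu : edif (fun m => r *: x m) mu = r *: edif x mu.
Proof. by rewrite /edif scaler_sumr; apply: eq_bigr => p _; rewrite linearZ. Qed.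

Lemma edifB x y mu : edif (fun m => x m - y m) mu = edif x mu - edif y mu.
Proof. by rewrite /edif -sumrB; apply: eq_bigr => p _; rewrite linearB. Qed.

Section Homotopy.
Variables (v : 'I_t -> 'I_s -> R) (Delta : R).
Hypothesis hv : forall p q, \sum_j A p j * v q j = (p == q)%:R * Delta.

(** Wedging with [v q] while raising the exponent of row q contracts the complex up to [Delta],
    except on monomials free of q, where the defect [epi q] remains. *)
Definition ehtp (q : 'I_t) x : X :=
  fun mu => if mu q == 0%N then 0 else lam (v q) (x (mu - U_(q))%MM).
Definition epi (q : 'I_t) x : X :=
  fun mu => if mu q == 0%N then lam (v q) (kap (A q) (x mu)) else 0.

(** For a row p other than q, [hv] makes contraction by p anticommute with wedging by [v q], so
    these terms cancel; row q leaves [Delta]. *)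
Lemma edif_htp q x mu :
  edif (ehtp q x) mu + ehtp q (edif x) mu = Delta *: x mu - epi q x mu.
Proof.
rewrite /edif (bigD1 q) //= /ehtp mnmDE mnm1E eqxx addn1 /= addmK kap_lam hv eqxx mul1r /epi.
have h0 (p : 'I_t) : p != q -> (mu + U_(p))%MM q = mu q.
  by move=> pq; rewrite mnmDE mnm1E (negPf pq) addn0.
case: (boolP (mu q == 0%N)) => hmu.
  rewrite big1 ?addr0 // => p pq; rewrite h0 // hmu; exact: linear0.
rewrite subr0 -!addrA -[RHS]addr0; congr (_ + _).
rewrite [\sum_(p < t) _](bigD1 q) //= linearD.
have hle : (U_(q) <= mu)%MM by rewrite lep1mP.
rewrite submK // addrCA addKr linear_sum -big_split big1 // => p pq /=.
rewrite h0 // (negPf hmu) kap_lam hv (negPf pq) mul0r scale0r add0r.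
have -> : (mu + U_(p) - U_(q) = mu - U_(q) + U_(p))%MM.
  by rewrite [RHS]addmC addmBA // addmC.
by rewrite addNr.
Qed.

Definition inI J (x : V) := forall S, J (x S).

Section Modulo.
Variable J : R -> Prop.
Hypothesis hJ : is_ideal J.

Lemma inI0 : inI J 0. Proof. by move=> S; rewrite ffunE; apply: ideal0. Qed.
Lemma inID (x y : V) : inI J x -> inI J y -> inI J (x + y).
Proof. by move=> hx hy S; rewrite ffunE; apply: idealD. Qed.
Lemma inIZ r (x : V) : inI J x -> inI J (r *: x).
Proof. by move=> hx S; rewrite ffunE; apply: idealM. Qed.
Lemma inIB (x y : V) : inI J x -> inI J y -> inI J (x - y).
Proof. by move=> hx hy; apply: inID => //; rewrite -scaleN1r; apply: inIZ. Qed.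
Lemma inI_sum (T : Type) (r : seq T) (P : pred T) (F : T -> V) :
  (forall i, P i -> inI J (F i)) -> inI J (\sum_(i <- r | P i) F i).
Proof. by move=> h; apply: big_ind => //; [apply: inI0|move=> x y; apply: inID]. Qed.
Lemma inI_kap a (x : V) : inI J x -> inI J (kap a x).
Proof.
move=> hx; apply: inI_sum => j _; apply: inIZ => S; rewrite ffunE.
by case: ifP => _; [apply: ideal0|apply: idealM].
Qed.
Lemma inI_lam a (x : V) : inI J x -> inI J (lam a x).
Proof.
move=> hx; apply: inI_sum => j _; apply: inIZ => S; rewrite ffunE.
by case: ifP => _; [apply: idealM|apply: ideal0].
Qed.
Lemma inI_kaps rs (x : V) : inI J x -> inI J (kaps rs x).
Proof. by elim: rs x => [|a rs IH] x hx //; rewrite kaps_cons; apply: IH; apply: inI_kap. Qed.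

Lemma edif_inI x : (forall mu, inI J (x mu)) -> forall mu, inI J (edif x mu).
Proof. by move=> hx mu; apply: inI_sum => p _; apply: inI_kap. Qed.

Lemma ehtp_inI q x : (forall mu, inI J (x mu)) -> forall mu, inI J (ehtp q x mu).
Proof. by move=> hx mu; rewrite /ehtp; case: ifP => _; [apply: inI0|apply: inI_lam]. Qed.

Lemma epi_cycle q x : (forall mu, inI J (edif x mu)) -> forall mu, inI J (edif (epi q x) mu).
Proof.
move=> hx mu.
have e : epi q x =1 (fun m => Delta *: x m - (edif (ehtp q x) m + ehtp q (edif x) m)).
  by move=> m; rewrite edif_htp opprB addrC subrK.
rewrite (eq_edif e) edifB edifZ edifD edif_dif add0r; apply: inIB; first exact: inIZ.
by apply: edif_inI; apply: ehtp_inI.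
Qed.

Definition epis (l : seq 'I_t) x := foldl (fun y q => epi q y) x l.

(** Each [epi q] sends cycles modulo [J] to cycles modulo [J], so the homotopies for the successive
    rows of [l] can be composed, each costing one factor [Delta]. *)
Lemma epis_htp l x : (forall mu, inI J (edif x mu)) ->
  exists w, forall mu, inI J (Delta ^+ size l *: x mu - epis l x mu - edif w mu).
Proof.
elim: l x => [|q l IH] x hx /=.
  exists (fun=> 0) => mu; rewrite scale1r subrr sub0r -scaleN1r; apply: inIZ.
  by apply: edif_inI => m; apply: inI0.
have [w hw] := IH _ (epi_cycle q hx).
exists (fun m => Delta ^+ size l *: ehtp q x m + w m) => mu.
rewrite edifD edifZ exprS mulrC -scalerA.
have -> : Delta *: x mu = edif (ehtp q x) mu + ehtp q (edif x) mu + epi q x mu.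
  by rewrite edif_htp subrK.
rewrite !scalerDr.
have -> : Delta ^+ size l *: edif (ehtp q x) mu + Delta ^+ size l *: ehtp q (edif x) mu +
  Delta ^+ size l *: epi q x mu - epis l (epi q x) mu -
  (Delta ^+ size l *: edif (ehtp q x) mu + edif w mu)
  = Delta ^+ size l *: ehtp q (edif x) mu +
    (Delta ^+ size l *: epi q x mu - epis l (epi q x) mu - edif w mu).
  by rewrite opprD !addrA (ACl (1*5*(2*(3*4*6))))%AC /= subrr add0r !addrA.
by apply: inID => //; apply: inIZ; apply: ehtp_inI.
Qed.

Lemma epis0 l x mu : x mu = 0 -> epis l x mu = 0.
Proof.
elim: l x => [//|q l IH] x hx /=; apply: IH; rewrite /epi; case: ifP => // _.
by rewrite hx !linear0.
Qed.

Lemma epis_neq0 l x mu q : q \in l -> mu q != 0%N -> epis l x mu = 0.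
Proof.
elim: l x => // p l IH x; rewrite inE => /predU1P[<-|h] hq /=; last exact: IH.
by apply: epis0; rewrite /epi (negPf hq).
Qed.

Lemma kaps_lam (l : seq 'I_t) q (x : V) : q \notin l ->
  kaps [seq A p | p <- l] (lam (v q) x) = (-1) ^+ size l *: lam (v q) (kaps [seq A p | p <- l] x).
Proof.
elim: l x => [|p l IH] x; first by rewrite scale1r.
rewrite inE negb_or => /andP[qp ql]; rewrite map_cons !kaps_cons kap_lam hv eq_sym (negPf qp).
by rewrite mul0r scale0r add0r linearN /= IH // exprS -scalerA scaleN1r.
Qed.

(** At exponent 0 each [epi q] is contraction by row q followed by a wedge. The wedges move past the
    later contractions up to sign, so what is left is a wedge of the contraction by all rows of
    [l]. *)
Lemma epis_at0 l x : uniq l -> inI J (kaps [seq A p | p <- l] (x 0%MM)) -> inI J (epis l x 0%MM).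
Proof.
elim: l x => [//|q l IH] x /= /andP[ql ul] hx; apply: IH => //.
rewrite /epi mnm0E eqxx kaps_lam //; apply: inIZ; exact: inI_lam.
Qed.

End Modulo.
End Homotopy.

(** Once [epi] has been applied for every row, the components at nonzero exponents vanish, and the
    one at exponent 0 lies in [J] because [z] is also a cycle for the map to the base ring. *)
Lemma minor_kill (f : 'I_t -> 'I_s) J z : is_ideal J ->
  (forall mu, inI J (edif z mu)) -> inI J (rkaps A (z 0%MM)) ->
  exists w, forall mu, inI J (\det (colsub f A) ^+ t *: z mu - edif w mu).
Proof.
move=> hJ hz hz0.
pose M := colsub f A.
(* Columns of the adjugate, spread over the columns of [A] along [f]; the sum over the fibre keeps
   [hv] true even when [f] repeats a value. *)
pose v q j := \sum_(l | f l == j) (\adj M) l q.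
have hv p q : \sum_j A p j * v q j = (p == q)%:R * \det M.
  have /matrixP/(_ p q) := mul_mx_adj M; rewrite mulr_natl !mxE => <-.
  under eq_bigr do rewrite mulr_sumr.
  rewrite (exchange_big_dep predT) //=; apply: eq_bigr => l _.
  by rewrite (big_pred1 (f l)) ?mxE // => j /=; rewrite eq_sym.
have [w hw] := epis_htp hv hJ (enum 'I_t) hz.
exists w => mu; have := hw mu; rewrite size_enum_ord.
have h : inI J (epis v (enum 'I_t) z mu).
  have [->|mu0] := eqVneq mu 0%MM.
    by apply: (epis_at0 hv hJ); [apply: enum_uniq|].
  have /existsP[q hq] : [exists q, mu q != 0%N].
    apply: contra_neqT mu0 => /existsPn h; apply/mnmP => q; rewrite mnm0E.
    by apply/eqP; rewrite -[_ == _]negbK; apply: h.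
  by rewrite (epis_neq0 _ _ (mem_enum _ q) hq); apply: inI0.
move=> h'; have := inID hJ h' h; congr inI.
by rewrite addrAC subrK.
Qed.

(** Indices of basis vectors. Monomial degrees may be bounded by [s], since [t + i] columns out of
    [s] force i <= s; the bound makes the type finite. *)
Definition enT : finType := ({set 'I_s} * 'X_{1..t < s.+1})%type.
Definition enb i : {pred enT} := fun b => (#|b.1| == (t + i)%N) && (mdeg b.2 == i).
(** Place 0 is the base ring, so [enb i] indexes the basis at place [i.+1]. *)
Definition enrk i : nat := if i is i'.+1 then #|enb i'| else 1.
Definition enS i (b : 'I_(#|enb i|)) : {set 'I_s} := (enum_val b).1.
Definition enM i (b : 'I_(#|enb i|)) : 'X_{1..t} := (enum_val b).2.

Lemma enS_card i (b : 'I_(#|enb i|)) : #|enS b| = (t + i)%N.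
Proof. by have /andP[/eqP] : enb i (enum_val b) := enum_valP b. Qed.
Lemma enM_deg i (b : 'I_(#|enb i|)) : mdeg (enM b) = i.
Proof. by have /andP[_ /eqP] : enb i (enum_val b) := enum_valP b. Qed.

Lemma en_inj i (b b' : 'I_(#|enb i|)) : enS b = enS b' -> enM b = enM b' -> b = b'.
Proof.
move=> h1 h2; apply: enum_val_inj; apply/eqP; rewrite -pair_eqE /pair_eq.
by rewrite [X in X && _](_ : _ = true) //=; apply/eqP; [apply/val_inj|].
Qed.

Lemma en_ex i (S : {set 'I_s}) mu : #|S| = (t + i)%N -> mdeg mu = i ->
  exists b : 'I_(#|enb i|), enS b = S /\ enM b = mu.
Proof.
move=> hS hmu.
have hi : (mdeg mu < s.+1)%N.
  by rewrite hmu ltnS (leq_trans (leq_addl t i)) // -hS -[leqRHS]card_ord max_card.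
pose b : enT := (S, BMultinom hi).
have hb : b \in enb i by rewrite unfold_in /enb /= hS hmu !eqxx.
by exists (enum_rank_in hb b); rewrite /enS /enM enum_rankK_in.
Qed.

Definition ebase i (b : 'I_(#|enb i|)) : X := fun mu => (enM b == mu)%:R *: edelta R (enS b).
(** [evec] and [euncol] pass between coordinate vectors at one place and elements of [X], so that
    the matrices [enmx] inherit the identities proved for [edif] and [rkaps]. *)
Definition evec i (v : 'cV[R]_(#|enb i|)) : X := fun mu => \sum_b v b 0 *: ebase b mu.
Definition euncol i (w : X) : 'cV[R]_(#|enb i|) := \col_b w (enM b) (enS b).

Definition enmx i : 'M[R]_(enrk i, enrk i.+1) :=
  match i return 'M[R]_(enrk i, enrk i.+1) with
  | 0 => \row_b rkaps A (edelta R (enS b)) set0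
  | i'.+1 => \matrix_(a, b) edif (ebase b) (enM a) (enS a)
  end.

Lemma evecE i (v : 'cV[R]_(#|enb i|)) mu (S : {set 'I_s}) :
  evec v mu S = \sum_b v b 0 * ((enM b == mu) && (enS b == S))%:R.
Proof.
rewrite /evec sum_ffunE; apply: eq_bigr => b _.
by rewrite /ebase !ffunE -mulnb natrM.
Qed.

Lemma evecK i (v : 'cV[R]_(#|enb i|)) b : evec v (enM b) (enS b) = v b 0.
Proof.
rewrite evecE (bigD1 b) //= !eqxx mulr1 big1 ?addr0 // => b' hb'.
case: eqVneq => [h1|_]; rewrite ?mulr0 //; case: eqVneq => [h2|_]; rewrite ?mulr0 //.
by case/eqP: hb'; apply: en_inj.
Qed.

Lemma evec_supp i (v : 'cV[R]_(#|enb i|)) mu (S : {set 'I_s}) :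
  ~~ ((#|S| == (t + i)%N) && (mdeg mu == i)) -> evec v mu S = 0.
Proof.
move=> h; rewrite evecE big1 // => b _; case: eqVneq => [h1|_]; rewrite ?mulr0 //.
case: eqVneq => [h2|_]; rewrite ?mulr0 //.
by case/negP: h; rewrite -h1 -h2 enS_card enM_deg !eqxx.
Qed.

Lemma evec_uncol i w mu (S : {set 'I_s}) : #|S| = (t + i)%N -> mdeg mu = i -> evec (euncol i w) mu S = w mu S.
Proof. by move=> hS hmu; have [b [<- <-]] := en_ex hS hmu; rewrite evecK mxE. Qed.

Lemma kap_local a (x y : V) (S : {set 'I_s}) : (forall S' : {set 'I_s}, #|S'| = #|S|.+1 -> x S' = y S') -> kap a x S = kap a y S.
Proof.
move=> h; rewrite /kap !sum_ffunE; apply: eq_bigr => j _; rewrite !ffunE.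
by case: (boolP (j \in S)) => // hj; rewrite h // cardsU1 hj.
Qed.

Lemma edif_local x y mu (S : {set 'I_s}) :
  (forall mu' (S' : {set 'I_s}), #|S'| = #|S|.+1 -> mdeg mu' = (mdeg mu).+1 -> x mu' S' = y mu' S') ->
  edif x mu S = edif y mu S.
Proof.
move=> h; rewrite /edif !sum_ffunE; apply: eq_bigr => p _; apply: kap_local => S' hS'.
by apply: h => //; rewrite mdegD mdeg1 addn1.
Qed.

Lemma kaps_local rs (x y : V) (S : {set 'I_s}) : (forall S' : {set 'I_s}, #|S'| = (#|S| + size rs)%N -> x S' = y S') ->
  kaps rs x S = kaps rs y S.
Proof.
elim: rs x y => [|a rs IH] x y h; first by apply: h; rewrite addn0.
by rewrite !kaps_cons; apply: IH => S' hS'; apply: kap_local => S'' hS''; apply: h; rewrite hS'' hS' /= addnS.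
Qed.

Lemma enmxS_mul i (v : 'cV[R]_(enrk i.+2)) : enmx i.+1 *m v = euncol i (edif (evec v)).
Proof.
apply/colP => a; rewrite !mxE /edif sum_ffunE /evec.
under [RHS]eq_bigr do rewrite linear_sum sum_ffunE.
rewrite exchange_big; apply: eq_bigr => b _; rewrite mxE /edif sum_ffunE mulr_suml.
by apply: eq_bigr => p _; rewrite /= [kap _ (v b 0 *: _)]linearZ /= [RHS]ffunE mulrC.
Qed.

Lemma enmx0_mul (v : 'cV[R]_(enrk 1)) : (enmx 0 *m v) 0 0 = rkaps A (evec v 0%MM) set0.
Proof.
rewrite !mxE /evec linear_sum sum_ffunE; apply: eq_bigr => b _; rewrite mxE linearZ [RHS]ffunE mulrC.
by congr (_ * _); rewrite /ebase; have /eqP := enM_deg b; rewrite mdeg_eq0 => ->; rewrite scale1r.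
Qed.

Lemma evec_edif i (v : 'cV[R]_(enrk i.+2)) mu S :
  evec (euncol i (edif (evec v))) mu S = edif (evec v) mu S.
Proof.
case: (boolP ((#|S| == (t + i)%N) && (mdeg mu == i))) => [/andP[/eqP hS /eqP hmu]|h].
  by rewrite evec_uncol.
rewrite evec_supp // -[edif _ _ _](_ : edif (fun=> 0) mu S = _).
  by rewrite /edif sum_ffunE big1 // => p _; rewrite linear0 ffunE.
apply: edif_local => mu' S' hS' hmu'; rewrite evec_supp ?ffunE //.
by rewrite hS' hmu' addnS !eqSS.
Qed.

Lemma enmx_complex i : enmx i *m enmx i.+1 = 0.
Proof.
suff h (v : 'cV[R]_(enrk i.+2)) : enmx i *m (enmx i.+1 *m v) = 0.
  apply/matrixP => a b; rewrite [RHS]mxE; have /colP/(_ a) := h (delta_mx b 0).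
  by rewrite mulmxA -colE !mxE.
rewrite enmxS_mul; case: i v => [|i] v.
  apply/colP => a; rewrite ord1 enmx0_mul.
  have -> : evec (euncol 0 (edif (evec v))) 0%MM = edif (evec v) 0%MM.
    by apply/ffunP => S; apply: evec_edif.
  by rewrite rkaps_dif ffunE mxE.
rewrite enmxS_mul; apply/colP => a; rewrite !mxE.
by rewrite (eq_edif (y := edif (evec v))) ?edif_dif ?ffunE // => mu; apply/ffunP => S; apply: evec_edif.
Qed.

(** At the first place the differential has no exponent to lower and the cycle condition is the one
    for [rkaps]; at later places the component at exponent 0 is zero. Either way [minor_kill]
    applies. *)
Lemma enmx_kill (f : 'I_t -> 'I_s) J i (z : 'cV[R]_(enrk i.+1)) : is_ideal J ->
  (forall a, J ((enmx i *m z) a 0)) ->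
  exists w : 'cV[R]_(enrk i.+2), forall b, J ((\det (colsub f A) ^+ t *: z - enmx i.+1 *m w) b 0).
Proof.
move=> hJ hz.
have [||w hw] := @minor_kill f J (evec z) hJ _ _.
- move=> mu S; case: i z hz => [|i] z hz.
    rewrite [edif _ _ _](_ : _ = 0); first exact: ideal0.
    rewrite /edif sum_ffunE big1 // => p _; rewrite (_ : evec z _ = 0) ?linear0 ?ffunE //.
    by apply/ffunP => S'; rewrite ffunE evec_supp // mdegD mdeg1 addn1 andbF.
  case: (boolP ((#|S| == (t + i)%N) && (mdeg mu == i))) => [/andP[/eqP hS /eqP hmu]|h].
    by have [b [<- <-]] := en_ex hS hmu; have := hz b; rewrite enmxS_mul mxE.
  rewrite -evec_edif evec_supp //; exact: ideal0.
- move=> S; case: i z hz => [|i] z hz.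
    have [->|S0] := eqVneq S set0; first by have := hz 0; rewrite enmx0_mul.
    rewrite /rkaps (@kaps_local _ _ 0) ?linear0 ?ffunE; first exact: ideal0.
    move=> S' hS'; rewrite evec_supp ?ffunE // hS' size_map size_enum_ord addn0 -[X in _ == X]add0n eqn_add2r cards_eq0.
    by rewrite (negPf S0).
  rewrite (_ : evec z _ = 0) ?linear0 ?ffunE; first exact: ideal0.
  by apply/ffunP => S'; rewrite ffunE evec_supp // mdeg0 andbF.
exists (euncol i.+1 w) => b; have := hw (enM b) (enS b).
rewrite !ffunE evecK enmxS_mul !mxE.
rewrite (@edif_local (evec (euncol i.+1 w)) w) //.
move=> mu' S' hS' hmu'; rewrite evec_uncol //.
  by rewrite hS' enS_card addnS.
by rewrite hmu' enM_deg.
Qed.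

Lemma enmx_image p : minors_ideal A p <-> exists v : 'cV[R]_(enrk 1), (enmx 0 *m v) 0 0 = p.
Proof.
split=> [|[v <-]]; last first.
  rewrite !mxE; apply: ideal_sum => [|b _]; first exact: minors_is_ideal.
  rewrite mulrC; apply: idealM; first exact: minors_is_ideal.
  by rewrite mxE; apply: rkaps_delta; rewrite enS_card addn0.
move: p; apply: minors_sub.
  split=> [|x y [u <-] [v <-]|r x [u <-]].
  - by exists 0; rewrite mulmx0 mxE.
  - by exists (u + v); rewrite mulmxDr mxE.
  - by exists (r *: u); rewrite -scalemxAr mxE.
move=> f; exists (euncol 0 (fun mu => (mu == 0%MM)%:R *: ewdgs R f)).
rewrite enmx0_mul -rkaps_wdgs; congr (rkaps A _ set0).
apply/ffunP => S; case: (boolP (#|S| == t)) => hS.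
  by rewrite evec_uncol ?mdeg0 ?addn0 ?eqxx ?scale1r //; apply/eqP.
by rewrite evec_supp ?addn0 ?(negPf hS) // ewdgs_supp.
Qed.

Lemma enrk0 i : (s < t + i)%N -> enrk i.+1 = 0%N.
Proof.
move=> h; apply: eq_card0 => b; apply/negP => /andP[/eqP hb _].
by have := max_card (mem b.1); rewrite hb card_ord leqNgt h.
Qed.

End EagonNorthcott.

(** * Acyclicity *)

Section Acyclicity.
Variables (R : comNzRingType) (r : nat -> nat) (phi : forall i, 'M[R]_(r i, r i.+1)).
Hypothesis phi_complex : forall i, phi i *m phi i.+1 = 0.

(** At place 0 every vector is a cycle, so killing homology there means killing the cokernel. *)
Definition cycle_mod (J : R -> Prop) i : 'cV[R]_(r i) -> Prop :=
  match i return 'cV[R]_(r i) -> Prop with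
  | 0 => fun _ => True
  | i'.+1 => fun z => forall a, J ((phi i' *m z) a 0)
  end.

Definition homology_killer (f : R) : Prop :=
  forall (J : R -> Prop), is_ideal J -> forall i (z : 'cV[R]_(r i)), cycle_mod J z ->
    exists w : 'cV[R]_(r i.+1), forall b, J ((f *: z - phi i *m w) b 0).

Lemma homology_killer_ideal : is_ideal homology_killer.
Proof.
split=> [J hJ i z _|f g hf hg J hJ i z hz|g f hf J hJ i z hz].
- by exists 0 => b; rewrite scale0r mulmx0 subr0 mxE; apply: ideal0.
- have [w hw] := hf J hJ i z hz; have [w' hw'] := hg J hJ i z hz.
  exists (w + w') => b; rewrite scalerDl mulmxDr opprD addrACA mxE.
  exact: idealD.
- have [w hw] := hf J hJ i z hz; exists (g *: w) => b.
  by rewrite -scalerA -scalemxAr -scalerBr mxE; apply: idealM.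
Qed.

Lemma regseq_cat_r (p s : seq R) : regseq (p ++ s) -> regseq s.
Proof. by elim: p => [//|f p IH] /= [/IH]. Qed.

(** Each element of [p] extends exactness by one place downwards. Let f be the element of [p] next
    to [s]. Modulo [s], f z = phi w, so w is a cycle modulo [f :: s], and the induction, used one
    place higher, gives w = phi v + f y. Then f (z - phi y) vanishes modulo [s], and regularity
    cancels f. *)
Lemma acyclic_mod (L : nat) (p s : seq R) :
  (forall i, (L < i)%N -> r i = 0%N) ->
  regseq (p ++ s) -> (forall f, f \in p -> homology_killer f) ->
  forall i (z : 'cV[R]_(r i)), (L < i + size p)%N -> cycle_mod (idl s) z ->
  exists w : 'cV[R]_(r i.+1), forall b, idl s ((z - phi i *m w) b 0).
Proof.
move=> hL; elim/last_ind: p s => [|p f IH] s hreg hkill i z.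
  rewrite addn0 => /hL h _; exists 0 => b; exfalso.
  by move: b; rewrite h; case.
rewrite size_rcons addnS cat_rcons in hreg * => hi hz.
have hJ := idl_ideal s.
have [w hw] := hkill f (ltac:(by rewrite mem_rcons mem_head)) _ hJ i z hz.
have {}IH := IH (f :: s) hreg (fun g hg => hkill g (ltac:(by rewrite mem_rcons inE hg orbT))).
have [|a|v hv] := IH i.+1 w; first by rewrite addSn.
  exists (z a 0); have := idealN hJ (hw a).
  by congr idl; rewrite !mxE; ring.
have [y hy] := @fin_all_exists _ _ (fun b x => idl s ((w - phi i.+1 *m v) b 0 - x * f)) hv.
exists (\col_b y b) => a.
have [_ hreg'] := regseq_cat_r hreg; apply: hreg'.
have -> : f * (z - phi i *m (\col_b y b)) a 0 = (f *: z - phi i *m w) a 0 +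
    (phi i *m (w - phi i.+1 *m v - f *: \col_b y b)) a 0.
  rewrite !mulmxBr mulmxA phi_complex mul0mx subr0 -scalemxAr !mxE.
  by ring.
apply: idealD => //; rewrite mxE; apply: ideal_sum => // b _; apply: idealM => //.
by have := hy b; congr idl; rewrite !mxE [f * _]mulrC.
Qed.

Lemma acyclic (L : nat) (s : seq R) : (forall i, (L < i)%N -> r i = 0%N) ->
  regseq s -> (forall f, f \in s -> homology_killer f) ->
  forall i (z : 'cV[R]_(r i)), (L < i + size s)%N -> cycle_mod (fun x => x = 0) z ->
  exists w : 'cV[R]_(r i.+1), z = phi i *m w.
Proof.
move=> hL hreg hk i z hi hz.
have [w hw] := @acyclic_mod L s [::] hL (ltac:(by rewrite cats0)) hk i z hi hz.
by exists w; apply/colP => b; apply/eqP; rewrite -subr_eq0; have := hw b; rewrite !mxE => ->.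
Qed.

End Acyclicity.

(** * Eagon-Northcott complexes over a polynomial ring *)

Section ENExact.
Variables (k : fieldType) (n : nat).
Local Notation R := {mpoly k[n]}.

(** The inequality dim R/I <= [m0] expressed by transcendence degree, the form that [noether_regseq]
    can meet. *)
Definition trdeg_le (I : R -> Prop) (m0 : nat) : Prop :=
  forall m (y : 'I_m -> R),
    (forall P : {mpoly k[m]}, I (mmap (mpolyC n (R := k)) y P) -> P = 0) -> (m <= m0)%N.

Variables (p q : nat) (B : 'M[R]_(p, q)).
Hypothesis p_gt0 : (0 < p)%N.
Hypothesis B_proper : ~ minors_ideal B 1.

(** At place 0 the power itself must lie in the ideal of minors, which holds because the exponent
    [p] is positive. *)
Lemma minor_homology_killer (f : 'I_p -> 'I_q) :
  homology_killer (enmx B) (\det (colsub f B) ^+ p).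
Proof.
move=> J hJ [|i] z hz; last exact: enmx_kill.
have : minors_ideal B (\det (colsub f B) ^+ p * z 0 0).
  have := minor_mem B f; move: (\det _) (minors_ideal B) (minors_is_ideal B) => D I hI hD.
  by case: (p) p_gt0 => // N _; rewrite exprSr mulrAC; apply: idealM.
move=> /enmx_image[v hv]; exists v => b; rewrite ord1 2!mxE [X in _ + X]mxE hv subrr.
exact: ideal0.
Qed.

Lemma homology_killer_minors f : homology_killer (enmx B) f -> minors_ideal B f.
Proof.
move=> hf; have [|w hw] := hf (fun x => x = 0) _ 0%N 1 I.
  by split=> // [x y -> ->|r x ->]; rewrite ?addr0 ?mulr0.
apply/enmx_image; exists w; apply/eqP; rewrite eq_sym -subr_eq0; have := hw 0.
by rewrite 2!mxE mxE [X in _ + X]mxE mulr1 => ->.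
Qed.

(** Normalization is applied to the ideal of homology killers. It contains a power of every element
    of the ideal of minors, and a polynomial ring has no nilpotents; hence elements independent
    modulo the killers are independent modulo the minors, and there are at most n - c of them. *)
Lemma en_regseq c : (c <= n)%N -> trdeg_le (minors_ideal B) (n - c) ->
  exists s : seq R, [/\ regseq s, (c <= size s)%N & forall f, f \in s -> homology_killer (enmx B) f].
Proof.
move=> hc hdim.
have hI := homology_killer_ideal (enmx B).
have [|m [y [s [e1 e2 e3 e4]]]] := noether_regseq hI.
  by move/homology_killer_minors.
exists s; split=> //.
suff : (m <= n - c)%N by lia.
apply: hdim (y) _ => P hP.
have [N] : exists N, homology_killer (enmx B) (mmap (mpolyC n (R := k)) y P ^+ N).
  apply: (minors_sub (radical_ideal hI)) hP => f.
  by exists p; apply: minor_homology_killer.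
rewrite -rmorphXn => /e4/eqP; rewrite expf_eq0 => /andP[_ /eqP //].
Qed.

(** The bound q - p + 1 on the codimension of maximal minors: a regular sequence of killers longer
    than the complex makes it exact even at place 0, which puts 1 in the ideal. *)
Lemma codim_minors_le c : (0 < c <= n)%N -> trdeg_le (minors_ideal B) (n - c) -> (p + c <= q.+1)%N.
Proof.
move=> /andP[c0 hc] hdim; have [s [s1 s2 s3]] := en_regseq hc hdim.
rewrite leqNgt; apply/negP => h; apply: B_proper.
have hL i : (q.+1 - p < i)%N -> enrk p q i = 0%N by case: i => // i hi; apply: enrk0; lia.
have hi : (q.+1 - p < 0 + size s)%N by lia.
have [w hw] := acyclic (enmx_complex B) hL s1 s3 (z := (1 : 'M[R]_1) : 'cV[R]_(enrk p q 0)) hi I.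
by apply/enmx_image; exists w; rewrite -hw mxE.
Qed.

Lemma en_exact c : (c <= n)%N -> trdeg_le (minors_ideal B) (n - c) -> (q.+1 <= p + c)%N ->
  forall i (z : 'cV[R]_(enrk p q i.+1)), enmx B i *m z = 0 -> exists w, z = enmx B i.+1 *m w.
Proof.
move=> hc hdim hq i z hz; have [s [s1 s2 s3]] := en_regseq hc hdim.
have hL j : (q.+1 - p < j)%N -> enrk p q j = 0%N by case: j => // j hj; apply: enrk0; lia.
have hi : (q.+1 - p < i.+1 + size s)%N by lia.
apply: (acyclic (enmx_complex B) hL s1 s3 hi).
by move=> a; rewrite hz mxE.
Qed.

End ENExact.

(** * Graded free resolutions *)

Section Graded.
Variables (k : fieldType) (n : nat).
Local Notation R := {mpoly k[n]}.

Lemma mcoeff_pihomog d (p : R) m : (pihomog mdeg d p)@_m = if mdeg m == d then p@_m else 0.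
Proof.
rewrite {2}[p]mpolyE /pihomog !raddf_sum /= big_mkcond /=.
case: ifP => hm; last first.
  apply: big1 => m' _; case: ifP => // /eqP hm'; rewrite mcoeffZ mcoeffX.
  by case: eqVneq => [e|_]; [move: hm; rewrite -e hm' eqxx|rewrite mulr0].
apply: eq_bigr => m' _; rewrite mcoeffZ mcoeffX; case: ifP => // hm'.
by case: eqVneq => [e|_]; [move: hm'; rewrite e hm|rewrite mulr0].
Qed.

(* The entries of a degree-0 map from the free module with shifts [dc] to the
   one with shifts [dr]. *)
Definition hmx m l (M : 'M[R]_(m, l)) (dr : 'I_m -> nat) (dc : 'I_l -> nat) : Prop :=
  forall a b mm, (M a b)@_mm != 0 -> (mdeg mm + dr a = dc b)%N.

Definition hpart m l (M : 'M[R]_(m, l)) (dr : 'I_m -> nat) (dc : 'I_l -> nat) : 'M[R]_(m, l) :=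
  \matrix_(a, b) if (dr a <= dc b)%N then pihomog mdeg (dc b - dr a) (M a b) else 0.

Lemma hpart_coef m l (M : 'M[R]_(m, l)) dr dc a b mm :
  (hpart M dr dc a b)@_mm = if (mdeg mm + dr a == dc b)%N then (M a b)@_mm else 0.
Proof.
rewrite mxE; case: leqP => h; rewrite ?mcoeff_pihomog ?mcoeff0.
  by rewrite -(eqn_add2r (dr a)) subnK.
by case: eqP => // e; move: h; rewrite -e ltnNge leq_addl.
Qed.

Lemma hpart_hmx m l (M : 'M[R]_(m, l)) dr dc : hmx (hpart M dr dc) dr dc.
Proof. by move=> a b mm; rewrite hpart_coef; case: (eqVneq (mdeg mm + dr a)%N (dc b)) => [-> //|_ /eqP]. Qed.

Lemma hmx_mul m l r (M : 'M[R]_(m, l)) (N : 'M[R]_(l, r)) d1 d2 d3 :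
  hmx M d1 d2 -> hmx N d2 d3 -> hmx (M *m N) d1 d3.
Proof.
move=> hM hN a b mm; rewrite mxE raddf_sum => h.
have [x hx] : exists x, (M a x * N x b)@_mm != 0.
  apply/existsP; apply: contra_neqT h => /existsPn h; apply: big1 => x _.
  by apply/eqP; have := h x; rewrite negbK.
move: hx; rewrite -mcoeff_msupp => /msuppM_le /allpairsP[[m1 m2] /= [h1 h2 ->]].
rewrite !mcoeff_msupp in h1 h2.
by have e1 := hM _ _ _ h1; have e2 := hN _ _ _ h2; rewrite mdegD -e2 -e1; lia.
Qed.

(** In the only degree where a coefficient of the product can be nonzero, just the homogeneous part
    of [N] contributes. Liftings through a resolution can thus be made homogeneous. *)
Lemma hmx_part m l r (M : 'M[R]_(m, l)) (N : 'M[R]_(l, r)) d1 d2 d3 :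
  hmx M d1 d2 -> hmx (M *m N) d1 d3 -> M *m N = M *m hpart N d2 d3.
Proof.
move=> hM hMN; apply/matrixP => a b; apply/mpolyP => mm.
have hp := hmx_mul hM (@hpart_hmx _ _ N d2 d3).
have [e|ne] := eqVneq (mdeg mm + d1 a)%N (d3 b); last first.
  rewrite [LHS](_ : _ = 0); last by apply: contra_neq_eq ne => /hMN.
  by apply/esym; apply: contra_neq_eq ne => /hp.
rewrite !mxE !raddf_sum /=; apply: eq_bigr => x _.
rewrite [in LHS](mpolyE (M a x)) [in RHS](mpolyE (M a x)) !mulr_suml !raddf_sum /=.
apply: eq_big_seq => m1; rewrite mcoeff_msupp => /hM hm1.
rewrite -!scalerAl !mcoeffZ.
have [hle|nle] := boolP (m1 <= mm)%MM; last first.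
  have z (q : R) : ('X_[m1] * q)@_mm = 0.
    apply/eqP; rewrite mcoeff_eq0; apply: contra nle; rewrite mulrC (perm_mem (msuppMX _ _)).
    by case/mapP => m2 _ ->; rewrite lem_addr.
  by rewrite !z.
rewrite -(submK hle) [(_ + m1)%MM]addmC ![('X_[_] * _)]mulrC !mcoeffMX hpart_coef.
suff -> : (mdeg (mm - m1) + d2 x == d3 b)%N by [].
by move: e; rewrite -{1}(submK hle) mdegD -hm1 => <-; apply/eqP; lia.
Qed.

End Graded.

Section Resolution.
Variables (k : fieldType) (n : nat).
Local Notation R := {mpoly k[n]}.
Variables (I : R -> Prop) (r : nat -> nat) (d : forall i, 'I_(r i) -> nat).
Variable phi : forall i, 'M[R]_(r i, r i.+1).
Hypothesis hres : min_graded_free_res I d phi.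

Lemma res_hmx i : hmx (phi i) (@d i) (@d i.+1).
Proof.
case: hres => _ [_ [h _ _ _]] a b mm hm; have [/dhomogP h1 h2] := h i a b.
have h0 : phi i a b != 0 by apply: contraNneq hm => ->; rewrite mcoeff0.
by rewrite (h1 mm) ?mcoeff_msupp // subnK ?h2.
Qed.

Lemma res_complex i : phi i *m phi i.+1 = 0.
Proof.
case: hres => _ [_ [_ _ _ h]]; apply/matrixP => a b.
have /(h i) : exists w : 'cV[R]_(r i.+2), phi i.+1 *m delta_mx b (0 : 'I_1) = phi i.+1 *m w.
  by exists (delta_mx b 0).
by move/colP/(_ a); rewrite mulmxA -colE !mxE.
Qed.

Lemma res_lift0 l (V : 'M[R]_(r 0, l)) (dc : 'I_l -> nat) : hmx V (@d 0) dc ->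
  (forall a b, I (V a b)) -> exists2 W, hmx W (@d 1) dc & V = phi 0 *m W.
Proof.
move=> hV hI; case: hres => r0 [_ [_ _ h _]].
have e (a a' : 'I_(r 0)) : a = a' by move: a a'; rewrite r0 => a a'; rewrite !ord1.
have a0 : 'I_(r 0) by rewrite r0; exact: ord0.
have [W hW] := @fin_all_exists _ _ (fun b v => forall a, (phi 0 *m v) a ord0 = V a0 b)
  (fun b => proj1 (h _) (hI a0 b)).
have E : V = phi 0 *m (\matrix_(x, b) W b x 0).
  apply/matrixP => a b; rewrite (e a a0) -(hW b a0) !mxE.
  by apply: eq_bigr => x _; rewrite mxE.
exists (hpart (\matrix_(x, b) W b x 0) (@d 1) dc); first exact: hpart_hmx.
by rewrite {1}E; apply: (hmx_part (@res_hmx 0)); rewrite -E.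
Qed.

Lemma res_lift i l (V : 'M[R]_(r i.+1, l)) (dc : 'I_l -> nat) : hmx V (@d i.+1) dc ->
  phi i *m V = 0 -> exists2 W, hmx W (@d i.+2) dc & V = phi i.+1 *m W.
Proof.
move=> hV h0; case: hres => _ [_ [_ _ _ h]].
have hc b : exists w : 'cV[R]_(_), col b V = phi i.+1 *m w.
  by apply/h; rewrite colE mulmxA h0 mul0mx.
have [W hW] := @fin_all_exists _ _ (fun b w => col b V = phi i.+1 *m w) hc.
have E : V = phi i.+1 *m (\matrix_(x, b) W b x 0).
  apply/matrixP => a b; have /colP/(_ a) := hW b; rewrite !mxE => ->.
  by apply: eq_bigr => x _; rewrite mxE.
exists (hpart (\matrix_(x, b) W b x 0) (@d i.+2) dc); first exact: hpart_hmx.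
by rewrite {1}E; apply: (hmx_part (@res_hmx i.+1)); rewrite -E.
Qed.

Lemma res_minimal i a b : (phi i a b)@_0%MM = 0.
Proof. by case: hres => _ [_ [_ h _ _]]. Qed.

Lemma res_image a b : I (phi 0 a b).
Proof.
case: hres => r0 [_ [_ _ h _]]; apply/h; exists (delta_mx b (0 : 'I_1)) => a'.
have -> : a' = a by move: a a'; rewrite r0 => a a'; rewrite !ord1.
by rewrite -colE mxE.
Qed.

End Resolution.
Arguments res_hmx {k n I r d phi} hres i.

(** * Uniqueness of the degree shifts *)

Section Comparison.
Variables (k : fieldType) (n : nat).
Local Notation R := {mpoly k[n]}.
Variables (I I' : R -> Prop).
Hypothesis II' : forall p, I p <-> I' p.
Variables (r : nat -> nat) (d : forall i, 'I_(r i) -> nat) (phi : forall i, 'M[R]_(r i, r i.+1)).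
Variables (r' : nat -> nat) (d' : forall i, 'I_(r' i) -> nat) (psi : forall i, 'M[R]_(r' i, r' i.+1)).
Hypothesis hF : min_graded_free_res I d phi.
Hypothesis hG : min_graded_free_res I' d' psi.

(* Comparison maps in homological degree [i], with [alpha beta] homotopic to the identity. *)
Lemma comparison i : exists (al : 'M[R]_(r' i, r i)) (be : 'M[R]_(r i, r' i)) (h : 'M[R]_(r' i.+1, r' i)),
  [/\ hmx al (@d' i) (@d i) /\ hmx be (@d i) (@d' i),
      exists2 al' : 'M[R]_(r' i.+1, r i.+1), hmx al' (@d' i.+1) (@d i.+1) & al *m phi i = psi i *m al',
      exists2 be' : 'M[R]_(r i.+1, r' i.+1), hmx be' (@d i.+1) (@d' i.+1) & be *m psi i = phi i *m be',
      (al *m be - 1%:M) *m psi i = psi i *m h *m psi i &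
      forall a b, ((al *m be - 1%:M) a b)@_0%MM = 0].
Proof.
(* The fourth clause is the homotopy relation composed with [psi i]. It makes the columns of al' be'
   - 1 - h psi cycles, which therefore lift to the next module and give [h']. The constant terms
   then vanish because the entries of [psi] have none. *)
elim: i => [|i [al [be [h [[hal hbe] [al' hal' eal] [be' hbe' ebe] eh hm]]]]].
  have r0 : r 0 = 1%N by case: hF.
  have r'0 : r' 0 = 1%N by case: hG.
  have d0 a : @d 0 a = 0%N by case: hF => _ [].
  have d'0 a : @d' 0 a = 0%N by case: hG => _ [].
  pose al : 'M[R]_(r' 0, r 0) := const_mx 1.
  pose be : 'M[R]_(r 0, r' 0) := const_mx 1.
  have hal : hmx al (@d' 0) (@d 0).
    move=> a b mm; rewrite mxE d0 d'0 addn0 mcoeff1; case: (eqVneq mm 0%MM) => [->|_]; rewrite ?mdeg0 ?eqxx //.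
  have hbe : hmx be (@d 0) (@d' 0).
    move=> a b mm; rewrite mxE d0 d'0 addn0 mcoeff1; case: (eqVneq mm 0%MM) => [->|_]; rewrite ?mdeg0 ?eqxx //.
  have e : al *m be - 1%:M = 0.
    apply/matrixP => a b; have -> : a = b by move: a b; rewrite r'0 => a b; rewrite !ord1.
    rewrite !mxE eqxx; under eq_bigr do rewrite !mxE mulr1.
    by rewrite sumr_const card_ord r0 subrr.
  have one m l (M : 'M[R]_(m, l)) a : m = 1%N -> exists x, ((const_mx 1 : 'M[R]_(a, m)) *m M) =2 fun _ => M x.
    by move=> em; subst m; exists ord0 => u v; rewrite mxE big_ord1 mxE mul1r.
  exists al, be, 0; split=> //.
  - apply: (res_lift0 hG); first exact: hmx_mul hal (res_hmx hF 0).
    move=> a b; have [x ->] := one _ _ (phi 0) (r' 0) r0.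
    by apply/II'; apply: (res_image hF).
  - apply: (res_lift0 hF); first exact: hmx_mul hbe (res_hmx hG 0).
    move=> a b; have [x ->] := one _ _ (psi 0) (r 0) r'0.
    by apply/II'; apply: (res_image hG).
  - by rewrite e mulmx0 !mul0mx.
  - by move=> a b; rewrite e mxE mcoeff0.
have e : psi i *m (al' *m be' - 1%:M - h *m psi i) = 0.
  rewrite !mulmxBr mulmx1 mulmxA -eal -mulmxA -ebe !mulmxA -eh mulmxBl mul1mx.
  by rewrite subrr.
have hc b : exists w : 'cV[R]_(_), col b (al' *m be' - 1%:M - h *m psi i) = psi i.+1 *m w.
  by case: hG => _ [_ [_ _ _ hex]]; apply/hex; rewrite colE mulmxA e mul0mx.
have [W hW] := @fin_all_exists _ _ (fun b w => col b (al' *m be' - 1%:M - h *m psi i) = psi i.+1 *m w) hc.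
pose h' := \matrix_(x, b) W b x 0.
have E : al' *m be' - 1%:M - h *m psi i = psi i.+1 *m h'.
  apply/matrixP => a b; have /colP/(_ a) := hW b; rewrite !mxE => ->.
  by apply: eq_bigr => x _; rewrite mxE.
have E' : al' *m be' - 1%:M = h *m psi i + psi i.+1 *m h' by rewrite -E [RHS]addrC subrK.
exists al', be', h'; split=> //.
- apply: (res_lift hG); first exact: hmx_mul hal' (res_hmx hF _).
  by rewrite mulmxA -eal -mulmxA (res_complex hF) mulmx0.
- apply: (res_lift hF); first exact: hmx_mul hbe' (res_hmx hG _).
  by rewrite mulmxA -ebe -mulmxA (res_complex hG) mulmx0.
- by rewrite E' mulmxDl -[h *m _ *m _]mulmxA (res_complex hG) mulmx0 add0r.
- move=> a b; rewrite E' !mxE mcoeffD !raddf_sum /= !big1 ?addr0 // => x _.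
    by rewrite mcoeff0_is_multiplicative (res_minimal hG) mul0r.
  by rewrite mcoeff0_is_multiplicative (res_minimal hG) mulr0.
Qed.

(** Modulo the maximal ideal [al *m be] is the identity, so row [b] of [al] has an entry with
    nonzero constant term, and homogeneity equates the two shifts. *)
Lemma shifts_unique i (b : 'I_(r' i)) : exists a, @d i a = @d' i b.
Proof.
have [al [be [h [[hal hbe] _ _ _ /(_ b b)]]]] := comparison i.
rewrite !mxE eqxx mcoeffB mcoeff1 eqxx => /eqP; rewrite subr_eq0 raddf_sum => /eqP hs.
have [a ha] : exists a, (al b a * be a b)@_0%MM != 0.
  apply/existsP; apply: contraT => /existsPn hz; move: hs; rewrite big1.
    by move/eqP; rewrite eq_sym oner_eq0.
  by move=> a _; apply/eqP; have := hz a; rewrite negbK.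
exists a; move: ha; rewrite mcoeff0_is_multiplicative mulf_eq0 negb_or => /andP[/hal].
by rewrite mdeg0 add0n.
Qed.

End Comparison.

(** * Dimension and Hilbert functions *)

Section Dimension.
Variables (k : fieldType) (V : lmodType k).
Implicit Types (P Q : V -> Prop).

Definition is_subspace P :=
  P 0 /\ forall c x y, P x -> P y -> P (c *: x + y).

Lemma subspace_comb P m (c : 'I_m -> k) (b : 'I_m -> V) :
  is_subspace P -> (forall i, P (b i)) -> P (\sum_i c i *: b i).
Proof.
move=> [h0 hP] hb; apply: (big_ind P) => // [x y hx hy|i _].
  by rewrite -[x]scale1r; apply: hP.
by rewrite -[_ *: _]addr0; apply: hP.
Qed.

Definition indep_modulo Q m (b : 'I_m -> V) :=
  forall c : 'I_m -> k, Q (\sum_i c i *: b i) -> forall i, c i = 0.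
Definition span_modulo P Q m (b : 'I_m -> V) :=
  forall x, P x -> exists c : 'I_m -> k, Q (x - \sum_i c i *: b i).

(* [P / (P :&: Q)] has dimension [m]. *)
Definition qdim P Q m :=
  exists b : 'I_m -> V, [/\ forall i, P (b i), indep_modulo Q b & span_modulo P Q b].
Definition pdim P m := qdim P (fun x => x = 0) m.

(** If m < m', the matrix expressing the [b'] through the [b] has more rows than columns; a vector
    of its left kernel is a relation modulo [Q]. *)
Lemma steinitz P Q m m' (b : 'I_m -> V) (b' : 'I_m' -> V) : is_subspace Q ->
  span_modulo P Q b -> (forall i, P (b' i)) -> indep_modulo Q b' -> (m' <= m)%N.
Proof.
move=> hQ hb hP hi; rewrite leqNgt; apply/negP => lt.
have [M hM] := @fin_all_exists _ _ (fun j c => Q (b' j - \sum_i c i *: b i)) (fun j => hb _ (hP j)).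
pose A := \matrix_(j, i) M j i.
have /rowV0Pn[u /sub_kermxP hu u0] : kermx A != 0.
  rewrite kermx_eq0 /row_free; apply: contraTneq lt => <-.
  by rewrite -leqNgt rank_leq_col.
case/eqP: u0; apply/rowP => j; rewrite mxE; move: j; apply: (hi (fun j => u 0 j)).
have -> : \sum_j u 0 j *: b' j = \sum_j u 0 j *: (b' j - \sum_i M j i *: b i).
  rewrite [RHS](eq_bigr (fun j => u 0 j *: b' j - \sum_i (u 0 j * M j i) *: b i)); last first.
    by move=> j _; rewrite scalerBr scaler_sumr; congr (_ - _); apply: eq_bigr => i _; rewrite scalerA.
  rewrite sumrB exchange_big [X in _ - X]big1 ?subr0 // => i _.
  rewrite -scaler_suml (_ : \sum_j _ = 0) ?scale0r //.
  transitivity ((u *m A) 0 i); last by rewrite hu mxE.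
  by rewrite mxE; apply: eq_bigr => j _; rewrite mxE.
exact: subspace_comb.
Qed.

(** In coordinates for a basis of [P], [Q] becomes the row space of [A], and a basis of the
    complement [A^C] lifts a basis of the quotient. Coordinates bring matrix algebra to an ambient
    space that may be infinite-dimensional. *)
Lemma qdim_quotient P Q m m1 : is_subspace P -> is_subspace Q -> (forall x, Q x -> P x) ->
  pdim P m -> pdim Q m1 -> exists2 m2, m = (m1 + m2)%N & qdim P Q m2.
Proof.
move=> sP sQ QP [b [b1 b2 b3]] [u [u1 u2 u3]].
have {}b3 x : P x -> exists c : 'I_m -> k, x = \sum_i c i *: b i.
  by move=> /b3[c /eqP]; rewrite subr_eq0 => /eqP; exists c.
have {}u3 x : Q x -> exists c : 'I_m1 -> k, x = \sum_i c i *: u i.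
  by move=> /u3[c /eqP]; rewrite subr_eq0 => /eqP; exists c.
pose ev (c : 'rV[k]_m) := \sum_i c 0 i *: b i.
have evE (c : 'I_m -> k) : \sum_i c i *: b i = ev (\row_i c i).
  by apply: eq_bigr => i _; rewrite mxE.
have ev_lin (l : nat) (c : 'rV[k]_l) (M : 'M[k]_(l, m)) : ev (c *m M) = \sum_j c 0 j *: ev (row j M).
  rewrite /ev; under [RHS]eq_bigr do rewrite scaler_sumr.
  rewrite exchange_big; apply: eq_bigr => i _; rewrite mxE scaler_suml.
  by apply: eq_bigr => j _; rewrite scalerA !mxE.
have evD c c' : ev (c + c') = ev c + ev c'.
  by rewrite /ev -big_split; apply: eq_bigr => i _; rewrite mxE scalerDl.
have ev0 c : ev c = 0 -> c = 0 by move=> /b2 h; apply/rowP => i; rewrite h mxE.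
have evP c : P (ev c) by apply: subspace_comb.
have [U hU] := @fin_all_exists _ _ (fun j c => u j = \sum_i c i *: b i) (fun j => b3 _ (QP _ (u1 j))).
pose A := \matrix_(j, i) U j i.
have hA j : ev (row j A) = u j by rewrite hU evE; congr ev; apply/rowP => i; rewrite !mxE.
have fA : row_free A.
  rewrite -kermx_eq0; apply/rowV0P => v /sub_kermxP hv; apply/rowP => j; rewrite mxE.
  apply: (u2 (fun j => v 0 j)).
  have := ev_lin _ v A; rewrite hv => e; rewrite -[RHS](_ : ev 0 = 0).
    by rewrite e; apply: eq_bigr => i _; rewrite hA.
  by rewrite /ev big1 // => i _; rewrite mxE scale0r.
have QA c : Q (ev c) <-> (c <= A)%MS.
  split=> [/u3[v hv]|/submxP[D ->]]; last first.
    by rewrite ev_lin; apply: subspace_comb => // j; rewrite hA.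
  have : ev (c - (\row_j v j) *m A) = 0.
    have h : ev ((\row_j v j) *m A) = ev c.
      by rewrite ev_lin hv; apply: eq_bigr => j _; rewrite hA mxE.
    have := evD (c - (\row_j v j) *m A) ((\row_j v j) *m A); rewrite subrK h.
    by move/eqP; rewrite -subr_eq subrr => /eqP.
  by move=> /ev0 /eqP; rewrite subr_eq0 => /eqP ->; apply: submxMl.
pose C := row_base (A^C)%MS.
exists (\rank (A^C)%MS).
  by rewrite mxrank_compl (eqP fA) subnKC // -(eqP fA) rank_leq_col.
exists (fun j => ev (row j C)); split=> [j|c|x hx] //.
  have -> : \sum_j c j *: ev (row j C) = ev ((\row_j c j) *m C).
    by rewrite ev_lin; apply: eq_bigr => j _; rewrite mxE.
  move=> /QA h.
  have h' : ((\row_j c j) *m C <= (A^C)%MS)%MS.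
    by apply: submx_trans (submxMl _ _) _; rewrite eq_row_base.
  have /eqP : (\row_j c j) *m C = 0.
    by apply/eqP; rewrite -submx0 -(capmx_compl A) sub_capmx h h'.
  rewrite mulmx_free_eq0 ?row_base_free // => /eqP/rowP h0 j.
  by have := h0 j; rewrite !mxE.
have [v ->] := b3 x hx; rewrite evE; set w := \row_i v i.
have : (w <= A + A^C)%MS by apply: submx_full; apply: addsmx_compl_full.
move=> /sub_addsmxP[[v1 v2] /= ->].
have /submxP[D hD] : (v2 *m A^C <= C)%MS by rewrite eq_row_base submxMl.
exists (fun j => D 0 j); rewrite -ev_lin -hD evD addrK; apply/QA; exact: submxMl.
Qed.

End Dimension.

Lemma rank_nullity (k : fieldType) (V W : lmodType k) (f : {linear V -> W}) (P : V -> Prop) m m1 :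
  is_subspace P -> pdim P m -> pdim (fun x => P x /\ f x = 0) m1 ->
  exists2 m2, m = (m1 + m2)%N & pdim (fun y => exists2 x, P x & y = f x) m2.
Proof.
move=> sP hP hK.
have sK : is_subspace (fun x => P x /\ f x = 0).
  case: sP => h0 h; split=> [|c x y [hx fx] [hy fy]]; first by rewrite linear0.
  by split; [apply: h|rewrite linearP fx fy scaler0 addr0].
have [m2 e [b [b1 b2 b3]]] := qdim_quotient sP sK (fun x h => proj1 h) hP hK.
exists m2 => //; exists (fun i => f (b i)); split=> [i|c hc|y [x hx ->]].
- by exists (b i).
- apply: b2; split; first exact: subspace_comb.
  by rewrite linear_sum; under eq_bigr do rewrite linearZ.
have [c [_ hc]] := b3 x hx; exists c.
transitivity (f (x - \sum_i c i *: b i)); last exact: hc.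
by rewrite [RHS]linearB /= (linear_sum f); congr (_ - _); apply: eq_bigr => i _; rewrite linearZ.
Qed.

Definition mons n j : seq 'X_{1..n} := [seq s2m t | t : j.-tuple 'I_n <- enum (basis n j)].

Lemma mem_mons n j (m : 'X_{1..n}) : (m \in mons n j) = (mdeg m == j).
Proof. by rewrite /mons -basis_cover. Qed.

Lemma uniq_mons n j : uniq (mons n j).
Proof. exact: uniq_basis. Qed.

Lemma sum_size_mons n D : (\sum_(j < D.+1) size (mons n j) = 'C(D + n, n))%N.
Proof.
case: n => [|n].
  rewrite bin0 big_ord_recl big1 ?addn0 => [|j _].
    suff /perm_size : perm_eq (mons 0 0) [:: 0%MM] by [].
    apply: uniq_perm; rewrite ?uniq_mons // => m; rewrite mem_mons inE mdeg_eq0 //.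
  apply/eqP; rewrite size_eq0; apply/eqP; case E : (mons _ _) => [//|m l].
  have : m \in mons 0 (lift ord0 j) by rewrite E mem_head.
  by rewrite mem_mons mdegE big_ord0.
elim: D => [|D IH].
  by rewrite big_ord_recl big_ord0 /mons size_basis bin0 add0n binn.
have e : 'C(D.+1 + n, D.+1) = 'C(D.+1 + n, n) by rewrite -bin_sub ?leq_addr // addKn.
by rewrite big_ord_recr /= IH /mons size_basis e [(D.+1 + n.+1)%N]addnS binS addSnnS.
Qed.

Section GradedDimension.
Variables (k : fieldType) (n : nat).
Local Notation R := {mpoly k[n]}.

Section GPart.
Variables (r : nat) (d : 'I_r -> nat) (e : nat).

Definition gpart (x : {ffun 'I_r -> R}) : Prop :=
  forall a mm, (x a)@_mm != 0 -> (mdeg mm + d a = e)%N.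

Definition gcount : nat := (\sum_a (if (d a <= e)%N then size (mons n (e - d a)) else 0))%N.

Lemma gpart_subspace : is_subspace gpart.
Proof.
split=> [a mm|c x y hx hy a mm]; first by rewrite ffunE mcoeff0 eqxx.
rewrite !ffunE mcoeffD mcoeffZ => h.
case: (eqVneq (x a)@_mm 0) => hxa; last exact: hx hxa.
by apply: hy; apply: contra_neq h => ->; rewrite hxa mulr0 addr0.
Qed.

Lemma gpart_dim : pdim gpart gcount.
Proof.
pose l := [seq (a, mm) | a <- enum 'I_r, mm <- (if (d a <= e)%N then mons n (e - d a) else [::])].
have ul : uniq l.
  apply: allpairs_uniq_dep => [|a _|]; first exact: enum_uniq.
    by case: ifP => // _; apply: uniq_mons.
  by move=> [a mm] [a' mm'] _ _ /= [-> ->].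
have ml a mm : ((a, mm) \in l) = (mdeg mm + d a == e)%N.
  apply/allpairsPdep/eqP => [[a' [mm' [_ h [-> ->]]]]|h].
    move: h; case: leqP => // h; rewrite mem_mons => /eqP ->; exact: subnK.
  have hle : (d a <= e)%N by rewrite -h leq_addl.
  exists a, mm; rewrite mem_enum hle mem_mons; split=> //.
  by rewrite -h addnK.
have -> : gcount = size l.
  rewrite size_allpairs_dep sumnE big_map enumT; apply: eq_bigr => a _.
  by case: ifP.
pose bb (i : 'I_(size l)) : {ffun 'I_r -> R} :=
  [ffun a => ((tnth (in_tuple l) i).1 == a)%:R *: 'X_[(tnth (in_tuple l) i).2]].
have bE (c : 'I_(size l) -> k) a mm :
    ((\sum_i c i *: bb i) a)@_mm = \sum_i c i * (tnth (in_tuple l) i == (a, mm))%:R.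
  rewrite sum_ffunE raddf_sum; apply: eq_bigr => i _ /=.
  rewrite !ffunE !mcoeffZ mcoeffX -natrM mulnb; congr (_ * _%:R).
exists bb; split=> [i a mm|c hc i|x hx].
- rewrite ffunE mcoeffZ mcoeffX -natrM mulnb.
  have := mem_tnth i (in_tuple l); case: (tnth _ i) => [a' mm'] /= hl.
  case: (eqVneq a' a) => [<-|_]; rewrite ?eqxx //=; case: (eqVneq mm' mm) => [<-|_]; rewrite ?eqxx // => _.
  by apply/eqP; rewrite -ml.
- have := bE c (tnth (in_tuple l) i).1 (tnth (in_tuple l) i).2.
  rewrite hc ffunE mcoeff0 (bigD1 i) //= -surjective_pairing eqxx mulr1 big1 ?addr0 // => j ji.
  rewrite (_ : (_ == _) = false) ?mulr0 //; apply: contraNF ji.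
  have x0 : 'I_r * 'X_{1..n} by exact: tnth (in_tuple l) i.
  by rewrite !(tnth_nth x0) nth_uniq.
exists (fun i => (x (tnth (in_tuple l) i).1)@_(tnth (in_tuple l) i).2).
apply/eqP; rewrite subr_eq0; apply/eqP/ffunP => a; apply/mpolyP => mm; rewrite bE.
case: (boolP ((a, mm) \in l)) => [h|h].
  have [i hi] : exists i, tnth (in_tuple l) i = (a, mm) 
    by have /tnthP[i ->] : (a, mm) \in in_tuple l by []; exists i.
  rewrite (bigD1 i) //= hi eqxx mulr1 big1 ?addr0 // => j ji.
  rewrite (_ : (_ == _) = false) ?mulr0 //; apply: contraNF ji.
  by rewrite -hi !(tnth_nth (a, mm)) nth_uniq.
rewrite big1 => [|i _].
  by apply/eqP; apply: contraNT h => /hx /eqP; rewrite ml.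
rewrite (_ : (_ == _) = false) ?mulr0 //; apply: contraNF h => /eqP <-.
by rewrite mem_tnth.
Qed.

End GPart.

Lemma pdim_ext (V : lmodType k) (P P' : V -> Prop) m : (forall x, P x <-> P' x) -> pdim P m -> pdim P' m.
Proof.
move=> h [b [b1 b2 b3]]; exists b; split=> // [i|x /h]; [exact/h|exact: b3].
Qed.

Section HilbertRes.
Variables (I : R -> Prop) (r : nat -> nat) (d : forall i, 'I_(r i) -> nat).
Variable phi : forall i, 'M[R]_(r i, r i.+1).
Hypothesis hI : is_ideal I.
Hypothesis hres : min_graded_free_res I d phi.
Variables (L e : nat).
Hypothesis hL : forall i, (L < i)%N -> r i = 0%N.

Definition rmap i (x : {ffun 'I_(r i.+1) -> R}) : {ffun 'I_(r i) -> R} :=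
  [ffun a => \sum_b phi i a b * x b].
Lemma rmap_is_linear i : linear (@rmap i).
Proof.
move=> c x y; apply/ffunP => a; rewrite !ffunE scaler_sumr -big_split; apply: eq_bigr => b _ /=.
by rewrite !ffunE mulrDr scalerAr.
Qed.
HB.instance Definition _ i := GRing.isLinear.Build k _ _ _ (@rmap i) (@rmap_is_linear i).

Definition rimage i (y : {ffun 'I_(r i) -> R}) : Prop := exists2 x, gpart (@d i.+1) e x & y = rmap x.

Lemma rmapE i x : \col_a rmap (i := i) x a = phi i *m \col_b x b.
Proof. by apply/colP => a; rewrite !mxE ffunE; apply: eq_bigr => b _; rewrite mxE. Qed.

Lemma gpart_hmx i (x : {ffun 'I_(r i) -> R}) : gpart (@d i) e x ->
  hmx (\col_a x a) (@d i) (fun _ => e).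
Proof. by move=> h a b mm; rewrite mxE; apply: h. Qed.

Lemma hmx_gpart i (W : 'cV[R]_(r i)) : hmx W (@d i) (fun _ => e) ->
  gpart (@d i) e [ffun a => W a 0].
Proof. by move=> h a mm; rewrite ffunE; apply: h. Qed.

Lemma rimageP i x : gpart (@d i.+1) e x /\ rmap x = 0 <-> rimage x.
Proof.
split=> [[hx h0]|[y hy ->]].
  have [|W hW eW] := res_lift hres (gpart_hmx hx).
    by rewrite -rmapE h0; apply/colP => a; rewrite !mxE ffunE.
  exists [ffun a => W a 0]; first exact: hmx_gpart.
  apply/ffunP => a; have /colP/(_ a) := eW; rewrite !mxE ffunE => ->.
  by apply: eq_bigr => b _; rewrite ffunE.
split.
  have hm := hmx_mul (res_hmx hres i.+1) (gpart_hmx hy).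
  by move=> a mm; rewrite ffunE => h; apply: (hm a 0); rewrite -rmapE mxE ffunE.
apply/ffunP => a; have /colP/(_ a) : \col_a rmap (rmap y) a = 0.
  by rewrite !rmapE mulmxA (res_complex hres) mul0mx.
by rewrite !mxE !ffunE.
Qed.

(** Descending induction on the place: by exactness the kernel on the degree-[e] part is the next
    image, so rank-nullity expresses each image through the next one. *)
Lemma rimage_dim i : exists2 m, pdim (rimage (i := i)) m &
  m%:Z = \sum_(l < L - i) (-1) ^+ l * (gcount (@d (i + l.+1)%N) e)%:Z.
Proof.
have [j] := ubnP (L - i)%N; elim: j i => // j IH i; rewrite ltnS => hj.
have [h0|hi] := leqP L i.
  exists 0%N; last by rewrite (_ : L - i = 0)%N ?big_ord0 //; lia.
  have r0 : r i.+1 = 0%N by apply: hL; lia.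
  have bb : 'I_0 -> {ffun 'I_(r i) -> R} by case.
  exists bb; split=> [[]//|c _ []//|y [x _ ->]]; exists (fun=> 0).
  rewrite big_ord0 subr0; apply/ffunP => a; rewrite !ffunE.
  by apply: big1 => b; have := ltn_ord b; rewrite [X in (_ < X)%N]r0.
have [|m hm em] := IH i.+1; first by lia.
have [m2 e2 h2] := rank_nullity (f := @rmap i) (gpart_subspace _ _) (gpart_dim (@d i.+1) e)
   (pdim_ext (fun x => iff_sym (rimageP x)) hm).
exists m2 => //.
have -> : (L - i = (L - i.+1).+1)%N by lia.
rewrite big_ord_recl /= expr0 mul1r addn1.
have -> : m2%:Z = (gcount (@d i.+1) e)%:Z - m%:Z by rewrite e2 PoszD; ring.
rewrite em -sumrN; congr (_ + _); apply: eq_bigr => l _.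
by rewrite /bump /= add1n exprS mulN1r mulNr -!addSnnS.
Qed.

(** Evaluation at the single generator of place 0 is injective and identifies the image there with
    the degree-[e] part of [I], which is then subtracted from the degree-[e] part of the ring. *)
Lemma hilbert_res (H : nat -> nat) : hilbert_function I H ->
  (H e)%:Z = \sum_(i < L.+1) (-1) ^+ i * (gcount (@d i) e)%:Z.
Proof.
move=> hH.
have r0 : r 0 = 1%N by case: hres.
have d0 a : @d 0 a = 0%N by case: hres => _ [].
have a0 : 'I_(r 0) by rewrite r0; exact: ord0.
have ea (a : 'I_(r 0)) : a = a0 by move: a a0; rewrite r0 => a a'; rewrite !ord1.
pose ev (x : {ffun 'I_(r 0) -> R}) : R := x a0.
have ev_lin : linear ev by move=> c x y; rewrite /ev !ffunE.
pose evm := GRing.isLinear.Build k _ _ _ ev ev_lin.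
pose evl : {linear {ffun 'I_(r 0) -> R} -> R} := HB.pack ev evm.
have ker0 (P : {ffun 'I_(r 0) -> R} -> Prop) : is_subspace P -> pdim (fun x => P x /\ evl x = 0) 0.
  move=> _; have bb : 'I_0 -> {ffun 'I_(r 0) -> R} by case.
  exists bb; split=> [[]//|c _ []//|x [_ hx]]; exists (fun=> 0); rewrite big_ord0 subr0.
  by apply/ffunP => a; rewrite (ea a) ffunE.
pose Re (p : R) := is_homog e p.
have sRe : is_subspace Re.
  split=> [|c x y hx hy]; first exact: dhomog0.
  by apply: dhomogD => //; apply: dhomogZ.
pose Ie (p : R) := I p /\ Re p.
have sIe : is_subspace Ie.
  case: sRe => h0 h; split=> [|c x y [hx hx'] [hy hy']]; split=> //; first exact: ideal0.
    by apply: idealD => //; rewrite -mul_mpolyC; apply: idealM.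
  exact: h.
have [m hm em] := rimage_dim 0.
have sim : is_subspace (rimage (i := 0)).
  split=> [|c x y [u hu ->] [v hv ->]].
    by exists 0; rewrite ?linear0 //; case: (gpart_subspace (@d 1) e).
  exists (c *: u + v); last by rewrite linearP.
  by case: (gpart_subspace (@d 1) e) => _; apply.
have [m1 e1 hR] := rank_nullity (gpart_subspace (@d 0) e) (gpart_dim (@d 0) e) (ker0 _ (gpart_subspace (@d 0) e)).
have [m1' e1' hJ] := rank_nullity sim hm (ker0 _ sim).
have {}hR : pdim Re (gcount (@d 0) e).
  rewrite e1 add0n; apply: pdim_ext hR => p; split=> [[x hx ->]|hp].
    by apply/dhomogP => mm; rewrite mcoeff_msupp => /hx; rewrite d0 addn0.
  exists [ffun=> p]; last by rewrite /= /ev ffunE.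
  move=> a mm; rewrite ffunE d0 addn0 -mcoeff_msupp; exact: (dhomogP _ _ _ hp).
have {}hJ : pdim Ie m.
  rewrite e1' add0n; apply: pdim_ext hJ => p; split=> [[x [y hy ->] ->]|[hp hp']].
    split.
      rewrite /= /ev ffunE; apply: ideal_sum => // b _; rewrite mulrC; apply: idealM => //.
      exact: (res_image hres).
    have hm' := hmx_mul (res_hmx hres 0) (gpart_hmx hy).
    apply/dhomogP => mm; rewrite mcoeff_msupp /= /ev => h.
    by have := hm' a0 0 mm; rewrite -rmapE mxE d0 addn0; apply.
  have [||W hW eW] := @res_lift0 _ _ _ _ _ _ hres 1 (const_mx p) (fun=> e).
  - move=> a b mm; rewrite mxE d0 addn0 -mcoeff_msupp; exact: (dhomogP _ _ _ hp').
  - by move=> a b; rewrite mxE.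
  exists (rmap [ffun a => W a 0]); first by exists [ffun a => W a 0] => //; apply: hmx_gpart.
  have /matrixP/(_ a0 0) := eW; rewrite !mxE => ->; rewrite /= /ev ffunE.
  by apply: eq_bigr => b _; rewrite ffunE.
have [m2 e2 [b [b1 b2 b3]]] := qdim_quotient sRe sIe (fun x h => proj2 h) hR hJ.
(* [hilbert_function] speaks only of independent families: one inequality is Steinitz, the other is
   maximality of [H e]. *)
have -> : H e = m2.
  have [[p [p1 p2]] hmax] := hH e.
  apply/eqP; rewrite eqn_leq; apply/andP; split.
    apply: (steinitz sIe b3 p1) => c [hc _]; exact: p2.
  apply: (hmax _ b); split=> // c hc; apply: b2; split=> //.
  exact: (subspace_comb c sRe b1).
have -> : m2%:Z = (gcount (@d 0) e)%:Z - m%:Z by rewrite e2 PoszD; ring.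
rewrite em subn0 big_ord_recl expr0 mul1r -sumrN; congr (_ + _); apply: eq_bigr => l _.
by rewrite lift0 add0n exprS mulN1r mulNr.
Qed.

End HilbertRes.

Lemma sum_gcount r (d : 'I_r -> nat) D :
  (\sum_(e < D.+1) gcount d e = \sum_a (if (d a <= D)%N then 'C(D - d a + n, n) else 0))%N.
Proof.
rewrite exchange_big; apply: eq_bigr => a _ /=; case: leqP => h; last first.
  by apply: big1 => e _; rewrite leqNgt (leq_ltn_trans _ h) // -ltnS.
rewrite -sum_size_mons -[in LHS](big_mkord xpredT (fun e => if (d a <= e)%N then size (mons n (e - d a)) else 0%N)).
rewrite (@big_cat_nat _ _ _ (d a)) //=; last by rewrite leqW.
rewrite big_nat big1 ?add0n => [|e he]; last by rewrite leqNgt; move: he => /= ->.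
rewrite -{1}[d a]add0n big_addn big_mkord subSn //; apply: eq_bigr => j _.
by rewrite leq_addl addnK.
Qed.

End GradedDimension.

(** * Dimension bound from the growth of the Hilbert function *)

Section TranscendenceBound.
Variables (k : fieldType) (n : nat).
Local Notation R := {mpoly k[n]}.

Definition deg_le (E : nat) (p : R) : Prop := forall mm, p@_mm != 0 -> (mdeg mm <= E)%N.

Lemma deg_leM E F p q : deg_le E p -> deg_le F q -> deg_le (E + F) (p * q).
Proof.
move=> hp hq mm; rewrite -mcoeff_msupp => /msuppM_le /allpairsP[[m1 m2] /= [h1 h2 ->]].
rewrite mdegD; rewrite !mcoeff_msupp in h1 h2.
exact: leq_add (hp _ h1) (hq _ h2).
Qed.

Lemma deg_leX E p j : deg_le E p -> deg_le (E * j) (p ^+ j).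
Proof.
move=> hp; elim: j => [|j IH].
  by move=> mm; rewrite expr0 mcoeff1; case: (eqVneq mm 0%MM) => [->|_]; rewrite ?mdeg0 ?eqxx.
by rewrite exprS mulnS; apply: deg_leM.
Qed.

Lemma deg_le_prod m (F : 'I_m -> R) (E : 'I_m -> nat) :
  (forall i, deg_le (E i) (F i)) -> deg_le (\sum_i E i) (\prod_i F i).
Proof.
move=> h; apply: (big_ind2 (fun x y => deg_le y x)) => //.
  by move=> mm; rewrite mcoeff1; case: (eqVneq mm 0%MM) => [->|_]; rewrite ?mdeg0 ?eqxx.
by move=> x1 x2 y1 y2; apply: deg_leM.
Qed.

Variables (I : R -> Prop) (H : nat -> nat).
Hypothesis hI : is_ideal I.
Hypothesis hH : hilbert_function I H.

Lemma ideal_subspace : is_subspace I.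
Proof.
split=> [|c x y hx hy]; first exact: ideal0.
by apply: idealD => //; rewrite -mul_mpolyC; apply: idealM.
Qed.

(** A maximal independent family spans: adjoining [x] creates a relation in which the coefficient of
    [x] is invertible. *)
Lemma hilbert_span e : exists b : 'I_(H e) -> R, span_modulo (is_homog e) I b.
Proof.
have [[b [b1 b2]] hmax] := hH e; exists b => x hx.
pose b' (i : 'I_(H e).+1) := if unlift ord_max i is Some j then b j else x.
have : ~ indep_mod I e b' by move/hmax; rewrite ltnn.
move=> h; have {}h : ~ forall cf : 'I_(H e).+1 -> k, I (\sum_a cf a *: b' a) -> forall a, cf a = 0.
  move=> h'; apply: h; split=> // a; rewrite /b'; case: unlift => //.
have [cf hc] := not_all_ex_not _ _ h; have [hcf hne] := imply_to_and _ _ hc.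
have sE : \sum_a cf a *: b' a = \sum_a cf (lift ord_max a) *: b a + cf ord_max *: x.
  rewrite big_ord_recr /=; congr (_ + _ *: _); last by rewrite /b' unlift_none.
  apply: eq_bigr => i _; rewrite /b' (_ : widen_ord _ _ = lift ord_max i) ?liftK //.
  by apply: val_inj; rewrite /= /bump leqNgt ltn_ord.
case: (eqVneq (cf ord_max) 0) => c0.
  case: hne => a; move: hcf; rewrite sE c0 scale0r addr0 => /b2 hz.
  by case: (unliftP ord_max a) => [j|] ->.
exists (fun a => - ((cf ord_max)^-1 * cf (lift ord_max a))).
suff -> : x - \sum_i - ((cf ord_max)^-1 * cf (lift ord_max i)) *: b i =
   ((cf ord_max)^-1)%:MP * (\sum_a cf a *: b' a) by apply: idealM.
rewrite mul_mpolyC sE scalerDr scalerA mulVf // scale1r addrC scaler_sumr -sumrN; congr (_ + _).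
by apply: eq_bigr => i _; rewrite scalerA scaleNr opprK.
Qed.

Lemma hilbert_span_le E :
  exists b : 'I_(\sum_(j < E.+1) H j) -> R, span_modulo (deg_le E) I b.
Proof.
elim: E => [|E [b hb]].
  rewrite big_ord1; have [b hb] := hilbert_span 0; exists b => x hx; apply: hb.
  apply/dhomogP => mm; rewrite mcoeff_msupp => /hx; rewrite leqn0 => /eqP //.
rewrite big_ord_recr /=; have [b' hb'] := hilbert_span E.+1.
exists (fun i => match split i with inl j => b j | inr j => b' j end) => x hx.
have [|c' hc'] := hb' (pihomog mdeg E.+1 x); first exact: pihomogP.
have [|c hc] := hb (x - pihomog mdeg E.+1 x).
  move=> mm; rewrite mcoeffB mcoeff_pihomog; case: (eqVneq (mdeg mm) E.+1) => [e|ne].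
    by rewrite subrr eqxx.
  by rewrite subr0 => /hx h; rewrite -ltnS ltn_neqAle ne h.
exists (fun i => match split i with inl j => c j | inr j => c' j end).
rewrite big_split_ord /=.
under eq_bigr do rewrite (unsplitK (inl _)).
under [X in _ - (_ + X)]eq_bigr do rewrite (unsplitK (inr _)).
by have := idealD hI hc hc'; congr I; rewrite opprD addrACA subrK.
Qed.

(** The monomials in the y_i with all exponents at most [q] are independent modulo [I] and have
    degree at most D q m. *)
Lemma alg_indep_count m (y : 'I_m -> R) (D q : nat) :
  (forall P : {mpoly k[m]}, I (mmap (mpolyC n (R := k)) y P) -> P = 0) ->
  (forall i, deg_le D (y i)) -> (q.+1 ^ m <= \sum_(j < (D * (q * m)).+1) H j)%N.
Proof.
move=> hy hD; have [b hb] := hilbert_span_le (D * (q * m)).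
pose T : finType := {ffun 'I_m -> 'I_q.+1}.
have <- : #|T| = (q.+1 ^ m)%N by rewrite card_ffun !card_ord.
pose mon (f : T) : 'X_{1..m} := [multinom (f i : nat) | i < m].
apply: (steinitz (b' := fun j : 'I_(#|T|) => mmap1 y (mon (enum_val j))) ideal_subspace hb) => [j|c hc].
  move: (enum_val j) => f mm hm.
  have := deg_le_prod (F := fun i => y i ^+ mon f i) (fun i => @deg_leX _ _ (mon f i) (hD i)) hm.
  rewrite -big_distrr /= => h; apply: leq_trans h _; rewrite leq_mul2l; apply/orP; right.
  rewrite -[X in (_ * X)%N](card_ord m) mulnC -sum_nat_const; apply: leq_sum => i _.
  by rewrite mnmE -ltnS.
pose P : {mpoly k[m]} := \sum_j c j *: 'X_[mon (enum_val j)].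
have /mpolyP hP : P = 0.
  apply: hy; move: hc; congr I; rewrite raddf_sum; apply: eq_bigr => j _ /=.
  by rewrite mmapZ mmapX mul_mpolyC.
move=> j; have := hP (mon (enum_val j)); rewrite mcoeff0 raddf_sum (bigD1 j) //=.
rewrite mcoeffZ mcoeffX eqxx mulr1 big1 ?addr0 // => i ij.
rewrite mcoeffZ mcoeffX (_ : (_ == _) = false) ?mulr0 //.
apply: contraNF ij => /eqP/mnmP h; apply/eqP/enum_val_inj/ffunP => x; apply: val_inj.
by have := h x; rewrite !mnmE.
Qed.

End TranscendenceBound.

Lemma poly_bound (Q : {poly rat}) : exists2 C : rat, 0 <= C &
  forall x : rat, 0 <= x -> Q.[x] <= C * (1 + x) ^+ (size Q).-1.
Proof.
exists (\sum_(i < size Q) `|Q`_i|); first by apply: sumr_ge0.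
move=> x x0; rewrite horner_coef mulr_suml; apply: ler_sum => i _.
apply: le_trans (ler_norm _) _; rewrite normrM; apply: ler_wpM2l => //.
rewrite ger0_norm ?exprn_ge0 //.
apply: le_trans (_ : (1 + x) ^+ i <= _); first by apply: lerXn2r; rewrite ?nnegrE; lra.
by apply: ler_weXn2l; [lra|case: (size Q) i => [[]//|s] i; rewrite -ltnS].
Qed.

(** For m > deg Q the count (q+1)^m would outgrow the values of Q at multiples of q. *)
Lemma trdeg_le_hilbert (k : fieldType) n (I : {mpoly k[n]} -> Prop) (H : nat -> nat) (Q : {poly rat}) :
  is_ideal I -> hilbert_function I H -> hilbert_samuel_poly H Q -> trdeg_le I (size Q).-1.
Proof.
move=> hI hH [d0 hQ] m y hy; rewrite leqNgt; apply/negP => hm.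
have [D hD] : exists D, forall i, deg_le D (y i).
  exists (\max_i msize (y i)) => i mm; rewrite -mcoeff_msupp => /msize_mdeg_lt h.
  by apply: leq_trans (ltnW h) _; apply: leq_bigmax.
(* A positive degree bound makes D.+1 q m reach [d0], from where the polynomial formula holds. *)
have hD1 i : deg_le D.+1 (y i) by move=> mm /(hD i) h; apply: leqW.
have [C C0 hC] := poly_bound Q.
pose N := (D.+1 * m)%N.
pose B := C * (1 + N%:R) ^+ (size Q).-1.
have key q : (d0 <= q)%N -> (q.+1%:R : rat) <= B.
  move=> hq; have := @alg_indep_count _ _ _ _ hI hH _ y D.+1 q hy hD1.
  have hle : (d0 <= D.+1 * (q * m))%N.
    by apply: leq_trans hq _; rewrite mulnCA leq_pmulr // muln_gt0 /= (leq_ltn_trans _ hm).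
  rewrite -(ler_nat rat) hQ // => /le_trans h.
  have {h} := h _ (hC _ (ler0n _ _)); rewrite natrX.
  have -> : (D.+1 * (q * m))%:R = N%:R * q%:R :> rat by rewrite -natrM mulnCA mulnC.
  have e : (1 + N%:R * q%:R : rat) <= (1 + N%:R) * q.+1%:R.
    have: (0 : rat) <= N%:R by []. have : (0 : rat) <= q%:R by [].
    rewrite -[q.+1]addn1 natrD; nra.
  have q0 : (0 : rat) < q.+1%:R by [].
  have hX : (1 + N%:R * q%:R : rat) ^+ (size Q).-1 <= ((1 + N%:R) * q.+1%:R) ^+ (size Q).-1.
    by apply: lerXn2r => //; rewrite nnegrE ?mulr_ge0 ?addr_ge0 ?mulr_ge0 ?ler0n.
  move=> /le_trans /(_ (ler_wpM2l C0 hX)); rewrite exprMn mulrA -/B.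
  rewrite -{1}(subnK hm) exprD exprS mulrA ler_pM2r ?exprn_gt0 //.
  apply: le_trans; rewrite ler_peMl ?(ltW q0) // exprn_ege1 //.
  by rewrite ler1n.
have B0 : 0 <= B by rewrite mulr_ge0 // exprn_ge0 // addr_ge0.
have := archi_boundP B0; set q1 := Num.Def.archi_bound B => hq1.
have := key (maxn d0 q1) (leq_maxl _ _).
have : (q1%:R : rat) <= (maxn d0 q1).+1%:R by rewrite ler_nat leqW // leq_maxr.
by move=> h1 h2; have := lt_le_trans hq1 (le_trans h1 h2); rewrite ltxx.
Qed.

(** * Hilbert series numerators and multiplicity *)

Section HilbertConvolution.
Variable n : nat.

(* The coefficient of [z^D] in [K(z) / (1 - z)^(n+1)]. *)
Definition hconv (K : {poly int}) (D : nat) : rat :=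
  \sum_(i < D.+1) (K`_i)%:~R * ('C(D - i + n, n))%:R.

Lemma hconvD K K' D : hconv (K + K') D = hconv K D + hconv K' D.
Proof. by rewrite /hconv -big_split; apply: eq_bigr => i _; rewrite coefD intrD mulrDl. Qed.

Lemma hconvB K K' D : hconv (K - K') D = hconv K D - hconv K' D.
Proof. by rewrite /hconv -sumrB; apply: eq_bigr => i _; rewrite coefB intrB mulrBl. Qed.

Lemma hconvM c K D : hconv (c%:P * K) D = c%:~R * hconv K D.
Proof. by rewrite /hconv mulr_sumr; apply: eq_bigr => i _; rewrite coefCM intrM mulrA. Qed.

Lemma hconv0 D : hconv 0 D = 0.
Proof. by rewrite /hconv big1 // => i _; rewrite coef0 mul0r. Qed.

Lemma hconv_sum (T : Type) (r : seq T) (P : pred T) (F : T -> {poly int}) D :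
  hconv (\sum_(x <- r | P x) F x) D = \sum_(x <- r | P x) hconv (F x) D.
Proof. by elim/big_rec2: _ => [|x y1 y2 _ <-]; rewrite ?hconv0 ?hconvD. Qed.

Lemma hconvXn f K D : hconv ('X^f * K) (D + f) = hconv K D.
Proof.
rewrite /hconv -(big_mkord xpredT (fun i => (('X^f * K)`_i)%:~R * ('C(D + f - i + n, n))%:R)).
rewrite (@big_cat_nat _ _ _ f) //=; last by rewrite leqW // leq_addl.
rewrite big_nat big1 ?add0r => [|i /= hi]; last by rewrite coefXnM hi mul0r.
rewrite -{1}[f]add0n big_addn subSn ?leq_addl // addnK big_mkord; apply: eq_bigr => i _.
by rewrite coefXnM ltnNge leq_addl addnK subnDr.
Qed.

Lemma hconvX f D : hconv 'X^f D = if (f <= D)%N then ('C(D - f + n, n))%:R else 0.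
Proof.
rewrite /hconv; case: leqP => h; last first.
  apply: big1 => i _; rewrite coefXn (_ : (_ == _) = false) ?mul0r //.
  by apply/negP => /eqP e; move: (ltn_ord i); rewrite e ltnS leqNgt h.
have hf : (f < D.+1)%N by [].
rewrite (bigD1 (Ordinal hf)) //= coefXn eqxx mul1r big1 ?addr0 // => i hi.
rewrite coefXn (_ : (_ == _) = false) ?mul0r //; apply: contraNF hi => /eqP e.
by apply/eqP/val_inj.
Qed.

(* [K] has a zero of order at least [n - m] at [1], with leading value [e]. *)
Definition eventually_poly (K : {poly int}) (m : nat) (e : rat) : Prop :=
  exists (q : {poly rat}) (D0 : nat),
    [/\ (size q <= m.+1)%N, q`_m * m`!%:R = e &
        forall D, (D0 <= D)%N -> hconv K D = q.[D%:R]].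

(** [hconv 1 D] is the binomial coefficient of D + n over n, a polynomial in D with leading
    coefficient 1/n!. *)
Lemma eventually_poly1 : eventually_poly 1 n 1.
Proof.
pose p := \prod_(i < n) ('X + (i.+1%:R)%:P) : {poly rat}.
have ms : p \is monic /\ size p = n.+1.
  rewrite /p; elim: (n) => [|m [IH1 IH2]]; first by rewrite big_ord0 monic1 size_poly1.
  rewrite big_ord_recr /=.
  have h : ('X + (m.+1%:R)%:P : {poly rat}) \is monic by rewrite -[_%:P]opprK -polyCN monicXsubC.
  split; first by rewrite monicMl.
  by rewrite size_Mmonic ?monic_neq0 // IH2 -[X in size ('X + X)]opprK -polyCN size_XsubC addn2.
have f0 : (n`!%:R : rat) != 0 by rewrite pnatr_eq0 -lt0n fact_gt0.
exists (n`!%:R^-1 *: p), 0%N; split=> [||D _].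
- by rewrite (leq_trans (size_scale_leq _ _)) // (proj2 ms).
- rewrite coefZ; have [/eqP] := ms; rewrite lead_coefE => h1 h2; rewrite h2 /= in h1.
  by rewrite h1 mulr1 mulVf.
have -> : 1 = 'X^0 :> {poly int} by [].
rewrite hconvX leq0n subn0 hornerZ /p horner_prod.
have -> : \prod_(i < n) ('X + (i.+1%:R)%:P).[D%:R] = (((D + n) ^_ n)%:R : rat).
  rewrite ffact_prod natr_prod (reindex_inj rev_ord_inj) /=; apply: eq_bigr => i _.
  by rewrite hornerD hornerX hornerC -natrD; congr (_%:R); have := ltn_ord i; lia.
by rewrite -bin_ffact natrM mulrC mulfK.
Qed.

Lemma eventually_poly0 m : eventually_poly 0 m 0.
Proof.
exists 0, 0%N; split=> [||D _]; rewrite ?size_poly0 ?coef0 ?mul0r //.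
by rewrite hconv0 horner0.
Qed.

Lemma eventually_polyD K K' m e e' : eventually_poly K m e -> eventually_poly K' m e' ->
  eventually_poly (K + K') m (e + e').
Proof.
move=> [q [D0 [h1 h2 h3]]] [q' [D0' [h1' h2' h3']]]; exists (q + q'), (maxn D0 D0'); split.
- by rewrite (leq_trans (size_polyD _ _)) // geq_max h1 h1'.
- by rewrite coefD mulrDl h2 h2'.
- by move=> D; rewrite geq_max => /andP[/h3 e1 /h3' e2]; rewrite hconvD e1 e2 hornerD.
Qed.

Section Shift.
Variable f : nat.
Local Notation shf q := (q \Po ('X - (f%:R)%:P) : {poly rat}).

Lemma shift_monomial j : (size ('X^j - ('X - (f%:R)%:P) ^+ j : {poly rat})%R <= j)%N /\
  ('X^j - ('X - (f%:R)%:P) ^+ j : {poly rat})`_j.-1 = (f * j)%:R.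
Proof.
case: j => [|j]; first by rewrite !expr0 subrr size_poly0 coef0 muln0.
rewrite subrXX opprB addrC subrK.
have h (i : 'I_j.+1) : let u := 'X^(j.+1.-1 - i) * ('X - (f%:R)%:P) ^+ i : {poly rat} in
   u \is monic /\ size u = j.+1.
  have m2 : ('X - (f%:R)%:P : {poly rat}) ^+ i \is monic by rewrite monic_exp ?monicXsubC.
  split; first by rewrite monicMl // monicXn.
  have s2 : size (('X - (f%:R)%:P : {poly rat}) ^+ i) = i.+1.
    by rewrite -[LHS]prednK ?size_poly_gt0 ?monic_neq0 // size_exp size_XsubC mul1n.
  by rewrite size_Mmonic ?monic_neq0 ?monicXn // size_polyXn s2 /=; have := ltn_ord i; lia.
have e0 (i : 'I_j.+1) : (j.+1 - i.+1 = j.+1.-1 - i)%N by rewrite subSS.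
split.
  apply: leq_trans (size_polyMleq _ _) _.
  have h1 : (size (f%:R%:P : {poly rat})%R <= 1)%N by apply: size_polyC_leq1.
  have h2 : (size (\sum_(i < j.+1) 'X^(j.+1 - i.+1) * ('X - (f%:R)%:P) ^+ i : {poly rat})%R <= j.+1)%N.
    apply: (leq_trans (size_sum _ _ _)); apply/bigmax_leqP => i _.
    by rewrite e0 (proj2 (h i)).
  by rewrite -subn1 leq_subLR; apply: leq_add.
rewrite coefCM coef_sum natrM; congr (_ * _).
rewrite -[RHS](_ : \sum_(i < j.+1) 1 = j.+1%:R :> rat); last by rewrite sumr_const card_ord.
apply: eq_bigr => i _; rewrite ?e0; have [/eqP] := h i.
by rewrite lead_coefE => h1 h2; rewrite h2 in h1.
Qed.

(** Expanded termwise, only the top monomial reaches degree [m], where [shift_monomial] supplies the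
    factor f (m+1). *)
Lemma shift_poly (q : {poly rat}) m : (size q <= m.+2)%N ->
  (size (q - shf q)%R <= m.+1)%N /\ (q - shf q)`_m = q`_m.+1 * (f * m.+1)%:R.
Proof.
move=> hq.
have E : q - shf q = \sum_(j < m.+2) q`_j *: ('X^j - ('X - (f%:R)%:P) ^+ j).
  have qE : q = \sum_(j < m.+2) q`_j *: 'X^j.
    rewrite -poly_def; apply/polyP => i; rewrite coef_poly; case: ltnP => // h.
    by rewrite nth_default // (leq_trans hq).
  rewrite {1}qE.
  rewrite (_ : shf q = \sum_(j < m.+2) q`_j *: ('X - (f%:R)%:P) ^+ j); last first.
    rewrite comp_polyE (big_ord_widen m.+2 (fun i : nat => q`_i *: ('X - (f%:R)%:P) ^+ i)) // big_mkcond /=.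
    apply: eq_bigr => j _; case: ltnP => // h; by rewrite nth_default // scale0r.
  by rewrite -sumrB; apply: eq_bigr => j _; rewrite scalerBr.
rewrite E; split.
  apply: (leq_trans (size_sum _ _ _)); apply/bigmax_leqP => j _.
  apply: leq_trans (size_scale_leq _ _) _; apply: leq_trans (proj1 (shift_monomial j)) _.
  by rewrite -ltnS.
rewrite coef_sum big_ord_recr /= big1 ?add0r => [|j _].
  by rewrite coefZ; have [_ /= ->] := shift_monomial m.+1.
rewrite coefZ [X in _ * X]nth_default ?mulr0 //; apply: leq_trans (proj1 (shift_monomial j)) _.
by rewrite -ltnS.
Qed.

Lemma eventually_poly_shift K m e : eventually_poly K m e -> eventually_poly ('X^f * K) m e.
Proof.
move=> [q [D0 [h1 h2 h3]]]; exists (shf q), (D0 + f)%N; split.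
- case: (m) h1 => [|m'] h1.
    by rewrite size_comp_poly2 // size_XsubC.
  by rewrite size_comp_poly2 ?size_XsubC.
- case: m h1 h2 => [|m] h1 h2.
    have hc : q = (q`_0)%:P by apply: size1_polyC.
    by rewrite hc comp_polyC coefC.
  have := shift_poly h1 => -[hs _].
  have : (q - shf q)`_m.+1 = 0 by rewrite nth_default.
  by rewrite coefB => /eqP; rewrite subr_eq0 => /eqP <-.
- move=> D hD; have hf : (f <= D)%N by apply: leq_trans hD; apply: leq_addl.
  rewrite -(subnK hf) hconvXn h3; last by rewrite leq_subRL // addnC.
  by rewrite horner_comp hornerXsubC subnK // natrB.
Qed.

(** Multiplication by 1 - z^f is a finite difference of step f; the factor m + 1 that it creates is
    absorbed by the factorial. *)
Lemma eventually_poly_diff K m e : eventually_poly K m.+1 e ->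
  eventually_poly ((1 - 'X^f) * K) m (f%:R * e).
Proof.
move=> [q [D0 [h1 h2 h3]]]; exists (q - shf q), (D0 + f)%N.
have [s1 s2] := shift_poly h1; split=> //.
  rewrite s2 -h2 factS !natrM; ring.
move=> D hD; have hf : (f <= D)%N by apply: leq_trans hD; apply: leq_addl.
rewrite mulrBl mul1r hconvB h3; last by apply: leq_trans hD; apply: leq_addr.
rewrite hornerD hornerN; congr (_ - _).
rewrite -(subnK hf) hconvXn h3; last by rewrite leq_subRL // addnC.
by rewrite horner_comp hornerXsubC subnK // natrB.
Qed.

End Shift.

Section Numerator.
Variables (a b : nat -> int).

(* The numerator of the Hilbert series of a determinantal ring, computed as if
   the last column were zero except for its last entry. *)
Fixpoint detnum (t c : nat) {struct t} : {poly int} :=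
  if t is t'.+1 then
    (fix aux c := if c is c'.+1 then
        'X^(`|a (t' + c')%N - b t'|%N) * detnum t' c'.+1
        + (1 - 'X^(`|a (t' + c')%N - b t'|%N)) * aux c'
      else 1) c
  else (c == 0%N)%:R.

Lemma detnumn0 t : detnum t 0 = 1. Proof. by case: t. Qed.
Lemma detnum0S c : detnum 0 c.+1 = 0. Proof. by []. Qed.
Lemma detnumSS t c : detnum t.+1 c.+1 =
  'X^(`|a (t + c)%N - b t|%N) * detnum t c.+1 + (1 - 'X^(`|a (t + c)%N - b t|%N)) * detnum t.+1 c.
Proof. by []. Qed.

(** The recursions of [detnum] and [detdeg] match term by term: z^f keeps the leading value, while 1
    - z^f multiplies it by f and lowers the degree by one. *)
Lemma detnum_eventually_poly t c : (c <= n)%N ->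
  (forall i l, (i < t)%N -> (l < c)%N -> b i <= a (i + l)%N) ->
  eventually_poly (detnum t c) (n - c) (detdeg a b t c)%:~R.
Proof.
elim: t c => [|t IHt] c hc hab.
  case: c hc hab => [|c] hc hab; first by rewrite subn0; apply: eventually_poly1.
  by rewrite detnum0S detdeg0S; apply: eventually_poly0.
elim: c hc hab => [|c IHc] hc hab; first by rewrite subn0; apply: eventually_poly1.
rewrite detnumSS detdegSS intrD intrM.
have hf : b t <= a (t + c)%N by apply: hab.
have -> : (a (t + c)%N - b t)%:~R = (`|a (t + c)%N - b t|%N)%:R :> rat.
  by rewrite -[LHS](_ : (`|a (t + c)%N - b t|%N : int)%:~R = _) // gez0_abs // subr_ge0.
apply: eventually_polyD.
  apply: eventually_poly_shift; apply: IHt => // i l hi hl; apply: hab => //; lia.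
apply: eventually_poly_diff; rewrite (_ : (n - c.+1).+1 = n - c)%N; last by lia.
by apply: IHc => [|i l hi hl]; [lia|apply: hab => //; lia].
Qed.

End Numerator.

Lemma poly_eventually_eq (p q : {poly rat}) D0 :
  (forall D : nat, (D0 <= D)%N -> p.[D%:R] = q.[D%:R]) -> p = q.
Proof.
move=> h; apply/eqP; rewrite -subr_eq0; apply: contraT => nz.
pose s := [seq (D%:R : rat) | D <- iota D0 (size (p - q))].
have us : uniq s by rewrite map_inj_uniq ?iota_uniq // => x y /eqP; rewrite eqr_nat => /eqP.
have rs : all (root (p - q)) s.
  apply/allP => x /mapP[D]; rewrite mem_iota => /andP[hD _] ->.
  by rewrite /root hornerD hornerN h // subrr.
by have := max_poly_roots nz rs us; rewrite size_map size_iota ltnn.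
Qed.

Lemma multiplicity_hconv (H : nat -> nat) (Q : {poly rat}) K m e :
  hilbert_samuel_poly H Q -> size Q = m.+1 -> eventually_poly K m e ->
  (forall D, (\sum_(j < D.+1) H j)%N%:R = hconv K D) -> multiplicity Q = e.
Proof.
move=> [d0 hQ] sQ [q [D0 [h1 h2 h3]]] hK.
have QE : Q = q.
  apply: (@poly_eventually_eq _ _ (maxn d0 D0)) => D; rewrite geq_max => /andP[/hQ <- /h3 <-].
  exact: hK.
by rewrite /multiplicity sQ lead_coefE sQ /= QE mulrC.
Qed.

End HilbertConvolution.

(** * Symmetric functions and the Hilbert series of the Eagon-Northcott complex *)

Section SymmetricSums.
Variables (F : comNzRingType) (A B : nat -> F) (N : nat).

Definition epol s : {poly F} := \prod_(j < s) (1 + A j *: 'X).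
(* The generating function of the complete symmetric sums, correct in degrees below [N]. *)
Definition hpol t : {poly F} := \prod_(i < t) \sum_(l < N) B i ^+ l *: 'X^l.

Lemma epolSS s m : (epol s.+1)`_m.+1 = (epol s)`_m.+1 + A s * (epol s)`_m.
Proof. by rewrite /epol big_ord_recr /= mulrDr mulr1 coefD -scalerAr coefZ coefMX. Qed.

Lemma epol0 s : (epol s)`_0 = 1.
Proof.
elim: s => [|s IH]; first by rewrite /epol big_ord0 coef1.
by rewrite /epol big_ord_recr /= mulrDr mulr1 coefD -scalerAr coefZ coefMX mulr0 addr0 IH.
Qed.

Lemma epol_big s m : (s < m)%N -> (epol s)`_m = 0.
Proof.
elim: s m => [|s IH] [|m] //; first by rewrite /epol big_ord0 coef1.
by rewrite ltnS => h; rewrite epolSS !IH ?mulr0 ?addr0 // ltnW.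
Qed.

Definition hprev t m : F := if m is m'.+1 then (hpol t)`_m' else 0.

(** The truncated geometric series times 1 - B_t X is 1 up to an error of order [N], invisible in
    degree m < N. *)
Lemma hpol_rec t m : (m < N)%N -> (hpol t.+1)`_m = (hpol t)`_m + B t * hprev t.+1 m.
Proof.
move=> hm; pose g : {poly F} := \sum_(l < N) B t ^+ l *: 'X^l.
have E : hpol t.+1 = hpol t + (B t *: 'X) * hpol t.+1 - hpol t * (B t *: 'X) ^+ N.
  have hg : g * (1 - B t *: 'X) = 1 - (B t *: 'X) ^+ N.
    have -> : g = \sum_(l < N) (B t *: 'X) ^+ l by apply: eq_bigr => l _; rewrite exprZn.
    by rewrite -[RHS]opprB subrX1 -mulNr opprB mulrC.
  have -> : hpol t.+1 = hpol t * g by rewrite /hpol big_ord_recr.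
  move: (hpol t) g (B t *: 'X) hg => p g' y hg.
  have -> : p + y * (p * g') - p * y ^+ N = p * (1 - y ^+ N) + y * (p * g') by ring.
  by rewrite -hg; ring.
rewrite {1}E coefB coefD -scalerAl coefZ mulrC coefXM exprZn -scalerAr coefZ coefMXn hm mulr0 subr0.
by rewrite [_ * B t]mulrC; congr (_ + B t * _); case: (m).
Qed.

Lemma hpol0 m : (hpol 0)`_m = (m == 0%N)%:R.
Proof. by rewrite /hpol big_ord0 coef1. Qed.

(** Place i + 1 of the complex contributes the elementary symmetric sum of degree t + i in the
    columns times the complete one of degree i in the rows; [(t + c).-1] is the number of
    columns. *)
Definition altsum t c : F := \sum_(i < c) (-1) ^+ i * ((epol (t + c).-1)`_(t + i) * (hpol t)`_i).

(** The last column A_(t+c) is split off from the elementary sums, then the row B_t from the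
    complete ones; the term asking for more columns than exist is zero. *)
Lemma altsum_rec t c : (c < N)%N -> altsum t.+1 c.+1 =
  A (t + c)%N * altsum t c.+1 + (1 - A (t + c)%N * B t) * altsum t.+1 c.
Proof.
move=> hc; rewrite /altsum !addSn /= addnS /=.
under eq_bigr do rewrite addSn epolSS mulrDl mulrDr.
rewrite big_split /=.
have -> : \sum_(i < c.+1) (-1) ^+ i * ((epol (t + c))`_(t + i).+1 * (hpol t.+1)`_i) =
          \sum_(i < c) (-1) ^+ i * ((epol (t + c))`_(t + i).+1 * (hpol t.+1)`_i).
  by rewrite big_ord_recr /= epol_big // mul0r mulr0 addr0.
have -> : \sum_(i < c.+1) (-1) ^+ i * (A (t + c)%N * (epol (t + c))`_(t + i) * (hpol t.+1)`_i) =
  A (t + c)%N * (\sum_(i < c.+1) (-1) ^+ i * ((epol (t + c))`_(t + i) * (hpol t)`_i)) +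
  A (t + c)%N * \sum_(i < c.+1) (-1) ^+ i * ((epol (t + c))`_(t + i) *
     (B t * hprev t.+1 i)).
  rewrite !mulr_sumr -big_split; apply: eq_bigr => i _ /=.
  rewrite hpol_rec; last by apply: leq_ltn_trans hc; rewrite -ltnS.
  by ring.
have -> : \sum_(i < c.+1) (-1) ^+ i * ((epol (t + c))`_(t + i) *
     (B t * hprev t.+1 i)) =
  - B t * \sum_(i < c) (-1) ^+ i * ((epol (t + c))`_(t + i).+1 * (hpol t.+1)`_i).
  rewrite big_ord_recl /= !mulr0 add0r mulr_sumr; apply: eq_bigr => i _.
  by rewrite /bump /= add1n exprS addnS; ring.
under [X in _ = _ + _ * X]eq_bigr do rewrite addSn.
by ring.
Qed.

(** With A_j = z^(a_j) and B_i = z^(-b_i), the numerator of the Hilbert series read off the complex;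
    the 1 is place 0. *)
Definition ennum t c : F := 1 - \prod_(i < t) B i * altsum t c.

Lemma ennumSS t c : (c < N)%N -> ennum t.+1 c.+1 =
  A (t + c)%N * B t * ennum t c.+1 + (1 - A (t + c)%N * B t) * ennum t.+1 c.
Proof. by move=> hc; rewrite /ennum altsum_rec // !big_ord_recr /=; ring. Qed.

Lemma ennum0S c : ennum 0 c.+1 = 0.
Proof.
rewrite /ennum big_ord0 mul1r /altsum big_ord_recl big1 => [|i _].
  by rewrite expr0 epol0 hpol0 !mul1r addr0 subrr.
by rewrite hpol0 !mulr0.
Qed.

Lemma ennumn0 t : ennum t 0 = 1.
Proof. by rewrite /ennum /altsum big_ord0 mulr0 subr0. Qed.

Lemma epol_coef s m : (epol s)`_m = \sum_(S : {set 'I_s} | #|S| == m) \prod_(j in S) A j.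
Proof.
rewrite /epol; under eq_bigr do rewrite addrC.
rewrite bigA_distr coef_sum [RHS]big_mkcond /=; apply: eq_bigr => S _.
have -> : \prod_(i < s) (if i \in S then A i *: 'X else 1) = (\prod_(j in S) A j) *: 'X^#|S| :> {poly F}.
  rewrite -big_mkcond /= -sum1_card.
  elim/big_rec3: _ => [|i x y z hi ->]; first by rewrite expr0 scale1r.
  by rewrite add1n exprS -scalerAl -scalerAr scalerA.
by rewrite coefZ coefXn eq_sym; case: eqP => _; rewrite ?mulr1 ?mulr0.
Qed.

Lemma hpol_coef t m : (m < N)%N ->
  (hpol t)`_m = \sum_(mu : 'X_{1..t < N} | mdeg mu == m) \prod_(i < t) B i ^+ mu i.
Proof.
move=> hm; rewrite /hpol bigA_distr_bigA /= coef_sum.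
have cE (f : {ffun 'I_t -> 'I_N}) : (\prod_(i < t) (B i ^+ f i *: 'X^(f i)) : {poly F})`_m =
   if (\sum_i f i == m)%N then \prod_(i < t) B i ^+ f i else 0.
  have -> : \prod_(i < t) (B i ^+ f i *: 'X^(f i)) =
     (\prod_(i < t) B i ^+ f i) *: 'X^(\sum_i f i) :> {poly F}.
    elim/big_rec3: _ => [|i x y z hi ->]; first by rewrite expr0 scale1r.
    by rewrite exprD -scalerAl -scalerAr scalerA.
  by rewrite coefZ coefXn eq_sym; case: eqP => _; rewrite ?mulr1 ?mulr0.
rewrite (eq_bigr _ (fun f _ => cE f)).
rewrite -big_mkcond /=.
have N0 : (0 < N)%N by apply: leq_ltn_trans hm.
pose up (mu : 'X_{1..t < N}) : {ffun 'I_t -> 'I_N} := [ffun i => insubd (Ordinal N0) (mu i)].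
have mlt (mu : 'X_{1..t}) (i : 'I_t) : (mu i <= mdeg mu)%N by rewrite mdegE (bigD1 i) //= leq_addr.
have upE (mu : 'X_{1..t < N}) i : up mu i = mu i :> nat.
  rewrite ffunE val_insubd (leq_ltn_trans (mlt mu i)) //; exact: bmdeg.
have hz0 : (mdeg (0%MM : 'X_{1..t}) < N)%N by rewrite mdeg0.
pose down (f : {ffun 'I_t -> 'I_N}) : 'X_{1..t < N} :=
  insubd (BMultinom hz0) [multinom (f i : nat) | i < t].
have dE (f : {ffun 'I_t -> 'I_N}) : mdeg [multinom (f i : nat) | i < t] = (\sum_i f i)%N.
  by rewrite mdegE; apply: eq_bigr => i _; rewrite mnmE.
rewrite (reindex_onto up down) /=; last first.
  move=> f /eqP hf; apply/ffunP => i; apply: val_inj; rewrite /= upE.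
  by rewrite val_insubd dE hf hm mnmE.
apply: eq_big => [mu|mu _]; last by apply: eq_bigr => i _; rewrite upE.
have e : (\sum_i up mu i = mdeg mu)%N by rewrite mdegE; apply: eq_bigr => i _; rewrite upE.
rewrite e; case: eqVneq => //= _; apply/eqP/val_inj; rewrite val_insubd dE e bmdeg.
by apply/mnmP => i; rewrite mnmE upE.
Qed.

End SymmetricSums.

Section ENNumerator.
Variables (t s : nat) (a b : nat -> int).

(** The degree of the generator with columns [S] and divided-power monomial [mu]: every row counts
    once from the minors and [mu i] more times. *)
Definition enshift (S : {set 'I_s}) (mu : 'X_{1..t}) : int :=
  \sum_(j in S) a j - \sum_(i < t) b i - \sum_(i < t) (mu i)%:Z * b i.

Local Notation F := {fraction {poly int}}.
Let z : F := tofrac 'X.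

Lemma z_neq0 : z != 0.
Proof. by rewrite tofrac_eq0 polyX_eq0. Qed.

Let Az (j : nat) : F := z ^ (a j).
Let Bz (i : nat) : F := z ^ (- b i).

Lemma expz_sum (T : Type) (r : seq T) (P : pred T) (f : T -> int) :
  z ^ (\sum_(x <- r | P x) f x) = \prod_(x <- r | P x) z ^ f x.
Proof. by apply: (big_morph (fun u => z ^ u)) => // x y; rewrite expfzDr ?z_neq0. Qed.

Lemma enshift_sum i : (i <= s)%N ->
  \sum_(x : 'I_(#|@enb t s i|)) z ^ enshift (enS x) (enM x) =
  \prod_(l < t) Bz l * ((epol Az s)`_(t + i) * (hpol Bz s.+1 t)`_i).
Proof.
move=> hi; rewrite epol_coef hpol_coef // big_distrlr /= mulr_sumr.
rewrite -(big_enum_val (fun x : enT t s => z ^ enshift x.1 x.2)).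
under [RHS]eq_bigr do rewrite mulr_sumr.
rewrite [RHS]pair_big_dep; apply: eq_big => [x|x _]; first by [].
rewrite /enshift /= !expfzDr ?z_neq0 // -!sumrN !expz_sum [RHS]mulrA; congr (_ * _).
  by rewrite mulrC.
by apply: eq_bigr => l _; rewrite /Bz mulrC -mulNr -exprz_exp.
Qed.

(** Both sides satisfy the same recursion. The comparison is made in the fraction field, where a_j
    and -b_i may have any sign; nonnegative differences identify the absolute values in [detnum]
    with true exponents. *)
Lemma detnum_ennum N u c : (c <= N)%N ->
  (forall i l, (i < u)%N -> (l < c)%N -> b i <= a (i + l)%N) ->
  tofrac (detnum a b u c) = ennum Az Bz N u c.
Proof.
elim: u c => [|u IHu] c hc hab.
  by case: c hc hab => [|c] hc hab; rewrite ?detnumn0 ?ennumn0 ?detnum0S ?ennum0S ?rmorph0 ?rmorph1.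
elim: c hc hab => [|c IHc] hc hab; first by rewrite detnumn0 ennumn0 rmorph1.
rewrite detnumSS ennumSS // rmorphD !rmorphM rmorphB rmorph1 rmorphXn /=.
have hf : b u <= a (u + c)%N by apply: hab.
have -> : tofrac 'X ^+ `|a (u + c)%N - b u|%N = Az (u + c)%N * Bz u.
  by rewrite /Az /Bz -expfzDr ?z_neq0 // -[RHS](_ : z ^ (`|a (u + c)%N - b u|%N : int) = _) // gez0_abs // subr_ge0.
rewrite IHu ?IHc // => [|i l hi hl|i l hi hl]; [lia|apply: hab => //; lia|apply: hab => //; lia].
Qed.

Lemma en_numerator c (d : forall i, 'I_(enrk t s i) -> nat) : s = (t + c).-1 -> (c <= s.+1)%N ->
  (forall x, d 0%N x = 0%N) ->
  (forall i (x : 'I_(enrk t s i.+1)), (d i.+1 x)%:Z = enshift (enS x) (enM x)) ->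
  (forall i l, (i < t)%N -> (l < c)%N -> b i <= a (i + l)%N) ->
  \sum_(i < c.+1) (-1) ^+ i * \sum_(x : 'I_(enrk t s i)) 'X^(d i x) = detnum a b t c.
Proof.
move=> hs hc d0 dS hab; apply/eqP; rewrite -tofrac_eq (detnum_ennum hc hab); apply/eqP.
have -> : \sum_(i < c.+1) (-1) ^+ i * \sum_(x : 'I_(enrk t s i)) 'X^(d i x) =
    1 + \sum_(i < c) (-1) ^+ i.+1 * \sum_(x : 'I_(enrk t s i.+1)) 'X^(d i.+1 x) :> {poly int}.
  rewrite big_ord_recl; congr (_ + _).
  by rewrite mul1r (big_ord1 _ (fun x => 'X^(d 0%N x))) d0.
rewrite rmorphD rmorph1 rmorph_sum /ennum; congr (_ + _).
rewrite /altsum -hs mulr_sumr -sumrN; apply: eq_bigr => i _.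
rewrite rmorphM rmorphXn rmorphN rmorph1 exprS mulN1r mulNr.
congr (- _); rewrite [RHS]mulrCA; congr (_ * _); rewrite -enshift_sum; last by have := ltn_ord i; lia.
by rewrite rmorph_sum; apply: eq_bigr => x _ /=; rewrite rmorphXn /= -dS.
Qed.

End ENNumerator.

(** * The graded Eagon-Northcott resolution *)

Lemma mcoeff_neq0D (k : fieldType) n (p q : {mpoly k[n]}) mm :
  (p + q)@_mm != 0 -> p@_mm != 0 \/ q@_mm != 0.
Proof.
rewrite mcoeffD; case: (eqVneq p@_mm 0) => [->|]; last by left.
by rewrite add0r; right.
Qed.

Lemma mcoeff_neq0M (k : fieldType) n (p q : {mpoly k[n]}) mm : (p * q)@_mm != 0 ->
  exists m1 m2, [/\ mm = (m1 + m2)%MM, p@_m1 != 0 & q@_m2 != 0].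
Proof.
rewrite -mcoeff_msupp => /msuppM_le /allpairsP[[m1 m2] /= [h1 h2 ->]].
by exists m1, m2; rewrite -!mcoeff_msupp.
Qed.

Lemma mcoeff_neq0_sum (k : fieldType) n (T : Type) (r : seq T) (P : pred T) (F : T -> {mpoly k[n]}) mm :
  (\sum_(x <- r | P x) F x)@_mm != 0 -> exists2 x, P x & (F x)@_mm != 0.
Proof.
elim: r => [|x r IH]; first by rewrite big_nil mcoeff0 eqxx.
rewrite big_cons; case: ifP => hP //.
by case/mcoeff_neq0D => [h|/IH //]; exists x.
Qed.

Section ENGraded.
Variables (k : fieldType) (n t s : nat) (A : 'M[{mpoly k[n]}]_(t, s)) (a b : nat -> int).
Local Notation R := {mpoly k[n]}.
Local Notation V := {ffun {set 'I_s} -> R^o}.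
Hypothesis Adeg : forall i j mm, (A i j)@_mm != 0 -> (mdeg mm)%:Z = a j - b i.
Hypothesis Amin : forall i j, (A i j)@_0%MM = 0.
Hypothesis t_gt0 : (0 < t)%N.

(** Homogeneity of a form when e_j has degree a_j; contraction by row p then lowers the degree by
    [b p]. *)
Definition ehomog (tau : int) (x : V) : Prop :=
  forall (S : {set 'I_s}) mm, (x S : R)@_mm != 0 -> (mdeg mm)%:Z + \sum_(j in S) a j = tau.

Lemma ehomog_kap (p : 'I_t) tau x : ehomog tau x -> ehomog (tau - b p) (kap (A p) x).
Proof.
move=> hx S mm; rewrite /kap sum_ffunE => /mcoeff_neq0_sum[j _].
rewrite !ffunE; case: (boolP (j \in S)) => hj; first by rewrite scaler0 mcoeff0 eqxx.
move=> /mcoeff_neq0M[m1 [m2 [-> /Adeg h1]]].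
case/mcoeff_neq0M => m3 [m4 [-> h3 /hx]]; rewrite big_setU1 //= => h4.
have h3' : mdeg m3 = 0%N.
  move: h3; rewrite /esgn -[(-1 : R)](mpolyCN n 1) -rmorphXn mcoeffC.
  by case: (eqVneq m3 0%MM) => [->|]; rewrite ?mdeg0 // mulr0 eqxx.
by rewrite !mdegD h3' add0n PoszD h1 -h4; ring.
Qed.

Lemma ehomog_kaps (l : seq 'I_t) tau x :
  ehomog tau x -> ehomog (tau - \sum_(p <- l) b p) (kaps [seq A p | p <- l] x).
Proof.
elim: l tau x => [|p l IH] tau x hx; first by rewrite big_nil subr0.
by rewrite map_cons kaps_cons big_cons opprD addrA; apply: IH; apply: ehomog_kap.
Qed.

Lemma ehomog_delta (S : {set 'I_s}) : ehomog (\sum_(j in S) a j) (edelta R S).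
Proof.
move=> S' mm; rewrite ffunE; case: (eqVneq S S') => [<-|_]; last by rewrite mcoeff0 eqxx.
by rewrite mcoeff1; case: (eqVneq mm 0%MM) => [->|_]; rewrite ?eqxx // mdeg0 add0r.
Qed.

Definition ensh i : 'I_(enrk t s i) -> int :=
  match i return 'I_(enrk t s i) -> int with
  | 0 => fun _ => 0
  | i'.+1 => fun x => enshift a b (enS x) (enM x)
  end.

Lemma enmx_deg i x y mm : (enmx A i x y)@_mm != 0 -> (mdeg mm)%:Z + ensh x = ensh (i := i.+1) y.
Proof.
case: i x y => [|i] x y.
  rewrite mxE => /(ehomog_kaps (l := enum 'I_t) (@ehomog_delta (enS y))).
  rewrite big_set0 addr0 big_enum /= /enshift => ->.
  rewrite -[LHS]subr0; congr (_ - _).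
  have /eqP := enM_deg y; rewrite mdeg_eq0 => /eqP ->.
  by rewrite big1 // => i _; rewrite mnm0E mul0r.
rewrite mxE /edif sum_ffunE => /mcoeff_neq0_sum[p _].
rewrite /ebase; case: (eqVneq (enM y) (enM x + U_(p))%MM) => [e|_]; last by rewrite scale0r linear0 ffunE mcoeff0 eqxx.
rewrite scale1r => /(@ehomog_kap p _ _ (@ehomog_delta (enS y))) h.
rewrite /ensh /enshift e.
have -> : \sum_(i0 < t) ((enM x + U_(p))%MM i0)%:Z * b i0 = \sum_(i0 < t) (enM x i0)%:Z * b i0 + b p.
  under eq_bigr do rewrite mnmDE PoszD mulrDl.
  rewrite big_split /=; congr (_ + _); rewrite (bigD1 p) //= mnm1E eqxx mul1r big1 ?addr0 // => q qp.
  by rewrite mnm1E eq_sym (negPf qp) mul0r.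
by move: h; lia.
Qed.

Lemma const0_ideal : is_ideal (fun p : R => p@_0%MM = 0).
Proof.
split=> [|x y hx hy|r x hx]; first exact: mcoeff0.
  by rewrite mcoeffD hx hy addr0.
by rewrite mcoeff0_is_multiplicative hx mulr0.
Qed.

Lemma kap_const0 p x : inI (fun q : R => q@_0%MM = 0) (kap (A p) x).
Proof.
move=> S; rewrite /kap sum_ffunE; apply: (ideal_sum _ const0_ideal) => j _.
by rewrite ffunE [_ *: _]mulrC; apply: (idealM _ const0_ideal); rewrite Amin.
Qed.

Lemma enmx_min i x y : (enmx A i x y)@_0%MM = 0.
Proof.
case: i x y => [|i] x y; rewrite mxE.
  rewrite /rkaps; case E : (enum 'I_t) => [|p l].
    by exfalso; move: t_gt0; rewrite -(size_enum_ord t) E.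
  rewrite map_cons kaps_cons; apply: (inI_kaps const0_ideal); exact: kap_const0.
rewrite /edif sum_ffunE; apply: (ideal_sum _ const0_ideal) => p _; exact: kap_const0.
Qed.

Lemma enmx_mul_min i (w : 'cV[R]_(enrk t s i.+1)) x : ((enmx A i *m w) x 0)@_0%MM = 0.
Proof.
rewrite mxE raddf_sum; apply: big1 => y _.
by rewrite /= mcoeff0_is_multiplicative enmx_min mul0r.
Qed.

Lemma minors_proper : ~ minors_ideal A 1.
Proof.
move=> /enmx_image[v hv]; have : (1 : R)@_0%MM = 0 by rewrite -hv enmx_mul_min.
by rewrite mcoeff1 eqxx => /eqP; rewrite oner_eq0.
Qed.

Hypothesis en_acyclic : forall i (z : 'cV[R]_(enrk t s i.+1)), enmx A i *m z = 0 ->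
  exists w, z = enmx A i.+1 *m w.

(** Shifts of a resolution are natural numbers. By exactness and minimality no column of a
    differential is zero, and a nonzero entry makes the shift of its column at least that of its
    row. *)
Lemma ensh_ge0 i x : 0 <= ensh (i := i) x.
Proof.
elim: i x => [//|i IH] y.
have [x [mm h]] : exists x mm, (enmx A i x y)@_mm != 0.
  have hne : enmx A i *m delta_mx y (0 : 'I_1) != 0.
    apply/eqP => /en_acyclic[w /colP/(_ y)/(congr1 (mcoeff 0%MM))]; rewrite enmx_mul_min mxE !eqxx mcoeff1 eqxx.
    by move/eqP; rewrite oner_eq0.
  have /existsP[x hx] : [exists x, enmx A i x y != 0].
    apply: contra_neqT hne => /existsPn h; apply/colP => x; rewrite -colE !mxE.
    by apply/eqP; have := h x; rewrite negbK.
  by exists x, (mlead (enmx A i x y)); rewrite -mcoeff_msupp mlead_supp.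
by rewrite -(enmx_deg h) addr_ge0.
Qed.

Definition endeg i (x : 'I_(enrk t s i)) : nat := `|ensh x|%N.

Lemma endegE i x : (endeg (i := i) x)%:Z = ensh x.
Proof. by rewrite /endeg gez0_abs // ensh_ge0. Qed.

Lemma en_min_res : min_graded_free_res (minors_ideal A) endeg (enmx A).
Proof.
split=> //; split=> //; split=> [i x y|i x y|p|i v].
- have h mm : (enmx A i x y)@_mm != 0 -> (mdeg mm + endeg x = endeg (i := i.+1) y)%N.
    by move=> /enmx_deg; rewrite -!endegE => h; lia.
  split.
    by apply/dhomogP => mm; rewrite mcoeff_msupp => /h <-; rewrite addnK.
  by move=> /mlead_supp; rewrite mcoeff_msupp => /h <-; apply: leq_addl.
- exact: enmx_min.
- split=> [/enmx_image[v hv]|[v hv]]; last by apply/enmx_image; exists v; apply: hv.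
  by exists v => x; rewrite ord1.
- split=> [/en_acyclic //|[w ->]].
  by rewrite mulmxA enmx_complex mul0mx.
Qed.

End ENGraded.

Lemma hilbert_function_ext (k : fieldType) n (I I' : {mpoly k[n]} -> Prop) H :
  (forall p, I p <-> I' p) -> hilbert_function I H -> hilbert_function I' H.
Proof.
move=> e h d; have [[p [p1 p2]] hmax] := h d; split.
  by exists p; split=> // cf /e; apply: p2.
by move=> s q [q1 q2]; apply: hmax; split=> // cf /e; apply: q2.
Qed.

(** * Shifts and multiplicity through the Eagon-Northcott resolution *)

Section Core.
Variables (k : fieldType) (n c t : nat) (A : 'M[{mpoly k[n]}]_(t, t + c.-1)) (a b : nat -> int).
Local Notation R := {mpoly k[n]}.
Hypothesis Adeg : forall i j mm, (A i j)@_mm != 0 -> (mdeg mm)%:Z = a j - b i.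
Hypothesis Amin : forall i j, (A i j)@_0%MM = 0.
Hypotheses (t_gt0 : (0 < t)%N) (hc : (0 < c <= n)%N).
Variables (I : R -> Prop) (H : nat -> nat) (Q : {poly rat}).
Hypothesis hI : forall p, I p <-> minors_ideal A p.
Hypotheses (hH : hilbert_function I H) (hQ : hilbert_samuel_poly H Q) (sQ : size Q = (n - c).+1).

Lemma core_trdeg : trdeg_le (minors_ideal A) (n - c).
Proof.
have := trdeg_le_hilbert (minors_is_ideal A) (hilbert_function_ext hI hH) hQ.
by rewrite sQ.
Qed.

Lemma core_exact i (z : 'cV[R]_(enrk t (t + c.-1) i.+1)) : enmx A i *m z = 0 ->
  exists w, z = enmx A i.+1 *m w.
Proof.
case/andP: hc => c0 cn.
apply: (en_exact t_gt0 (minors_proper Amin t_gt0) cn core_trdeg); lia.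
Qed.

Let hen := en_min_res Adeg Amin t_gt0 core_exact.

Lemma core_shift (r : nat -> nat) (d : forall i, 'I_(r i) -> nat) (phi : forall i, 'M[R]_(r i, r i.+1)) :
  min_graded_free_res I d phi -> forall i (S : {set 'I_(t + c.-1)}) (mu : 'X_{1..t}),
  #|S| = (t + i)%N -> mdeg mu = i -> exists x, (@d i.+1 x)%:Z = enshift a b S mu.
Proof.
move=> hres i S mu hS hmu; have [y [<- <-]] := en_ex hS hmu.
have [x hx] := shifts_unique hI hres hen (i := i.+1) y.
by exists x; rewrite hx (endegE Adeg Amin t_gt0 core_exact).
Qed.

(** The listing of rows and columns is constrained only by nonnegative factors, so the formula
    serves both sorting orders. *)
Lemma core_multiplicity : (forall i l, (i < t)%N -> (l < c)%N -> b i <= a (i + l)%N) ->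
  multiplicity Q = (detdeg a b t c)%:~R.
Proof.
move=> hab; case/andP: hc => c0 cn.
apply: (multiplicity_hconv hQ sQ (detnum_eventually_poly cn hab)) => D.
have hs : (t + c.-1 = (t + c).-1)%N by lia.
have hc' : (c <= (t + c.-1).+1)%N by lia.
have hL i : (c < i)%N -> enrk t (t + c.-1) i = 0%N by case: i => // i hi; apply: enrk0; lia.
have d0 (x : 'I_(enrk t (t + c.-1) 0)) : endeg a b x = 0%N by [].
have dS i (x : 'I_(enrk t (t + c.-1) i.+1)) : (endeg a b x)%:Z = enshift a b (enS x) (enM x).
  by rewrite (endegE Adeg Amin t_gt0 core_exact).
rewrite -(en_numerator hs hc' d0 dS hab) hconv_sum.
have hh e := hilbert_res (minors_is_ideal A) hen e hL (hilbert_function_ext hI hH).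
have -> : (\sum_(j < D.+1) H j)%N%:R = (\sum_(e < D.+1) \sum_(i < c.+1)
    (-1) ^+ i * (gcount n (@endeg t (t + c.-1) a b i) e)%:Z)%:~R :> rat.
  rewrite -[LHS]/(((\sum_(j < D.+1) H j)%N%:Z)%:~R) (big_morph Posz PoszD (erefl 0%:Z)).
  by congr (_%:~R); apply: eq_bigr => e _; apply: hh.
rewrite exchange_big /=.
rewrite rmorph_sum; apply: eq_bigr => i _ /=.
have -> : (-1) ^+ i = ((-1) ^+ i)%:P :> {poly int} by rewrite rmorphXn rmorphN1.
rewrite hconvM -mulr_sumr intrM; congr (_ * _).
rewrite -(big_morph Posz PoszD (erefl 0%:Z)) sum_gcount hconv_sum.
have -> (m : nat) : (m%:Z)%:~R = m%:R :> rat by [].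
rewrite natr_sum; apply: eq_bigr => x _; rewrite hconvX.
by case: ifP.
Qed.

End Core.

(** * Reduction to a sorted minimal matrix *)

Section MinorsTransform.
Variable R : comNzRingType.

Lemma minors_mulmx t s (P : 'M[R]_t) (A : 'M[R]_(t, s)) p :
  minors_ideal (P *m A) p -> minors_ideal A p.
Proof.
move: p; apply: minors_sub => [|f]; first exact: minors_is_ideal.
have -> : colsub f (P *m A) = P *m colsub f A.
  by apply/matrixP => i j; rewrite !mxE; apply: eq_bigr => l _; rewrite mxE.
by rewrite det_mulmx; apply: idealM; [apply: minors_is_ideal|apply: minor_mem].
Qed.

Lemma minors_perm t s (ta : 'S_t) (f : 'I_s -> 'I_s) (A : 'M[R]_(t, s)) p :
  minors_ideal (mxsub ta f A) p -> minors_ideal A p.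
Proof.
move: p; apply: minors_sub => [|g]; first exact: minors_is_ideal.
have -> : colsub g (mxsub ta f A) = row_perm ta (colsub (f \o g) A).
  by apply/matrixP => i j; rewrite !mxE.
by rewrite row_permE det_mulmx; apply: idealM; [apply: minors_is_ideal|apply: minor_mem].
Qed.

Lemma minors_permP t s (ta : 'S_t) (si : 'S_s) (A : 'M[R]_(t, s)) p :
  minors_ideal (mxsub ta si A) p <-> minors_ideal A p.
Proof.
split; first exact: minors_perm.
have {1}-> : A = mxsub (ta^-1)%g (si^-1)%g (mxsub ta si A).
  by apply/matrixP => i j; rewrite !mxE !permKV.
exact: minors_perm.
Qed.

Lemma det_col0 t (M : 'M[R]_t) j : (forall i, M i j = 0) -> \det M = 0.
Proof. by move=> h; rewrite (expand_det_col _ j) big1 // => i _; rewrite h mul0r. Qed.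

(** Repeated Laplace expansion along the top row writes the determinant as a combination of minors
    of the last [p] rows. *)
Lemma det_rows_mem (J : R -> Prop) i p (M : 'M[R]_(i + p)) : is_ideal J ->
  (forall h : 'I_p -> 'I_(i + p), J (\det (mxsub (@rshift i p) h M))) -> J (\det M).
Proof.
move=> hJ; elim: i M => [|i IH] M hM.
  have := hM id; congr J; congr (\det _); apply/matrixP => x y; rewrite mxE.
  by congr (M _ _); apply: val_inj.
rewrite (expand_det_row M ord0); apply: ideal_sum => // l _; apply: idealM => //.
apply: idealM => //; apply: IH => h; have := hM (lift l \o h); congr J; congr (\det _).
by apply/matrixP => x y; rewrite !mxE; congr (M _ _); apply: val_inj.
Qed.

Lemma det_rows_mem_sub (J : R -> Prop) t i p (f : 'I_p -> 'I_t) (M : 'M[R]_t) : is_ideal J ->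
  t = (i + p)%N -> (forall x, f x = (i + x)%N :> nat) ->
  (forall h : 'I_p -> 'I_t, J (\det (mxsub f h M))) -> J (\det M).
Proof.
move=> hJ e; subst t => hf hM; apply: det_rows_mem => // h.
have := hM h; congr J; congr (\det _); apply/matrixP => x y; rewrite !mxE.
by congr (M _ _); apply: val_inj; rewrite /= hf.
Qed.

(** Row operations clear column j0 outside row i0. Expanding a minor along row i0 leaves minors of
    the other rows, zero if they use j0 and minors of the Schur complement otherwise. Conversely,
    bordering such a minor by row i0 and column j0 multiplies it by a unit. *)
Lemma minors_pivot t s (A : 'M[R]_(t.+1, s.+1)) i0 j0 (u v : R) : u * v = 1 -> A i0 j0 = u ->
  forall p, minors_ideal A p <->
    minors_ideal (\matrix_(i < t, j < s)
      (A (lift i0 i) (lift j0 j) - v * A (lift i0 i) j0 * A i0 (lift j0 j))) p.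
Proof.
move=> uv hu.
set A' := (\matrix_(i < t, j < s) _).
pose w i := if i == i0 then 0 else v * A i j0.
have mulE (e : R) (B : 'M[R]_(t.+1, s.+1)) i j :
    ((\matrix_(i, l) ((i == l)%:R + e * w i * (l == i0)%:R)) *m B) i j = B i j + e * w i * B i0 j.
  rewrite mxE; under eq_bigr do rewrite mxE mulrDl.
  rewrite big_split /=; congr (_ + _).
    rewrite (bigD1 i) //= eqxx mul1r big1 ?addr0 // => l li.
    by rewrite eq_sym (negPf li) mul0r.
  rewrite (bigD1 i0) //= eqxx mulr1 big1 ?addr0 // => l /negPf ->.
  by rewrite mulr0 mul0r.
pose A1 := (\matrix_(i, l) ((i == l)%:R + (-1) * w i * (l == i0)%:R)) *m A.
have A1E i j : A1 i j = A i j - w i * A i0 j by rewrite mulE mulN1r mulNr.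
have w0 : w i0 = 0 by rewrite /w eqxx.
have AE : A = (\matrix_(i, l) ((i == l)%:R + 1 * w i * (l == i0)%:R)) *m A1.
  apply/matrixP => i j; rewrite mulE !A1E w0; ring.
have A1A p : minors_ideal A p <-> minors_ideal A1 p.
  by split; [rewrite {1}AE|]; apply: minors_mulmx.
clearbody A1.
have A1col i : A1 (lift i0 i) j0 = 0.
  rewrite A1E /w eq_sym (negPf (neq_lift i0 i)) hu.
  by rewrite -[X in X - _]mul1r -uv; ring.
have A1sub : row' i0 (col' j0 A1) = A'.
  by apply/matrixP => i j; rewrite !mxE A1E /w eq_sym (negPf (neq_lift i0 i)).
move=> p; rewrite A1A; split; move: p; apply: minors_sub; try exact: minors_is_ideal.
  move=> f; rewrite (expand_det_row _ i0); apply: ideal_sum => [|l _]; first exact: minors_is_ideal.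
  apply: idealM; first exact: minors_is_ideal.
  apply: idealM; first exact: minors_is_ideal.
  have [/existsP[y /eqP hy]|/existsPn hn] := boolP [exists y, f (lift l y) == j0].
    rewrite (det_col0 (j := y)) => [|x]; first exact: ideal0 (minors_is_ideal _).
    by rewrite !mxE hy; apply: A1col.
  have [g hg] : exists g : 'I_t -> 'I_s, forall y, f (lift l y) = lift j0 (g y).
    have h y : exists z, f (lift l y) = lift j0 z.
      by case: (unliftP j0 (f (lift l y))) (hn y) => [z|] ->; [exists z|rewrite eqxx].
    exact: fin_all_exists h.
  have := minor_mem A' g; congr minors_ideal; congr (\det _).
  by rewrite -A1sub; apply/matrixP => x y; rewrite !mxE hg.
move=> g.
pose f (l : 'I_t.+1) := if unlift ord0 l is Some y then lift j0 (g y) else j0.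
have : \det (colsub f A1) = u * ((-1) ^+ (i0 + 0) * \det (colsub g A')).
  rewrite (expand_det_col _ ord0) (bigD1 i0) //= big1 ?addr0 => [|i].
    rewrite mxE /f unlift_none A1E w0 mul0r subr0 hu; congr (_ * (_ * \det _)).
    by rewrite -A1sub; apply/matrixP => x y; rewrite !mxE /f liftK.
  case: (unliftP i0 i) => [x|] ->; last by rewrite eqxx.
  by rewrite mxE /f unlift_none A1col mul0r.
move=> e; have -> : \det (colsub g A') = v * (-1) ^+ (i0 + 0) * \det (colsub f A1).
  rewrite e mulrACA [v * u]mulrC uv mul1r mulrA -expr2 sqrr_sign mul1r //.
by apply: idealM; [apply: minors_is_ideal|apply: minor_mem].
Qed.

End MinorsTransform.

Section Reduction.
Variables (k : fieldType) (n : nat).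
Local Notation R := {mpoly k[n]}.

Definition mxdeg t s (A : 'M[R]_(t, s)) (a : 'I_s -> int) (b : 'I_t -> int) : Prop :=
  forall i j mm, (A i j)@_mm != 0 -> (mdeg mm)%:Z = a j - b i.

Lemma homogeneous_mxdeg t s (A : 'M[R]_(t, s)) : is_homogeneous_matrix A ->
  exists a b, mxdeg A a b.
Proof.
move=> [a [b h]]; exists a, b => i j mm hm.
have h0 : A i j != 0 by apply: contraNneq hm => ->; rewrite mcoeff0.
have [e [<- /dhomogP he]] := h i j h0.
by rewrite (he mm) // mcoeff_msupp.
Qed.

(** An entry with nonzero constant term has degree 0 and is a unit; eliminating it removes one row
    and one column, so [e] is preserved. The process stops before the rows run out, as the empty
    determinant is 1. *)
Lemma minimal_reduction e t (A : 'M[R]_(t, t + e)) a b : mxdeg A a b -> ~ minors_ideal A 1 ->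
  exists t' (A' : 'M[R]_(t', t' + e)) a' b',
    [/\ (0 < t')%N, mxdeg A' a' b', forall i j, (A' i j)@_0%MM = 0 &
        forall p, minors_ideal A p <-> minors_ideal A' p].
Proof.
elim: t A a b => [|t IH] A a b hA h1.
  have f : 'I_0 -> 'I_(0 + e) by case.
  by case: h1; have := minor_mem A f; rewrite det_mx00.
have [/existsP[i0 /existsP[j0 h0]]|hmin] := boolP [exists i, exists j, (A i j)@_0%MM != 0]; last first.
  exists t.+1, A, a, b; split=> // i j; apply/eqP; rewrite -[_ == _]negbK.
  by apply: contra hmin => h; apply/existsP; exists i; apply/existsP; exists j.
have e0 : a j0 = b i0 by have := hA _ _ _ h0; rewrite mdeg0; lia.
set u := (A i0 j0)@_0%MM in h0.
have hu : A i0 j0 = u%:MP.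
  apply/mpolyP => mm; rewrite mcoeffC; case: (eqVneq mm 0%MM) => [->|mm0]; first by rewrite mulr1.
  rewrite mulr0; apply/eqP; apply: contraNT mm0 => /hA; rewrite e0 subrr => /eqP.
  by rewrite eqz_nat mdeg_eq0.
have uv : u%:MP * (u^-1)%:MP = 1 :> R by rewrite -mpolyCM mulfV.
have hp := minors_pivot uv hu.
set A' := (\matrix_(i, j) _) in hp.
have [||t' [A2 [a2 [b2 [q1 q2 q3 q4]]]]] := IH A' (a \o lift j0) (b \o lift i0).
- move=> i j mm; rewrite mxE => /mcoeff_neq0D[/hA //|].
  rewrite mcoeffN oppr_eq0 -mulrA mcoeffCM mulf_eq0 negb_or => /andP[_].
  case/mcoeff_neq0M => m1 [m2 [-> /hA h2 /hA h3]]; rewrite mdegD PoszD h2 h3 e0 /=; ring.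
- by move/hp.
by exists t', A2, a2, b2; split=> // p; rewrite hp.
Qed.

Lemma sort_perm m (f : 'I_m -> int) : (0 < m)%N ->
  exists (si : 'S_m) (g : nat -> int), {homo g : i j / (i <= j)%N >-> i <= j} /\
    forall i, f (si i) = g i.
Proof.
move=> m0; pose l := [tuple f i | i < m].
have /tuple_permP[si hsi] : perm_eq (sort_tuple <=%O l) l by rewrite /= perm_sort.
(* Constant continuation beyond index m - 1 keeps the sequence monotone on all natural numbers. *)
exists si, (fun i => nth 0 (sort <=%O l) (minn i m.-1)).
have sl : size (sort <=%O l) = m by rewrite size_sort size_tuple.
split=> [i j ij|i].
  apply: (sorted_leq_nth le_trans le_refl) => //; rewrite ?inE ?sl; try lia.
  by apply: sort_le_sorted.
have -> : minn i m.-1 = i by have := ltn_ord i; lia.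
have -> : nth 0 (sort <=%O l) i = tnth (sort_tuple <=%O l) i by rewrite (tnth_nth 0).
have -> : tnth (sort_tuple <=%O l) i = nth 0 [tuple tnth l (si i) | i < m] i.
  by rewrite -hsi (tnth_nth 0).
by rewrite -tnth_nth !tnth_mktuple.
Qed.

Lemma trdeg_le_sub (I I' : R -> Prop) m : (forall p, I p -> I' p) -> trdeg_le I m -> trdeg_le I' m.
Proof. by move=> h hI m' y hy; apply: (hI _ y) => P /h; apply: hy. Qed.

(* If the [i]-th diagonal degree were not positive, the rows from [i] on would
   vanish on the first [i+1] columns, and the minors would lie in the ideal of
   minors of a block too small for codimension [c]. *)
Lemma diag_degree_gt0 c t (A : 'M[R]_(t, t + c.-1)) (a b : nat -> int) :
  mxdeg A (fun j => a j) (fun i => b i) -> (forall i j, (A i j)@_0%MM = 0) ->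
  {homo a : i j / (i <= j)%N >-> i <= j} -> {homo b : i j / (i <= j)%N >-> i <= j} ->
  (0 < c <= n)%N -> trdeg_le (minors_ideal A) (n - c) ->
  forall i, (i < t)%N -> b i < a i.
Proof.
move=> hA hmin ma mb hc hdim i it; rewrite ltNge; apply/negP => hab.
pose p := (t - i)%N; pose q := (t + c.-1 - i.+1)%N.
have hf (x : 'I_p) : (i + x < t)%N by have := ltn_ord x; rewrite /p; lia.
have hg (y : 'I_q) : (i.+1 + y < t + c.-1)%N by have := ltn_ord y; rewrite /q; lia.
pose f x := Ordinal (hf x); pose g y := Ordinal (hg y).
pose B := mxsub f g A.
have p0 : (0 < p)%N by rewrite /p; lia.
have Bmin x y : (B x y)@_0%MM = 0 by rewrite mxE.
have sub P : minors_ideal A P -> minors_ideal B P.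
  move: P; apply: minors_sub; first exact: minors_is_ideal.
  move=> ph; apply: (det_rows_mem_sub (f := f) (minors_is_ideal B) (i := i)) => //.
    by rewrite /p; lia.
  (* A chosen column of index at most i is zero in these rows, since a nonzero entry would have
     degree at most 0 and so a constant term. Otherwise all chosen columns belong to the block
     [B]. *)
  move=> h; have [/existsP[y hy]|/existsPn hn] := boolP [exists y, (ph (h y) <= i)%N].
    rewrite (det_col0 (j := y)) => [|x]; first exact: ideal0 (minors_is_ideal _).
    rewrite !mxE; apply/eqP; apply: contraT => nz.
    have := mlead_supp nz; rewrite mcoeff_msupp => hm.
    have hd := hA _ _ _ hm.
    have : (mdeg (mlead (A (f x) (ph (h y)))))%:Z <= 0.
      rewrite hd subr_le0; apply: le_trans (ma _ _ hy) (le_trans hab (mb _ _ _)).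
      by rewrite leq_addr.
    rewrite lez_nat leqn0 mdeg_eq0 => /eqP e.
    by move: hm; rewrite e hmin eqxx.
  have hh y : (ph (h y) - i.+1 < q)%N.
    by have := hn y; rewrite -ltnNge; have := ltn_ord (ph (h y)); rewrite /q; lia.
  have := minor_mem B (fun y => Ordinal (hh y)); congr minors_ideal; congr (\det _).
  apply/matrixP => x y; rewrite !mxE; congr (A _ _); apply: val_inj => /=.
  by have := hn y; rewrite -ltnNge; lia.
(* Here q + 1 - p = c - 1, so [B] is too small for codimension c. *)
have := codim_minors_le p0 (minors_proper Bmin p0) hc (trdeg_le_sub sub hdim).
by rewrite /p /q; case/andP: hc; lia.
Qed.

End Reduction.

Lemma extshift_enshift (a b : nat -> int) t s l : (0 < t)%N -> (t + l <= s)%N ->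
  exists (S : {set 'I_s}) (mu : 'X_{1..t}),
    [/\ #|S| = (t + l)%N, mdeg mu = l & enshift a b S mu = extshift a b t l.+1].
Proof.
move=> t0 hl.
have ht : (t.-1 < t)%N by rewrite prednK.
exists [set j : 'I_s | (j < t + l)%N], (U_(Ordinal ht) *+ l)%MM; split.
- rewrite -sum1_card (eq_bigl (fun j : 'I_s => (j < t + l)%N)); last by move=> j; rewrite inE.
  by rewrite -(big_ord_widen s (fun=> 1%N)) // sum1_card card_ord.
- by rewrite mdegMn mdeg1 mul1n.
rewrite /enshift /extshift addnS /=; congr (_ - _ - _).
  rewrite (eq_bigl (fun j : 'I_s => (j < t + l)%N)); last by move=> j; rewrite inE.
  by rewrite -(big_ord_widen s a).
rewrite (bigD1 (Ordinal ht)) //= mulmnE mnm1E eqxx mul1n big1 ?addr0 => [|i hi].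
  by rewrite natz.
by rewrite mulmnE mnm1E eq_sym (negPf hi) mul0n mul0r.
Qed.

Lemma bigmin_leq r (F : 'I_r -> nat) x0 y : (\big[minn/x0]_(x < r) F x <= F y)%N.
Proof.
have : y \in index_enum 'I_r by rewrite mem_index_enum.
elim: (index_enum _) => // x l IH; rewrite inE big_cons => /predU1P[->|/IH h].
  exact: geq_minl.
exact: leq_trans (geq_minr _ _) h.
Qed.

Section ShiftBounds.
Variables (k : fieldType) (n c t : nat) (A : 'M[{mpoly k[n]}]_(t, t + c.-1)) (a b : nat -> int).
Local Notation R := {mpoly k[n]}.
Hypothesis Adeg : mxdeg A (fun j => a j) (fun i => b i).
Hypothesis Amin : forall i j, (A i j)@_0%MM = 0.
Hypotheses (t_gt0 : (0 < t)%N) (hc : (0 < c <= n)%N).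
Variables (I : R -> Prop) (H : nat -> nat) (Q : {poly rat}).
Hypothesis hI : forall p, I p <-> minors_ideal A p.
Hypotheses (hH : hilbert_function I H) (hQ : hilbert_samuel_poly H Q) (sQ : size Q = (n - c).+1).
Variables (r : nat -> nat) (d : forall i, 'I_(r i) -> nat) (phi : forall i, 'M[R]_(r i, r i.+1)).
Hypothesis hres : min_graded_free_res I d phi.

(** In any listing [extshift] is the degree of a generator, so it lies between the extreme shifts.
    The lower bound uses this for increasing degrees, the upper bound for decreasing ones. *)
Lemma extshift_bounds l : (l < c)%N ->
  (minshift d l.+1)%:Z <= extshift a b t l.+1 <= (maxshift d l.+1)%:Z.
Proof.
move=> hl; have [|S [mu [hS hmu <-]]] := @extshift_enshift a b t (t + c.-1) l t_gt0; first by lia.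
have [x <-] := core_shift Adeg Amin t_gt0 hc hI hH hQ sQ hres hS hmu.
by rewrite !lez_nat bigmin_leq; apply: (leq_bigmax x).
Qed.

End ShiftBounds.

Lemma minors_ideal_bounds (k : fieldType) (n c t : nat) (A : 'M[{mpoly k[n]}]_(t, t + c.-1))
    (a b : nat -> int) (I : {mpoly k[n]} -> Prop) (H : nat -> nat) (Q : {poly rat})
    (r : nat -> nat) (d : forall i, 'I_(r i) -> nat) (phi : forall i, 'M[{mpoly k[n]}]_(r i, r i.+1)) :
  mxdeg A (fun j => a j) (fun i => b i) -> (forall i j, (A i j)@_0%MM = 0) ->
  {homo a : i j / (i <= j)%N >-> i <= j} -> {homo b : i j / (i <= j)%N >-> i <= j} ->
  (0 < t)%N -> (0 < c <= n)%N -> (forall p, I p <-> minors_ideal A p) ->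
  hilbert_function I H -> hilbert_samuel_poly H Q -> size Q = (n - c).+1 ->
  min_graded_free_res I d phi ->
  (\prod_(i < c) (minshift d i.+1)%:R) / (c`!)%:R <= multiplicity Q <=
  (\prod_(i < c) (maxshift d i.+1)%:R) / (c`!)%:R.
Proof.
move=> hA hmin ma mb t0 hc hI hH hQ sQ hres.
have hdiag := diag_degree_gt0 hA hmin ma mb hc (core_trdeg hI hH hQ sQ).
have hab i l : (i < t)%N -> (l < c)%N -> b i <= a (i + l)%N.
  by move=> /hdiag/ltW h _; apply: le_trans h (ma _ _ _); apply: leq_addr.
have bnd := extshift_bounds hA hmin t0 hc hI hH hQ sQ hres.
have prodZ (F : nat -> nat) : \prod_(i < c) (F i)%:R = (\prod_(i < c) (F i)%:Z)%:~R :> rat.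
  by rewrite rmorph_prod.
have factZ : (c`!)%:R = (c`!%:R : int)%:~R :> rat by rewrite rmorph_nat.
have f0 : (0 : rat) < (c`!)%:R by rewrite ltr0n fact_gt0.
apply/andP; split.
  rewrite ler_pdivrMr // (core_multiplicity hA hmin t0 hc hI hH hQ sQ hab) mulrC.
  rewrite (prodZ (fun i => minshift d i.+1)) factZ -intrM ler_int.
  have hm : \prod_(i < c) (minshift d i.+1)%:Z <= \prod_(i < c) extshift a b t i.+1.
    by apply: ler_prod => i _; have /andP[-> _] := bnd i (ltn_ord i).
  apply: le_trans hm (fact_detdeg_lower ma mb (fun i hi => ltW (hdiag i hi)) _).
  by move=> l hl; have /andP[h _] := bnd l hl; apply: le_trans h.
(* Listing rows and columns in decreasing order of degree gives the upper bound. *)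
pose s1 := (t + c.-1).-1.
pose aD j := a (s1 - j)%N; pose bD i := b (t.-1 - i)%N.
pose ta := perm (@rev_ord_inj t); pose si := perm (@rev_ord_inj (t + c.-1)).
pose A' := mxsub ta si A.
have hA' : mxdeg A' (fun j => aD j) (fun i => bD i).
  move=> i j mm; rewrite mxE !permE => /hA ->; rewrite /aD /bD /s1 /=.
  by congr (a _ - b _); have := ltn_ord i; have := ltn_ord j; lia.
have hmin' i j : (A' i j)@_0%MM = 0 by rewrite mxE.
have hI' p : I p <-> minors_ideal A' p := iff_trans (hI p) (iff_sym (minors_permP ta si A p)).
have bnd' := extshift_bounds hA' hmin' t0 hc hI' hH hQ sQ hres.
have maD : {homo aD : i j / (i <= j)%N >-> j <= i} by move=> i j ij; apply: ma; lia.
have mbD : {homo bD : i j / (i <= j)%N >-> j <= i} by move=> i j ij; apply: mb; lia.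
case/andP: (hc) => c0 _.
have habD i l : (i < t)%N -> (l < c)%N -> bD i <= aD (i + l)%N.
  move=> hi hl; apply: le_trans (_ : a (t.-1 - i)%N <= _).
    by apply: ltW; apply: hdiag; lia.
  by apply: ma; rewrite /s1; lia.
rewrite ler_pdivlMr // (core_multiplicity hA' hmin' t0 hc hI' hH hQ sQ habD) mulrC.
rewrite (prodZ (fun i => maxshift d i.+1)) factZ -intrM ler_int.
have e0 l : (l < c)%N -> 0 <= extshift aD bD t l.+1.
  by move=> hl; have /andP[h _] := bnd' l hl; apply: le_trans h.
apply: le_trans (fact_detdeg_upper maD mbD _ e0) _.
  by move=> i hi; apply: habD => //; lia.
by apply: ler_prod => i _; rewrite e0 //=; have /andP[_ ->] := bnd' i (ltn_ord i).
Qed.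

Theorem theorem3p1 (k : fieldType) (n c t : nat) (hc : (1 <= c)%N) (ht : (1 <= t)%N)
    (A : 'M[{mpoly k[n]}]_(t, t + c.-1)) (hA : is_homogeneous_matrix A)
    (H : nat -> nat) (hH : hilbert_function (maxminor_ideal A) H)
    (Q : {poly rat}) (hQ : hilbert_samuel_poly H Q)
    (hcodim : (c <= n)%N /\ size Q = (n - c).+1)
    (r : nat -> nat) (d : forall i, 'I_(r i) -> nat)
    (phi : forall i, 'M[{mpoly k[n]}]_(r i, r i.+1))
    (hres : min_graded_free_res (maxminor_ideal A) d phi) :
  (\prod_(i < c) (minshift d i.+1)%:R) / (c`!)%:R <= multiplicity Q /\
  multiplicity Q <= (\prod_(i < c) (maxshift d i.+1)%:R) / (c`!)%:R.
Proof.
case: hcodim => cn sQ; apply/andP.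
(* If 1 were in the ideal, [H] and then [Q] would vanish, while [size Q] is positive. *)
have proper : ~ minors_ideal A 1.
  move=> h1; have H0 e : H e = 0%N.
    have [[p [p1 p2]] _] := hH e; case E : (H e) p p1 p2 => [//|m] p p1 p2.
    have hm : maxminor_ideal A (\sum_(x < m.+1) 1 *: p x).
      by rewrite -[X in maxminor_ideal A X]mulr1; apply: (idealM _ (minors_is_ideal A)).
    by have /eqP := p2 (fun=> 1) hm ord0; rewrite oner_eq0.
  have Q0 : Q = 0.
    case: hQ => d0 h; apply: (@poly_eventually_eq _ _ d0) => D /h <-.
    by rewrite horner0 big1.
  by move: sQ; rewrite Q0 size_poly0.
have [a0 [b0 hab]] := homogeneous_mxdeg hA.
have [t' [A' [a' [b' [t0 hA' hmin' hI']]]]] := minimal_reduction hab proper.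
have s0 : (0 < t' + c.-1)%N by rewrite addn_gt0 t0.
have [si [a [ma ha]]] := sort_perm a' s0.
have [ta [b [mb hb]]] := sort_perm b' t0.
have hA2 : mxdeg (mxsub ta si A') (fun j => a j) (fun i => b i).
  by move=> i j mm; rewrite mxE => /hA'; rewrite ha hb.
have hmin2 i j : (mxsub ta si A' i j)@_0%MM = 0 by rewrite mxE.
have hI2 p : maxminor_ideal A p <-> minors_ideal (mxsub ta si A') p :=
  iff_trans (hI' p) (iff_sym (minors_permP ta si A' p)).
have hcn : (0 < c <= n)%N by rewrite hc.
exact: (minors_ideal_bounds hA2 hmin2 ma mb t0 hcn hI2 hH hQ sQ hres).
Qed.
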